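(* Let $V_{\min},V_{\max}\in \mathbf{W}^{2,\infty}((0,1),\mathbb{R}^+)$ and $f(\rho,w)=\rho\,\big((1-w)V_{\min}(\rho)+wV_{\max}(\rho)\big)$ satisfy: (a) $V_{\min},V_{\max}$ are non-increasing, $V_{\min}\le V_{\max}$ and $V_{\min}(1)=V_{\max}(1)=0$; (b) there exists $\eta>0$ such that $\partial_\rho^2 f(\rho,w)<-\eta$ for all $(\rho,w)\in[0,1]^2$; (c) $\varepsilon\in(0,1)$ is such that $V_{\min}(\rho)=V_{\max}(\rho)$ for all $\rho\in[0,\varepsilon]$. Fix $\rho_o\in \mathbf{L}^\infty(\mathbb{R},[\varepsilon,1])$ and $w_o\in\mathbf{BV}(\mathbb{R},[0,1])$. Then there exists a weak solution $(\rho,w)$ to $$\partial_t\rho+\partial_x\big(f(\rho,w)\big)=0,\qquad \partial_t(\rho w)+\partial_x\big(f(\rho,w)w\big)=0$$ with initial datum $(\rho_o,w_o)$. If moreover $w_o$ is piecewise constant, then $(\rho,w)$ is an entropy solution of this system with initial datum $(\rho_o,w_o)$.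
   Context: Conventions. $\mathbb{R}^+=[0,+\infty)$. $\mathbf{BV}(\mathbb{R},[0,1])$ denotes the $[0,1]$-valued functions of finite total variation (not necessarily integrable). Since $V_{\min},V_{\max}$ are only $\mathbf{W}^{2,\infty}$, $\partial^2_\rho f$ is a weak derivative and (b) is understood for a.e. $\rho$. The Kruzhkov entropy flux is $\Phi(\rho,w,k)=\operatorname{sgn}(\rho-k)(f(\rho,w)-f(k,w))$ for $\rho,w,k\in[0,1]$. Weak solution. $(\rho,w)\in\mathbf{L}^\infty(\mathbb{R}^+\times\mathbb{R},[0,1])^2$ is a weak solution with initial datum $(\rho_o,w_o)$ if for all $\phi\in\mathbf{C}_c^\infty(\mathbb{R}^+\times\mathbb{R},\mathbb{R})$, $$\int_0^{+\infty}\!\!\int_{\mathbb{R}}(\rho\,\partial_t\phi+f(\rho,w)\partial_x\phi)\,dx\,dt+\int_{\mathbb{R}}\rho_o(x)\phi(0,x)\,dx=0$$ and $$(\mathrm{W})\quad \int_0^{+\infty}\!\!\int_{\mathbb{R}}(\rho w\,\partial_t\phi+f(\rho,w)w\,\partial_x\phi)\,dx\,dt+\int_{\mathbb{R}}\rho_o(x)w_o(x)\phi(0,x)\,dx=0.$$ Piecewise constant datum. $w_o$ is piecewise constant if there are $M\in\mathbb{N}\setminus\{0\}$, real numbers $d_1<\dots<d_M$ and values $a_0,\dots,a_M\in[0,1]$ with $w_o=a_0$ on $(-\infty,d_1)$, $w_o=a_m$ on $[d_m,d_{m+1})$ for $1\le m\le M-1$, $w_o=a_M$ on $[d_M,+\infty)$.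 Entropy solution (for piecewise constant $w_o$, i.e. $w_o=a_0$ on $(-\infty,d_1)$, $w_o=a_m$ on $[d_m,d_{m+1})$ for $1\le m\le M-1$, $w_o=a_M$ on $[d_M,+\infty)$, with $M\in\mathbb{N}\setminus\{0\}$, real numbers $d_1<\dots<d_M$ and values $a_0,\dots,a_M\in[0,1]$). $(\rho,w)\in\mathbf{L}^\infty(\mathbb{R}^+\times\mathbb{R},[0,1])^2$ is an entropy solution with initial datum $(\rho_o,w_o)$ if: (d1) there exist $M$ ordered curves $y_m\in\mathbf{Lip}((t_m,T_m),\mathbb{R})$ such that, with $\Gamma_m=\{(t,y_m(t)):t\in[t_m,T_m)\}$, $w$ is constant in each connected component of $(\mathbb{R}^+\times\mathbb{R})\setminus\bigcup_{m=1}^M\Gamma_m$; (d2) for all $\varphi\in\mathbf{C}_c^\infty(\mathbb{R}^+\times\mathbb{R},\mathbb{R}^+)$ and all $k\in[0,1]$, $$\int_0^{+\infty}\!\!\int_{\mathbb{R}}\big(|\rho-k|\partial_t\varphi+\Phi(\rho,w,k)\partial_x\varphi\big)dx\,dt+\int_{\mathbb{R}}|\rho_o(x)-k|\varphi(0,x)dx+\sum_{m=1}^M\int_{t_m}^{T_m}\big|f(k,w(t,y_m(t)+))-f(k,w(t,y_m(t)-))\big|\varphi(t,y_m(t))dt\ge0,$$ where $w(t,y_m(t)\pm)$ are the one-sided limits in $x$; (d3) (W) holds for all $\phi\in\mathbf{C}_c^\infty(\mathbb{R}^+\times\mathbb{R},\mathbb{R})$. In the last sentence of the claim, $(\rho,w)$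 is the solution whose existence is asserted: for piecewise constant $w_o$ there exists a weak solution that is also an entropy solution. *)

(* Defs.v *)
From HB Require Import structures.
From mathcomp Require Import all_boot all_order all_algebra.
From mathcomp Require Import all_classical all_reals all_analysis.
Set Implicit Arguments.
Unset Strict Implicit.
Unset Printing Implicit Defensive.
Import Order.TTheory GRing.Theory Num.Theory.
Import numFieldNormedType.Exports.
Local Open Scope classical_set_scope.
Local Open Scope ring_scope.

(* Elements of L^oo(D, I) are represented by (Borel) measurable functions with
   values in I almost everywhere on D. *)
Definition Linf (d : measure_display) (T : measurableType d) (R : realType)
    (mu : {measure set T -> \bar R}) (D : set T) (I : set R) (u : T -> R) : Prop :=
  measurable_fun D u /\ {ae mu, forall x, D x -> I (u x)}.

Definition Linf_unit_interval (R : realType) (u : R -> R) : Prop :=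
  exists C : R, Linf (@lebesgue_measure R) `]0, 1[ `[- C, C] u.

(* C_c^oo((0,1)): the closure of the support, taken in R, lies in ]0, 1[ and is
   therefore compact. *)
Definition test_unit_interval (R : realType) (phi : R -> R) : Prop :=
  (forall (n : nat) (x : R), derivable (derive1n n phi) x 1) /\
  closure [set x | phi x != 0] `<=` `]0, 1[.

Definition weak_derivative (R : realType) (n : nat) (u g : R -> R) : Prop :=
  Linf_unit_interval g /\
  forall phi : R -> R, test_unit_interval phi ->
    \int[@lebesgue_measure R]_(x in `]0, 1[) (u x * derive1n n phi x) =
    (-1) ^+ n * \int[@lebesgue_measure R]_(x in `]0, 1[) (g x * phi x).

(* W^{2,oo}((0,1), R^+).  An element is identified with its representative that
   is continuous up to the boundary, so that its values on [0, 1] make sense. *)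
Definition W2inf_nonneg (R : realType) (V : R -> R) : Prop :=
  [/\ {within `[0, 1], continuous V},
      forall x, 0 <= x <= 1 -> 0 <= V x,
      Linf_unit_interval V
    & forall n : nat, (1 <= n <= 2)%N -> exists g, weak_derivative n V g].

Definition flux (R : realType) (Vmin Vmax : R -> R) (rho w : R) : R :=
  rho * ((1 - w) * Vmin rho + w * Vmax rho).

Definition kruzhkov_flux (R : realType) (f : R -> R -> R) (rho w k : R) : R :=
  Num.sg (rho - k) * (f rho w - f k w).

Definition BV (R : realType) (u : R -> R) : Prop :=
  (ereal_sup [set total_variation p.1 p.2 u | p in [set p : R * R | p.1 <= p.2]%R]
   < +oo)%E.

(* Points of the half-plane R^+ x R are pairs (time, position). *)
Definition half_plane (R : realType) : set (R * R) := `[0, +oo[ `*` setT.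

Definition dt (R : realType) (phi : R * R -> R) : R * R -> R := 'D_(1, 0) phi.
Definition dx (R : realType) (phi : R * R -> R) : R * R -> R := 'D_(0, 1) phi.

Fixpoint Cn (R : realType) (n : nat) (phi : R * R -> R) : Prop :=
  continuous phi /\
  if n is n'.+1 then
    [/\ forall p, derivable phi p (1, 0), forall p, derivable phi p (0, 1),
        Cn n' (dt phi) & Cn n' (dx phi)]
  else True.

(* C_c^oo(R^+ x R), smooth up to the boundary t = 0 and not required to vanish
   there: such functions are exactly the restrictions to the half-plane of the
   smooth compactly supported functions on R^2. *)
Definition test_half_plane (R : realType) (phi : R * R -> R) : Prop :=
  (forall n, Cn n phi) /\ compact (closure [set p | phi p != 0]).

Definition int_half_plane (R : realType) (F : R * R -> R) : R :=
  \int[@lebesgue_measure R]_(t in `[0, +oo[) \int[@lebesgue_measure R]_x F (t, x).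

Definition Linf_half_plane (R : realType) (u : R * R -> R) : Prop :=
  Linf (@lebesgue_measure R \x @lebesgue_measure R)%E
       (@half_plane R) `[0, 1] u.

Definition weak_form_rho (R : realType) (f : R -> R -> R) (rhoo : R -> R)
    (rho w : R * R -> R) : Prop :=
  forall phi, test_half_plane phi ->
    int_half_plane (fun p => rho p * dt phi p + f (rho p) (w p) * dx phi p)
    + \int[@lebesgue_measure R]_x (rhoo x * phi (0, x)) = 0.

Definition weak_form_rhow (R : realType) (f : R -> R -> R) (rhoo wo : R -> R)
    (rho w : R * R -> R) : Prop :=
  forall phi, test_half_plane phi ->
    int_half_plane
      (fun p => rho p * w p * dt phi p + f (rho p) (w p) * w p * dx phi p)
    + \int[@lebesgue_measure R]_x (rhoo x * wo x * phi (0, x)) = 0.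

Definition weak_solution (R : realType) (f : R -> R -> R) (rhoo wo : R -> R)
    (rho w : R * R -> R) : Prop :=
  [/\ Linf_half_plane rho, Linf_half_plane w,
      weak_form_rho f rhoo rho w & weak_form_rhow f rhoo wo rho w].

(* Only d 1, ..., d M and a 0, ..., a M are meaningful. *)
Definition piecewise_constant (R : realType) (M : nat) (d a : nat -> R)
    (wo : R -> R) : Prop :=
  [/\ (0 < M)%N,
      forall m, (1 <= m < M)%N -> d m < d m.+1,
      forall m, (m <= M)%N -> 0 <= a m <= 1
    & [/\ forall x, x < d 1%N -> wo x = a 0%N,
          forall m x, (1 <= m < M)%N -> d m <= x < d m.+1 -> wo x = a m
        & forall x, d M <= x -> wo x = a M]].

(* The interval [t, T), where T may be +oo. *)
Definition lifespan (R : realType) (t : R) (T : \bar R) : set R :=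
  [set s | (t <= s) && (s%:E < T)%E].

Definition curve_graph (R : realType) (t : R) (T : \bar R) (y : R -> R) :
    set (R * R) := [set p | lifespan t T p.1 /\ p.2 = y p.1].

(* Only the indices 1 <= m <= M are meaningful.  A Lipschitz function on
   (t_m, T_m) extends to t_m in a unique way by continuity, hence the Lipschitz
   condition on [t_m, T_m), the interval over which Gamma_m is taken. *)
Definition ordered_curves (R : realType) (M : nat) (t : nat -> R)
    (T : nat -> \bar R) (y : nat -> R -> R) : Prop :=
  (forall m, (1 <= m <= M)%N ->
    [/\ 0 <= t m, ((t m)%:E < T m)%E
      & [lipschitz y m s | s in lifespan (t m) (T m)]]) /\
  (forall m m', (1 <= m)%N -> (m < m')%N -> (m' <= M)%N ->
    forall s, lifespan (t m) (T m) s -> lifespan (t m') (T m') s ->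
      y m s < y m' s).

Definition curves_complement (R : realType) (M : nat) (t : nat -> R)
    (T : nat -> \bar R) (y : nat -> R -> R) : set (R * R) :=
  @half_plane R `\`
  \bigcup_(m in [set m | (1 <= m <= M)%N]) curve_graph (t m) (T m) (y m).

Definition entropy_inequality (R : realType) (f : R -> R -> R) (rhoo : R -> R)
    (rho w : R * R -> R) (M : nat) (t : nat -> R) (T : nat -> \bar R)
    (y : nat -> R -> R) : Prop :=
  forall (phi : R * R -> R) (k : R), test_half_plane phi ->
    (forall p, half_plane p -> 0 <= phi p) -> 0 <= k <= 1 ->
    0 <= int_half_plane (fun p => `|rho p - k| * dt phi p
                                  + kruzhkov_flux f (rho p) (w p) k * dx phi p)
         + \int[@lebesgue_measure R]_x (`|rhoo x - k| * phi (0, x))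
         + \sum_(1 <= m < M.+1)
             \int[@lebesgue_measure R]_(s in lifespan (t m) (T m))
               (`|f k (lim (w (s, x) @[x --> (y m s)^'+]))
                  - f k (lim (w (s, x) @[x --> (y m s)^'-]))| * phi (s, y m s)).

(* M, the number of curves, is the number of points d_m in the description of wo. *)
Definition entropy_solution (R : realType) (f : R -> R -> R) (M : nat)
    (rhoo wo : R -> R) (rho w : R * R -> R) : Prop :=
  [/\ Linf_half_plane rho, Linf_half_plane w,
      exists (t : nat -> R) (T : nat -> \bar R) (y : nat -> R -> R),
        [/\ ordered_curves M t T y,
            forall p q, connected_component (curves_complement M t T y) p q ->
              w p = w q
          & entropy_inequality f rhoo rho w M t T y]
    & weak_form_rhow f rhoo wo rho w].

(* Main.v *)
(** In the mass coordinate X the system becomes x_X = 1 / rho, x_t = V(rho, W(X)),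
with W constant in time, V = f / rho and rho the density along the trajectory
x(., X).  The trajectories are approximated by the follow-the-leader scheme with
mass step h and a proportional time step.  It keeps rho in [eps, 1] because V does
not depend on w on [0, eps] and vanishes at rho = 1.  As rho |-> rho V is strongly
concave, V is a strongly concave function of the specific volume 1 / rho, and the
velocity of each particle satisfies the one-sided bound v(s) - v(t) <= K (s - t) / t.
Hence, along a subsequence for which the equi-Lipschitz trajectories converge, the
velocities converge for all but countably many times, for almost every X; since V
is strictly decreasing in rho, the densities converge almost everywhere.  The weak
formulations, and the entropy inequalities derived from a discrete entropy
inequality for |1 - k / rho|, pass to the limit by dominated convergence, and the
change of variables y = x(t, X) brings them back to Eulerian coordinates.  There
w(t, x(t, X)) = W(X), so that the discontinuities of a piecewise constant w are
carried by the particle trajectories. *)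

(* No uniform modulus of continuity in X is available: the initial density is merely bounded and W
   may jump between neighbouring particles. All compactness is therefore gained in time, on one
   trajectory at a time, with W(X) as a frozen parameter; the labels X are put together afterwards
   by Tonelli's theorem. The constant K of the one-sided bound is uniform in W because a particle is
   compared with its leader only through velocity increments: if all increments of one step are at
   most m, those of the next are at most m - m^2 / K, and K / (n + 4) is a supersolution of this
   recursion. The compactness argument does not apply to the leader X + h, which is another particle
   for each h; its velocity is recovered from the update of the specific volume. Test functions are
   pulled back to the particles, where every function of the label alone is conserved exactly: the
   weights 1 and W give the two equations at once. The bounds eps <= rho <= 1 keep the trajectories
   bi-Lipschitz in X, so that the return to Eulerian coordinates is a change of variables by a
   homeomorphism at almost every time. *)
Require Import Defs.
From HB Require Import structures.
From mathcomp Require Import all_boot all_order all_algebra.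
From mathcomp Require Import all_classical all_reals all_analysis.
From mathcomp Require Import measurable_realfun.
From mathcomp Require Import ring lra.
Import Order.TTheory GRing.Theory Num.Theory.
Import numFieldNormedType.Exports.
Local Open Scope classical_set_scope.
Local Open Scope ring_scope.

(** * The particle scheme *)

Section concave_step.
Context (R : realType).
Variables (H : R -> R) (Tm A kap lam : R).
Hypothesis A0 : 0 < A.
Hypothesis kap0 : 0 < kap.
Hypothesis lam0 : 0 < lam.
Hypothesis CFL : A * lam <= 2^-1.
Hypothesis H_ndecr : forall x y, 1 <= x -> x <= y -> y <= Tm -> H x <= H y.
Hypothesis H_lip : forall x y, 1 <= x -> x <= y -> y <= Tm ->
  H y - H x <= A * (y - x).
Hypothesis H_conc : forall x y z, 1 <= x -> x < y -> y < z -> z <= Tm ->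
  kap * (z - x) * ((z - y) * (y - x)) <=
  (H y - H x) * (z - y) - (H z - H y) * (y - x).

(** Strong concavity makes the chord slope of [H] drop from one step to the next by an amount that
    costs a term quadratic in the velocity increment. Here [x], [y], [z] are successive specific
    volumes of a particle, [d] and [d'] the velocity of the leader minus its own, [up] and
    [H y - H x] the increments of the two velocities. The outcome [m - m ^+ 2 / K] is an explicit
    Euler step for m' = - m^2 / K, whose solutions decay like K / t. *)
Lemma concave_step (x d d' up m K : R) :
  let y := x + lam * d in let z := y + lam * d' in
  1 <= x <= Tm -> 1 <= y <= Tm -> 1 <= z <= Tm ->
  d' = d + (up - (H y - H x)) ->
  up <= m -> H y - H x <= m -> 0 <= m -> 0 < K -> 4 * m <= K ->
  A ^+ 2 <= kap * K ->
  H z - H y <= m - m ^+ 2 / K.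
Proof.
move=> y z /andP[x1 xT] /andP[y1 yT] /andP[z1 zT] d'E upm um m0 K0 mK AK.
have KV0 : 0 < K^-1 by rewrite invr_gt0.
have KKV : K * K^-1 = 1 by rewrite divff// gt_eqF.
have m2 : m ^+ 2 / K <= m / 4.
  have -> : m / 4 = m * K / 4 / K by field; lra.
  rewrite ler_pM2r//; nra.
(* If the volume does not grow in the second step, the increment is nonpositive, while the target is
   at least [3 * m / 4]. *)
have [d'0|d'0] := leP d' 0.
  have zy : z <= y by rewrite /z gerDl pmulr_rle0.
  have := H_ndecr z y z1 zy yT; lra.
have yz : y < z by rewrite /z ltrDl pmulr_rgt0.
have := H_lip y z y1 (ltW yz) zT.
have Hzy := H_ndecr y z y1 (ltW yz) zT.
have zyE : z - y = lam * d' by rewrite /z; ring.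
rewrite zyE => Lzy.
have ld' : 0 < lam * d' by rewrite mulr_gt0.
pose s := (H z - H y) / (lam * d').
have sE : H z - H y = s * (lam * d') by rewrite /s divfK// gt_eqF.
have s0 : 0 <= s by rewrite /s divr_ge0// ?subr_ge0// ltW.
have sA : s <= A by rewrite /s ler_pdivrMr//.
have sl : s * lam <= 2^-1 by apply: le_trans CFL; rewrite ler_pM2r.
have sl0 : 0 <= s * lam by rewrite mulr_ge0// ltW.
(* If the volume shrinks and then grows, the CFL condition gives [H x - H y <= - d / 2], hence
   [d' <= up <= m], and the slope bound [s * lam <= 2^-1] leaves at most [m / 2]. *)
have [d0|d0] := leP d 0.
  have yx : y <= x by rewrite /y gerDl pmulr_rle0.
  have := H_lip y x y1 yx xT; have := H_ndecr y x y1 yx xT.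
  have -> : x - y = lam * - d by rewrite /y; ring.
  move=> H1 H2.
  have H3 : A * (lam * - d) <= 2^-1 * - d by rewrite mulrA ler_wpM2r// lerNr oppr0.
  rewrite sE mulrA d'E.
  have : s * lam * (d + (up - (H y - H x))) <= s * lam * m.
    by rewrite ler_wpM2l//; lra.
  nra.
have xy : x < y by rewrite /y ltrDl pmulr_rgt0.
have := H_conc x y z x1 xy yz zT.
have yxE : y - x = lam * d by rewrite /y; ring.
have zxE : z - x = lam * d + lam * d' by rewrite /z /y; ring.
rewrite zyE yxE zxE sE => C1.
have u0 := H_ndecr x y x1 (ltW xy) yT.
have := H_lip x y x1 (ltW xy) yT; rewrite yxE => Lu.
set u := H y - H x in d'E um C1 Lu *.
have {}u0 : 0 <= u by rewrite subr_ge0.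
have ld : 0 < lam * d by rewrite mulr_gt0.
(* dividing the concavity inequality by [lam * d'] *)
have C2 : kap * (lam * d) ^+ 2 <= u - s * (lam * d).
  have : kap * (lam * d + lam * d') * (lam * d) <= u - s * (lam * d).
    rewrite -(ler_pM2r ld'); nra.
  by apply: le_trans; rewrite expr2 mulrA ler_pM2r// ler_pM2l//; lra.
have C3 : u ^+ 2 / K <= kap * (lam * d) ^+ 2.
  rewrite ler_pdivrMr//.
  have : u ^+ 2 <= A ^+ 2 * (lam * d) ^+ 2.
    by rewrite -exprMn ler_pXn2r// nnegrE// mulr_ge0// ltW.
  move=> /le_trans; apply.
  by rewrite [leRHS]mulrAC ler_wpM2r// sqr_ge0.
have E1 : s * (lam * d') <= u - u ^+ 2 / K + s * lam * (m - u).
  rewrite d'E.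
  have -> : s * (lam * (d + (up - u))) = s * (lam * d) + s * lam * (up - u) by ring.
  apply: lerD; first lra.
  by rewrite ler_wpM2l// lerB.
have E2 : s * lam * (m - u) <= 2^-1 * (m - u) by rewrite ler_wpM2r// subr_ge0.
(* The left side is nondecreasing in [u] up to [m], because [(m + u) / K <= 2^-1] by [4 * m <= K];
   the worst case is [u = m]. *)
suff : u - u ^+ 2 / K + 2^-1 * (m - u) <= m - m ^+ 2 / K by lra.
have E3 : (m ^+ 2 - u ^+ 2) / K <= 2^-1 * (m - u).
  rewrite ler_pdivrMr// subr_sqr (mulrC 2^-1) -mulrA ler_wpM2l//; lra.
move: E3; rewrite mulrBl; lra.
Qed.

End concave_step.

Section scheme.
Context (R : realType).
Variables (H : int -> R -> R) (Tm cm A kap lam h : R) (x0 : int -> R).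

(** Explicit Euler scheme for follow-the-leader dynamics with time step [lam * h]: the particles
    carry mass [h], so the gap to the leader divided by [h] is the specific volume, and [H i] is the
    speed as a function of it. Its dependence on [i] carries the parameter w. *)
Fixpoint pos (n : nat) (i : int) : R :=
  if n is n'.+1 then
    pos n' i + lam * h * H i ((pos n' (i + 1) - pos n' i) / h)
  else x0 i.

Definition tau n i := (pos n (i + 1) - pos n i) / h.
Definition vel n i := H i (tau n i).

Hypothesis h0 : 0 < h.
Hypothesis A0 : 0 < A.
Hypothesis kap0 : 0 < kap.
Hypothesis lam0 : 0 < lam.
Hypothesis CFL : A * lam <= 2^-1.
Hypothesis Tm1 : 1 <= Tm.
Hypothesis H1 : forall i, H i 1 = 0.
Hypothesis HT : forall i, H i Tm = cm.
Hypothesis H_ndecr : forall i x y, 1 <= x -> x <= y -> y <= Tm ->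
  H i x <= H i y.
Hypothesis H_lip : forall i x y, 1 <= x -> x <= y -> y <= Tm ->
  H i y - H i x <= A * (y - x).
Hypothesis H_conc : forall i x y z, 1 <= x -> x < y -> y < z -> z <= Tm ->
  kap * (z - x) * ((z - y) * (y - x)) <=
  (H i y - H i x) * (z - y) - (H i z - H i y) * (y - x).
Hypothesis x0P : forall i, h <= x0 (i + 1) - x0 i <= Tm * h.

Lemma posS n i : pos n.+1 i = pos n i + lam * h * vel n i.
Proof. by []. Qed.

Lemma tauS n i : tau n.+1 i = tau n i + lam * (vel n (i + 1) - vel n i).
Proof. by rewrite /tau !posS; field; rewrite gt_eqF. Qed.

Lemma velP x i : 1 <= x <= Tm -> 0 <= H i x <= cm.
Proof.
move=> /andP[x1 xT]; rewrite -{1}(H1 i) -(HT i).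
by rewrite !H_ndecr// ?lexx.
Qed.

(** Both ends of the segment are barriers: [H i] vanishes at 1 and takes at [Tm] the maximal speed
    [cm], the same for all particles. The velocity of the leader, lying between 0 and [cm], cannot
    push the volume out, and by the CFL condition the particle's own velocity consumes at most half
    of the distance to a barrier. *)
Lemma tauP n i : 1 <= tau n i <= Tm.
Proof.
elim: n i => [|n ih] i.
  by rewrite /tau /= ler_pdivlMr// mul1r ler_pdivrMr.
rewrite tauS; have /andP[t1 tT] := ih i.
have /andP[v0 v1] := velP (tau n (i + 1)) (i + 1) (ih (i + 1)).
rewrite -/(vel _ _) in v0 v1.
have := H_lip i 1 (tau n i) (lexx _) t1 tT; rewrite H1 -/(vel n i) => L1.
have := H_lip i (tau n i) Tm t1 tT (lexx _); rewrite HT -/(vel n i) => L2.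
have a1 : A * (tau n i - 1) * lam <= 2^-1 * (tau n i - 1).
  by rewrite mulrAC ler_wpM2r// subr_ge0.
have a2 : A * (Tm - tau n i) * lam <= 2^-1 * (Tm - tau n i).
  by rewrite mulrAC ler_wpM2r// subr_ge0.
have := ler_wpM2r (ltW lam0) L1; have := ler_wpM2r (ltW lam0) L2.
have := ler_wpM2r (ltW lam0) v0; have := ler_wpM2r (ltW lam0) v1.
by move=> ? ? ? ?; apply/andP; split; lra.
Qed.

Lemma vel_bounds n i : 0 <= vel n i <= cm.
Proof. exact/velP/tauP. Qed.

Lemma cm_ge0 : 0 <= cm.
Proof. by have /andP[] := vel_bounds 0 0; apply: le_trans. Qed.

(* Discrete counterpart of the one-sided bound [v_t <= K / t]. *)
Lemma vel_step n i (K : R) : 0 < K -> 16 * cm <= K -> A ^+ 2 <= kap * K ->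
  vel n.+1 i - vel n i <= K / (n + 4)%:R.
Proof.
move=> K0 cK AK; elim: n i => [|n ih] i.
  have /andP[_ v1] := vel_bounds 1 i; have /andP[v0 _] := vel_bounds 0 i.
  rewrite add0n ler_pdivlMr// ?ltr0n//; have := cm_ge0; lra.
(* The offset 4 provides [4 * m <= K], which [concave_step] requires; the base case is
   [4 * cm <= K]. The induction then closes because [m - m ^+ 2 / K] falls short of the next term of
   the sequence by [K / ((N + 1) * N ^+ 2)], with N = n + 4. *)
set m := K / (n + 4)%:R.
have n40 : 0 < (n + 4)%:R :> R by rewrite ltr0n addn_gt0 orbT.
have n4 : 4 <= (n + 4)%:R :> R by rewrite ler_nat leq_addl.
have m0 : 0 < m by rewrite divr_gt0.
apply: (@le_trans _ _ (m - m ^+ 2 / K)); last first.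
  have -> : (n.+1 + 4)%:R = (n + 4)%:R + 1 :> R by rewrite addSn natr1.
  rewrite /m; set N := (n + 4)%:R in n40 n4 *.
  rewrite -subr_ge0.
  have -> : K / (N + 1) - (K / N - (K / N) ^+ 2 / K) =
            K / ((N + 1) * N ^+ 2).
    by field; rewrite !gt_eqF//; lra.
  by rewrite divr_ge0 ?mulr_ge0 ?sqr_ge0//; lra.
have tE := tauS n i; have tE' := tauS n.+1 i.
have := @concave_step R (H i) Tm A kap lam A0 kap0 lam0 CFL (H_ndecr i) (H_lip i) (H_conc i)
  (tau n i) (vel n (i + 1) - vel n i) (vel n.+1 (i + 1) - vel n.+1 i)
  (vel n.+1 (i + 1) - vel n (i + 1)) m K.
rewrite /= -tE -tE'; apply => //; try exact: tauP; try exact: ih.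
- by rewrite -/(vel n.+1 i) -/(vel n i); ring.
- exact: ltW.
- by rewrite /m mulrA ler_pdivrMr// mulrC ler_wpM2l// ltW.
Qed.

(** Each of the steps from [n] to [N] adds at most [K / n.+1] by [vel_step]. Multiplied by the time
    step, [N - n] becomes s - t and [n.+1] becomes t plus one step, so this is the bound K (s - t) /
    t. *)
Lemma vel_osl n N i (K : R) : 0 < K -> 16 * cm <= K -> A ^+ 2 <= kap * K ->
  (n <= N)%N -> vel N i - vel n i <= (N - n)%:R * (K / n.+1%:R).
Proof.
move=> K0 cK AK /subnKC <-; rewrite addKn.
elim: (N - n)%N => [|p ih]; first by rewrite addn0 subrr mul0r.
have := vel_step (n + p) i K K0 cK AK.
have : K / (n + p + 4)%:R <= K / n.+1%:R.
  rewrite ler_pM2l// lef_pV2 ?posrE ?ltr0n ?addn_gt0 ?orbT// ler_nat.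
  by rewrite -addnA -addn1 leq_add2l addn_gt0 orbT.
rewrite [(n + p.+1)%N]addnS -[p.+1%:R]natr1 mulrDl mul1r.
move: ih; set q := K / n.+1%:R; set q' := K / (n + p + 4)%:R => ih s1 s2.
have -> : vel (n + p).+1 i - vel n i =
  (vel (n + p) i - vel n i) + (vel (n + p).+1 i - vel (n + p) i) by ring.
exact: lerD ih (le_trans s2 s1).
Qed.

Lemma posB n N i : (n <= N)%N ->
  pos N i - pos n i = lam * h * \sum_(n <= l < N) vel l i.
Proof.
move=> nN; rewrite -(telescope_sumr (fun l => pos l i) nN) big_distrr/=.
by apply: eq_bigr => l _; have -> : pos l.+1 i - pos l i = lam * h * vel l i
  by rewrite posS addrAC subrr add0r.
Qed.

Lemma pos_lip_t n N i : (n <= N)%N ->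
  0 <= pos N i - pos n i <= lam * h * cm * (N - n)%:R.
Proof.
move=> nN; rewrite posB//; have lh : 0 < lam * h by rewrite mulr_gt0.
apply/andP; split.
  by rewrite mulr_ge0 ?(ltW lh)// sumr_ge0// => l _; have /andP[] := vel_bounds l i.
rewrite -[leRHS]mulrA ler_pM2l// mulr_natr -sumr_const_nat.
by rewrite ler_sum// => l _; have /andP[] := vel_bounds l i.
Qed.

Lemma pos_mono_x n i j (p : nat) : j = i + p%:Z ->
  h * p%:R <= pos n j - pos n i <= Tm * h * p%:R.
Proof.
move=> ->; elim: p => [|p /andP[ih1 ih2]].
  by rewrite addr0 subrr !mulr0 lexx.
have /andP[t1 t2] := tauP n (i + p%:Z).
have e : pos n (i + p.+1%:Z) - pos n (i + p%:Z) = h * tau n (i + p%:Z).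
  by rewrite /tau -addrA -[p%:Z + 1]/((p + 1)%:Z) addn1; field; rewrite gt_eqF.
have : h * 1 <= h * tau n (i + p%:Z) <= h * Tm by rewrite !ler_pM2l// t1.
rewrite -e -!natr1 !mulrDr !mulr1 (mulrC h Tm) => /andP[? ?].
by apply/andP; split; lra.
Qed.

(* [k^-1] is the specific volume of the constant state [k]; multiplying by [k]
   makes the inequality meaningful for [k = 0] too. *)
Lemma scheme_entropy n i (k g g' : R) : 0 <= k ->
  lam * k * `|vel n i - g| <= `|1 - k * tau n i| ->
  (vel n i - g) * (1 - k * tau n i) <= 0 ->
  `|1 - k * tau n.+1 i| <= `|1 - k * tau n i|
    + lam * k * (`|vel n (i + 1) - g'| - `|vel n i - g|) + lam * k * `|g' - g|.
Proof.
move=> k0 small sgn; rewrite tauS.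
have lk : 0 <= lam * k by rewrite mulr_ge0// ltW.
set v := vel n i in small sgn *; set v' := vel n (i + 1).
set a := 1 - k * tau n i in small sgn *.
have -> : 1 - k * (tau n i + lam * (v' - v)) =
    (a + lam * k * (v - g)) - lam * k * (v' - g') - lam * k * (g' - g).
  by rewrite /a; ring.
(* [a] and [v - g] have opposite signs and [small] prevents the correction from overshooting 0, so
   it shrinks [|a|] by exactly its own size: this is the dissipation of the scheme. *)
have E : `|a + lam * k * (v - g)| = `|a| - lam * k * `|v - g|.
  have [a0|a0] := leP 0 a.
    have [vg|vg] := leP (v - g) 0.
      rewrite (ler0_norm vg) in small *; rewrite (ger0_norm a0) in small *.
      rewrite ger0_norm; [ring|lra].
    have : a = 0 by apply/eqP; rewrite eq_le a0 andbT; nra.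
    move=> a00; rewrite a00 in small *; rewrite normr0 in small *.
    have : lam * k * `|v - g| = 0.
      by apply/eqP; rewrite eq_le small mulr_ge0.
    by move=> e; rewrite add0r sub0r normrM (ger0_norm lk) e oppr0.
  have vg : 0 <= v - g by nra.
  rewrite (ger0_norm vg) in small *; rewrite (ltr0_norm a0) in small *.
  rewrite ler0_norm; [ring|lra].
apply: le_trans (ler_normB _ _) _; apply: le_trans (lerD (ler_normB _ _) (lexx _)) _.
rewrite E !normrM (ger0_norm k0) (gtr0_norm lam0); lra.
Qed.

End scheme.

(** * Change of variables *)

Lemma eq_indic (R : realType) (T U : Type) (A : set T) (B : set U) (a : T) (b : U) :
  (A a <-> B b) -> \1_A a = \1_B b :> R.
Proof.
move=> AB; rewrite !indicE; suff -> : (a \in A) = (b \in B) by [].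
by apply/idP/idP => /set_mem /AB ?; exact/mem_set.
Qed.

Lemma integral_indicT (R : realType) (A : set R) : measurable A ->
  (\int[@lebesgue_measure R]_z (\1_A z)%:E = lebesgue_measure A)%E.
Proof.
move=> mA; rewrite integral_indic//; congr (lebesgue_measure _).
exact: setIT.
Qed.

Section change_of_variables.
Context (R : realType).
Local Notation mu := (@lebesgue_measure R).
Variables (x y t : R -> R).
Hypothesis xy : cancel y x.
Hypothesis xmono : {mono x : a b / a <= b}.
Hypothesis mt : measurable_fun setT t.
Hypothesis t0 : forall a, 0 <= t a.
Hypothesis xt : forall a b, a <= b ->
  (\int[mu]_(z in `]a, b]) (t z)%:E = (x b - x a)%:E)%E.

Lemma homeo_measurable : measurable_fun setT x.
Proof. by apply: nondecreasing_measurable => // a b; rewrite xmono. Qed.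

Let mx := homeo_measurable.

(** The measure with density [t], pushed forward by [x], gives every interval ]a, b] its length, so
    it is the Lebesgue measure by uniqueness. In this way [t] acts as the derivative of [x] although
    [x] is never differentiated. *)
Lemma homeo_lebesgue_measure A : measurable A ->
  mu A = (\int[mu]_z (\1_A (x z) * t z)%:E)%E.
Proof.
pose nu (B : set (measurableTypeR R)) : \bar R := (\int[mu]_(z in B) (t z)%:E)%E.
have nu_ge0 B : (0 <= nu B)%E by apply: integral_ge0 => z _; rewrite lee_fin.
have nu_sigma : semi_sigma_additive nu.
  apply: semi_sigma_additive_nng_induced => [|z]; last by rewrite lee_fin.
  exact/measurable_EFinP.
have nu0 : nu set0 = 0%E by rewrite /nu integral_set0.
pose nuM := isMeasure.Build _ _ R nu nu0 nu_ge0 nu_sigma.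
pose nu' : {measure set (measurableTypeR R) -> \bar R} := HB.pack nu nuM.
pose x' : measurableTypeR R -> measurableTypeR R := x.
pose xm := isMeasurableFun.Build _ _ _ _ x' mx.
pose xf : {mfun measurableTypeR R >-> measurableTypeR R} := HB.pack x' xm.
have := @lebesgue_measure_unique R (pushforward nu' xf).
move=> U mA; rewrite U//; last first.
  move=> _ [[a b] /= _ <-]; rewrite /pushforward/=.
  have -> : x @^-1` `]a, b] = `]y a, y b]%classic.
    have ea z : (a < x z) = (y a < z) by rewrite -{1}(xy a) (leW_mono xmono).
    have eb z : (x z <= b) = (z <= y b) by rewrite -{1}(xy b) xmono.
    by apply/seteqP; split=> z /=; rewrite !in_itv/= ea eb.
  transitivity (nu `]y a, y b]%classic); last by [].
  rewrite /nu; have [ab|ab] := leP a b.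
    rewrite xt ?xy; last by rewrite -xmono !xy.
    rewrite lebesgue_measure_itv/= lte_fin; case: ltP => //= ba.
    by rewrite (le_anti (introT andP (conj ab ba))) subrr.
  rewrite set_itv_ge; last by rewrite bnd_simp -leNgt ltW.
  rewrite set_itv_ge ?integral_set0 ?measure0//.
  by rewrite bnd_simp -leNgt -xmono !xy ltW.
rewrite /pushforward/= [LHS]integral_mkcond; apply: eq_integral => z _.
rewrite /patch indicE; case: ifPn => zA.
  by rewrite mem_set ?mul1r//; exact: (set_mem zA).
rewrite memNset ?mul0r//; apply: contraNnot zA => Az.
exact: mem_set.
Qed.

(* Layer cake: [F z] is the length of [0, F z[. *)
Lemma homeo_integral_ge0 (F : R -> R) :
  measurable_fun setT F -> (forall z, 0 <= F z) ->
  (\int[mu]_z (F z)%:E = \int[mu]_z (F (x z) * t z)%:E)%E.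
Proof.
move=> mF F0.
have msub (f : R -> R) : measurable_fun setT f ->
    measurable [set p : R * R | 0 <= p.2 < f p.1].
  move=> mf.
  have -> : [set p : R * R | 0 <= p.2 < f p.1] =
     [set: R * R] `&` (snd @^-1` `[0, +oo[%classic `&`
        ((f \o fst) \- snd) @^-1` `]0, +oo[%classic).
    apply/seteqP; split => p /=; rewrite !in_itv/= !andbT subr_gt0.
      by move=> /andP[].
    by move=> [_ [-> ->]].
  rewrite setTI; apply: measurableI; rewrite -[X in measurable X]setTI.
    exact: measurable_snd.
  by apply: measurable_funB => //; exact: measurableT_comp.
have lc (f : R -> R) z : 0 <= f z ->
    (f z)%:E = (\int[mu]_s (\1_[set p : R * R | 0 <= p.2 < f p.1] (z, s))%:E)%E.
  move=> fz0; transitivity (\int[mu]_s (\1_(`[0, f z[%classic) s)%:E)%E.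
    rewrite integral_indicT// lebesgue_measure_itv/= lte_fin.
    by case: ltP => [_|]; rewrite ?sube0// => fz; apply/congr1/le_anti/andP.
  apply: eq_integral => s _; congr (_%:E); exact: eq_indic.
pose G := [set p : R * R | 0 <= p.2 < F p.1].
pose Gx := [set p : R * R | 0 <= p.2 < (F \o x) p.1].
have mG : measurable G by exact: msub.
have mGx : measurable Gx by apply: msub; exact: measurableT_comp.
transitivity (\int[mu]_z \int[mu]_s (\1_G (z, s))%:E)%E.
  by apply: eq_integral => z _; exact: lc.
transitivity (\int[mu]_s \int[mu]_z (\1_G (z, s))%:E)%E.
  apply: (@fubini_tonelli _ _ _ _ R mu mu (fun p => (\1_G p)%:E)) => //.
  by apply/measurable_EFinP; exact: measurable_indic.
transitivity (\int[mu]_s \int[mu]_z (\1_Gx (z, s) * t z)%:E)%E.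
  apply: eq_integral => s _.
  pose A := [set z | 0 <= s < F z].
  have mA : measurable A by have := measurable_ysection s mG; rewrite ysectionE.
  transitivity (\int[mu]_z (\1_A z)%:E)%E.
    by apply: eq_integral => z _; congr (_%:E); exact: eq_indic.
  rewrite integral_indicT// homeo_lebesgue_measure//.
transitivity (\int[mu]_z \int[mu]_s (\1_Gx (z, s) * t z)%:E)%E.
  apply/esym/(@fubini_tonelli _ _ _ _ R mu mu (fun p => (\1_Gx p * t p.1)%:E)) => [|p].
    apply/measurable_EFinP; apply: measurable_funM; first exact: measurable_indic.
    exact: measurableT_comp.
  by rewrite lee_fin mulr_ge0.
apply: eq_integral => z _; rewrite EFinM (lc (F \o x) z); last exact: F0.
under eq_integral do rewrite EFinM muleC.
rewrite ge0_integralZl ?lee_fin// 1?muleC//.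
apply/measurable_EFinP.
rewrite (_ : (fun s => _) = \1_(xsection Gx z)).
  by apply: measurable_indic; exact: measurable_xsection.
by apply/funext => s; apply: eq_indic; rewrite xsectionE.
Qed.

(** Multiplication by [t >= 0] commutes with taking positive and negative parts, so the nonnegative
    case applies to each part, integrable or not. *)
Lemma homeo_integral (F : R -> R) : measurable_fun setT F ->
  (\int[mu]_z (F z)%:E = \int[mu]_z (F (x z) * t z)%:E)%E.
Proof.
move=> mF; rewrite integralE [RHS]integralE.
have m0 : measurable_fun setT (cst 0 : R -> R) by [].
congr (_ - _)%E.
  transitivity (\int[mu]_z (Num.max (F z) 0)%:E)%E.
    by apply: eq_integral => z _; rewrite funeposE -EFin_max.
  rewrite homeo_integral_ge0//; first last.
  - by move=> z; rewrite le_max lexx orbT.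
  - exact: measurable_maxr.
  apply: eq_integral => z _; rewrite funeposE -EFin_max; congr EFin.
  by rewrite maxr_pMl// mul0r.
transitivity (\int[mu]_z (Num.max (- F z) 0)%:E)%E.
  by apply: eq_integral => z _; rewrite funenegE -EFinN -EFin_max.
rewrite homeo_integral_ge0//; first last.
- by move=> z; rewrite le_max lexx orbT.
- by apply: measurable_maxr => //; exact: measurableT_comp.
apply: eq_integral => z _; rewrite funenegE -EFinN -EFin_max; congr EFin.
by rewrite maxr_pMl// mul0r mulNr.
Qed.

End change_of_variables.

(** * Compactness tools *)

Lemma lip_continuous (R : realType) (f : R -> R) (L : R) :
  (forall x y, `|f x - f y| <= L * `|x - y|) -> continuous f.
Proof.
move=> fL x; apply/cvgrPdist_lt => e e0.
pose M := `|L| + 1; have M0 : 0 < M by rewrite ltr_wpDl.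
near=> y.
apply: le_lt_trans (fL x y) _; apply: (@le_lt_trans _ _ (M * `|x - y|)).
  by rewrite ler_wpM2r// /M ler_wpDr// ler_norm.
rewrite mulrC -ltr_pdivlMr//; near: y.
by apply: (@cvgr_dist_lt _ _ _ _ _ id x) => //; rewrite divr_gt0.
Unshelve. all: by end_near. Qed.

Lemma bilip_inverse (R : realType) (f : R -> R) (a b : R) : 0 < a ->
  (forall x y, x <= y -> a * (y - x) <= f y - f x <= b * (y - x)) ->
  exists g : R -> R, [/\ cancel f g, cancel g f, {mono f : x y / x <= y} &
    forall x y, x <= y -> (y - x) / b <= g y - g x <= (y - x) / a].
Proof.
move=> a0 fab.
have b0 : 0 < b.
  have /andP[h1 h2] := fab 0 1 ler01; move: (le_trans h1 h2).
  by rewrite subr0 !mulr1; apply: lt_le_trans.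
have fmono : {mono f : x y / x <= y}.
  apply: le_mono => x y xy; rewrite -subr_gt0.
  have /andP[+ _] := fab x y (ltW xy); apply: lt_le_trans.
  by rewrite mulr_gt0// subr_gt0.
have cf : continuous f.
  apply: (@lip_continuous _ _ b) => x y; wlog xy : x y / x <= y.
    move=> W; have [|/ltW] := leP x y; first exact: W.
    by rewrite distrC (distrC x); exact: W.
  have /andP[h1 h2] := fab x y xy.
  rewrite distrC (distrC x) ger0_norm; last by apply: le_trans h1; rewrite mulr_ge0 ?subr_ge0// ltW.
  by rewrite ger0_norm ?subr_ge0.
have fsurj y : exists x, f x = y.
  (* Over this distance a function of slope at least [a] moves by at least [|y - f 0|], so [y] lies
     between its values at [- M] and [M]. *)
  pose M := `|y - f 0| / a.
  have M0 : 0 <= M by rewrite divr_ge0// ltW.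
  have aM : a * M = `|y - f 0| by rewrite /M mulrC divfK ?gt_eqF.
  have /andP[h1 _] := fab 0 M M0.
  have /andP[h2 _] := fab (- M) 0 (ltac:(by rewrite oppr_le0)).
  have h3 : - M <= M by rewrite ge0_cp.
  rewrite subr0 aM in h1; rewrite sub0r opprK aM in h2.
  have := ler_norm (y - f 0); have := ler_norm (- (y - f 0)); rewrite normrN => h4 h5.
  have [|c _ fc] := @IVT R f (- M) M y h3 (continuous_subspaceT cf).
    rewrite ge_min le_max; apply/andP; split; apply/orP; [left|right]; lra.
  by exists c.
pose g y := sval (cid (fsurj y)).
have gK : cancel g f by move=> y; exact: (svalP (cid (fsurj y))).
have fK : cancel f g by move=> x; apply: (inc_inj fmono); rewrite gK.
exists g; split => // x y xy.
have gxy : g x <= g y by rewrite -fmono !gK.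
have := fab _ _ gxy; rewrite !gK => /andP[h1 h2].
by rewrite ler_pdivrMr// ler_pdivlMr// mulrC h2 mulrC h1.
Qed.

(* The intervals ](C / a) t - U t, (C / a) t - L t[ with t >= a are pairwise
   disjoint. *)
Lemma countable_gap (R : realType) (U L : R -> R) (C : R) : 0 <= C ->
  (forall t s, 0 < t -> t < s -> U s <= L t + C * (s - t) / t) ->
  countable [set t | 0 < t /\ L t < U t].
Proof.
move=> C0 UL.
pose S (k : nat) := [set t : R | k.+1%:R^-1 <= t /\ L t < U t].
suff cS k : countable (S k).
  have : countable (\bigcup_k S k) by exact: bigcup_countable.
  apply: sub_countable; apply: subset_card_le => t [t0 LU].
  exists (Num.truncn t^-1) => //; split=> //.
  rewrite invf_ple ?posrE// ltW//; exact: truncnS_gt.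
pose C' := C * k.+1%:R.
pose F t := C' * t - U t; pose G t := C' * t - L t.
have h t : exists q : rat, S k t -> F t < ratr q < G t.
  have [St|nSt] := pselect (S k t); last by exists 0.
  have FG : F t < G t by rewrite /F /G ler_ltB//; case: St.
  by have [q] := rat_in_itvoo FG; rewrite in_itv/= => ?; exists q.
pose q t := sval (cid (h t)).
have qP t : S k t -> F t < ratr (q t) < G t by exact: (svalP (cid (h t))).
have qlt t s : S k t -> S k s -> t < s -> q t < q s.
  move=> St Ss ts; rewrite -(ltr_rat R).
  have /andP[_ h1] := qP t St; have /andP[h2 _] := qP s Ss.
  apply: lt_trans h1 (le_lt_trans _ h2).
  have t0 : 0 < t by apply: lt_le_trans St.1; rewrite invr_gt0.
  have h3 : C * (s - t) / t <= C' * (s - t).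
    rewrite mulrAC ler_wpM2r ?subr_ge0 ?(ltW ts)// ler_wpM2l//.
    by rewrite invf_ple ?posrE//; case: St.
  have := UL t s t0 ts; rewrite /F /G; lra.
apply/countable_injP; exists (choice.pickle \o q).
move=> t s /set_mem St /set_mem Ss /= /(pcan_inj choice.pickleK) qts.
by have [ts|ts|//] := ltgtP t s; [have := qlt _ _ St Ss ts|have := qlt _ _ Ss St ts];
  rewrite qts ltxx.
Qed.

(** By Tychonoff's theorem the sequence has a cluster point [G] for pointwise convergence. The index
    [phi j] is chosen so that [F (phi j)] is within 1 / (j + 1) of [G] at the first [j] points of an
    enumeration of the rational pairs, and equicontinuity spreads this to all points. The additive
    error [e] admits step functions, which are Lipschitz only up to their mesh. For limits,
    [j <= phi j] suffices; monotonicity of [phi] is not claimed. *)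
Lemma equicontinuous_extraction (R : realType) (F : nat -> R * R -> R)
    (B : R * R -> R) (L : R) (e : nat -> R) :
  0 <= L -> e @ \oo --> 0 ->
  (forall j p, `|F j p| <= B p) ->
  (forall j p q, `|F j p - F j q| <= L * (`|p.1 - q.1| + `|p.2 - q.2|) + e j) ->
  exists phi : nat -> nat, exists G : R * R -> R,
    (forall j, (j <= phi j)%N) /\ forall p, F (phi j) p @[j --> \oo] --> G p.
Proof.
move=> L0 e0 FB FL.
pose A p := [set` `[- B p, B p]%R] : set R.
pose T := prod_topology (fun _ : (R * R)%type => (R : topologicalType)).
have cA : compact ([set f : T | forall p, A p (f p)] : set T).
  by apply: (@tychonoff (R * R)%type (fun=> R) A) => p; exact: segment_compact.
have [|G [_ clG]] := cA ((F : nat -> T) @ \oo) _.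
  by exists 0%N => // j _ p; rewrite /A /= in_itv/= -ler_norml; exact: FB.
have near_G (n : nat) (p : 'I_n -> R * R) (d : R) (N : nat) : 0 < d ->
    exists j, (N <= j)%N /\ forall i, `|F j (p i) - G (p i)| < d.
  move=> d0.
  have [||f [[j Nj <-] fd]] := clG ((F : nat -> T) @` [set j | (N <= j)%N])
      [set f : T | forall i, `|f (p i) - G (p i)| < d].
  - by exists N => // j Nj; exists j.
  - apply: (@filter_forall T _ (fun i => [set f : T | `|f (p i) - G (p i)| < d])
      (nbhs (G : T))) => i.
    have cp : (fun f : T => f (p i) : R) @ nbhs (G : T) --> (G (p i) : R).
      exact: (@proj_continuous (R * R)%type (fun=> (R : topologicalType)) (p i) (G : T)).
    have Gd : nbhs (G (p i)) [set y : R | `|y - G (p i)| < d].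
      by apply/nbhs_ballP; exists d => //= y; rewrite /ball/= distrC.
    exact: cp _ Gd.
  by exists j.
pose pt (i : nat) : R * R :=
  if choice.unpickle i is Some q then (ratr (q : rat * rat).1, ratr q.2) else (0, 0).
have h j : exists k, (j <= k)%N /\
    forall i : 'I_j, `|F k (pt i) - G (pt i)| < j.+1%:R^-1.
  exact: near_G.
pose phi j := sval (cid (h j)).
have phiP j : (j <= phi j)%N /\
    forall i : 'I_j, `|F (phi j) (pt i) - G (pt i)| < j.+1%:R^-1.
  exact: (svalP (cid (h j))).
exists phi, G; split => [j|p]; first by case: (phiP j).
have ephi d : 0 < d -> \forall j \near \oo, e (phi j) < d.
  move=> d0; have /cvgrPdist_lt/(_ d d0)[N _ Nd] := e0.
  exists N => // j /= Nj; have := Nd (phi j) (leq_trans Nj (phiP j).1).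
  by rewrite /= sub0r normrN; apply: le_lt_trans; exact: ler_norm.
have GL p' q : `|G p' - G q| <= L * (`|p'.1 - q.1| + `|p'.2 - q.2|).
  apply/ler_addgt0Pr => d d0.
  have d3 : 0 < d / 3 by rewrite divr_gt0.
  have /cvgrPdist_lt/(_ _ d3)[N _ Nd] := e0.
  have [j [Nj Fj]] := near_G 2%N (fun i => if i == 0 then p' else q) (d / 3) N d3.
  have := Fj 0; have := Fj 1; rewrite /= => F1 F0.
  have := Nd j Nj; rewrite /= sub0r normrN => /(le_lt_trans (ler_norm _)) ej.
  have := FL j p' q.
  have := ler_distD (F j p') (G p') (G q).
  have := ler_distD (F j q) (F j p') (G q).
  rewrite (distrC (G p') (F j p')); lra.
suff key (d : R) : 0 < d -> \forall j \near \oo, `|G p - F (phi j) p| < d.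
  by apply/cvgrPdist_lt => d; exact: key.
move=> d0; have d4 : 0 < d / 4 by rewrite divr_gt0.
(* With this radius each of the two uses of the Lipschitz bound, for [G] and for [F (phi j)], costs
   at most [d / 4]; the error [e] and the distance to [G] at the rational point cost the other two
   quarters. *)
pose r := d / (8 * (L + 1)).
have L1 : 0 < L + 1 by rewrite ltr_wpDl.
have r0 : 0 < r by rewrite divr_gt0// mulr_gt0.
have [q1 q1r] := @rat_in_itvoo R (p.1 - r) (p.1 + r) (ltac:(lra)).
have [q2 q2r] := @rat_in_itvoo R (p.2 - r) (p.2 + r) (ltac:(lra)).
pose q : R * R := (ratr q1, ratr q2).
have pq : L * (`|p.1 - q.1| + `|p.2 - q.2|) <= d / 4.
  have h1 : `|p.1 - q.1| <= r.
    by move: q1r; rewrite in_itv/= /q/= ler_distlC => /andP[? ?]; lra.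
  have h2 : `|p.2 - q.2| <= r.
    by move: q2r; rewrite in_itv/= /q/= ler_distlC => /andP[? ?]; lra.
  apply: (@le_trans _ _ ((L + 1) * (r + r))).
    by rewrite ler_pM ?addr_ge0 ?lerD// lerDl.
  have -> : (L + 1) * (r + r) = d / 4 by rewrite /r; field; rewrite gt_eqF.
  by [].
pose iq := choice.pickle (q1, q2).
have ptq : pt iq = q by rewrite /pt choice.pickleK.
near=> j.
have [_] := phiP j.
have jq : (iq < j)%N by near: j; exact: nbhs_infty_gt.
move=> /(_ (Ordinal jq)); rewrite /= ptq => Fq.
have ej : e (phi j) < d / 4 by near: j; exact: ephi.
have jd : j.+1%:R^-1 < d / 4.
  by near: j; exact: near_infty_natSinv_lt (PosNum d4).
have := FL (phi j) p q; have := GL p q.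
have := ler_distD (G q) (G p) (F (phi j) p).
have := ler_distD (F (phi j) q) (G q) (F (phi j) p).
rewrite (distrC (G q) (F (phi j) q)) (distrC (F (phi j) q) (F (phi j) p)).
move=> h1 h2 h3 h4; apply: (le_lt_trans h2).
have -> : d = d / 4 + (d / 4 + (d / 4 + d / 4)) by field.
rewrite ler_ltD ?(le_trans h3)// (le_lt_trans h1)// ltr_leD ?(lt_trans Fq)//.
by rewrite (le_trans h4)// lerD// ltW.
Unshelve. all: by end_near. Qed.

(** * Measurability and integration on the plane *)

Lemma countable_fibers_measurable (d : measure_display) (T : measurableType d)
    (R : realType) (C : countType) (a : T -> C) (g : C -> R) :
  (forall c, measurable (a @^-1` [set c])) -> measurable_fun setT (g \o a).
Proof.
move=> ma _ Y mY; rewrite setTI.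
have -> : (g \o a) @^-1` Y =
    \bigcup_(c in [set: C]) (if g c \in Y then a @^-1` [set c] else set0).
  apply/seteqP; split => [x Yx|x [c _]].
    by exists (a x) => //; rewrite ifT//; exact: mem_set.
  by case: ifPn => // /set_mem Yc /= ->.
apply: countable_bigcupT_measurable => // c; by case: ifPn.
Qed.

Lemma measurable_step (R : realType) (g : int -> int -> R) (a b : R) :
  0 < a -> 0 < b ->
  measurable_fun setT (fun p : R * R => g (Num.floor (p.1 / a)) (Num.floor (p.2 / b))).
Proof.
move=> a0 b0.
pose fl (p : R * R) : int * int := (Num.floor (p.1 / a), Num.floor (p.2 / b)).
apply: (@countable_fibers_measurable _ _ R _ fl (fun c => g c.1 c.2)) => -[i j].
have -> : fl @^-1` [set (i, j)] =
   [set` `[i%:~R * a, (i + 1)%:~R * a[] `*` [set` `[j%:~R * b, (j + 1)%:~R * b[].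
  apply/seteqP; split => -[t x]; rewrite /fl /= !in_itv /=.
    by move=> [<- <-]; rewrite -!ler_pdivlMr// -!ltr_pdivrMr// !floor_itv.
  rewrite -!ler_pdivlMr// -!ltr_pdivrMr// => -[h1 h2].
  by congr pair; exact: Num.Theory.floor_def.
exact: measurableX.
Qed.

Lemma measurable_step_nat (R : realType) (g : nat -> int -> R) (a b : R) :
  0 < a -> 0 < b ->
  measurable_fun setT (fun p : R * R => g (Num.truncn (p.1 / a)) (Num.floor (p.2 / b))).
Proof.
move=> a0 b0.
have -> : (fun p : R * R => g (Num.truncn (p.1 / a)) (Num.floor (p.2 / b))) =
  (fun p => (fun i => g (if i is Posz n then n else 0%N)) (Num.floor (p.1 / a))
     (Num.floor (p.2 / b))).
  by apply/funext => p; rewrite Num.Theory.truncEfloor.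
exact: (@measurable_step R (fun i => g (if i is Posz n then n else 0%N)) a b).
Qed.

Lemma floor_approx (R : realType) (a t : R) : 0 < a ->
  t - a < (Num.floor (t / a))%:~R * a <= t.
Proof.
move=> a0; have /andP[h1 h2] := floor_itv (t / a).
rewrite -ler_pdivlMr// h1 andbT ltrBlDr.
by move: h2; rewrite ltr_pdivrMr// intrD mulrDl mul1r.
Qed.

Lemma cvg_natSinv (R : realType) : (fun n : nat => n.+1%:R^-1 : R) @ \oo --> 0.
Proof. exact: cvg_harmonic. Qed.

Lemma floor_cvg (R : realType) (t : R) (a : nat -> R) : (forall n, 0 < a n) ->
  a @ \oo --> 0 -> (Num.floor (t / a n))%:~R * a n @[n --> \oo] --> t.
Proof.
move=> a0 ca; apply: (@squeeze_cvgr _ _ _ _ (fun n => t - a n) (cst t)).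
- by near=> n; have /andP[/ltW -> ->] := floor_approx R (a n) t (a0 n).
- by rewrite -[X in _ --> X]subr0; apply: cvgB => //; exact: cvg_cst.
- exact: cvg_cst.
Unshelve. all: by end_near. Qed.

Lemma measurable_fun_cvgr (d : measure_display) (T : measurableType d)
    (R : realType) (D : set T) (f_ : nat -> T -> R) (f : T -> R) :
  (forall n, measurable_fun D (f_ n)) ->
  (forall x, D x -> f_ ^~ x @ \oo --> f x) -> measurable_fun D f.
Proof.
move=> mf cf; apply/measurable_EFinP.
apply: (@emeasurable_fun_cvg _ _ _ _ (fun n => EFin \o f_ n)) => [n|x Dx].
  exact/measurable_EFinP.
by apply/cvg_EFin; [near=> n|exact: cf].
Unshelve. all: by end_near. Qed.

Lemma continuous_cvg_pair (R : realType) (f : R * R -> R) : continuous f ->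
  forall (u v : nat -> R) (t x : R), u @ \oo --> t -> v @ \oo --> x ->
  f (u n, v n) @[n --> \oo] --> f (t, x).
Proof.
move=> cf u v t x cu cv.
apply: (@continuous2_cvg nat R R R \oo _ u v (fun a b => f (a, b)) t x _ cu cv).
have -> : (fun z : R * R => f (z.1, z.2)) = f by apply/funext => -[].
exact: cf.
Qed.

(** Rounding both coordinates down to multiples of 1 / (n + 1) exhibits [f] as a pointwise limit of
    step functions, which are measurable for the product sigma-algebra. *)
Lemma continuous_measurable2 (R : realType) (f : R * R -> R) :
  continuous f -> measurable_fun setT f.
Proof.
move=> cf; pose a n : R := n.+1%:R^-1.
have a0 n : 0 < a n by rewrite invr_gt0.
pose g n (i j : int) := f (i%:~R * a n, j%:~R * a n).
pose F n (p : R * R) := g n (Num.floor (p.1 / a n)) (Num.floor (p.2 / a n)).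
have mF n : measurable_fun setT (F n) by exact: measurable_step.
apply: (measurable_fun_cvgr _ _ _ _ F f mF).
move=> [t x] _.
have ca : a @ \oo --> 0 by exact: cvg_natSinv.
have c1 := @floor_cvg R t a a0 ca; have c2 := @floor_cvg R x a a0 ca.
exact: (continuous_cvg_pair _ f cf _ _ _ _ c1 c2).
Qed.

Section dominated_box.
Context (d : measure_display) (T : measurableType d) (R : realType).
Variables (m : {measure set T -> \bar R}) (S : set T) (M : R).
Hypothesis mS : measurable S.
Hypothesis Sfin : (m S < +oo)%E.

Let ig : m.-integrable setT (fun x => (M * \1_S x)%:E).
Proof.
have -> : (fun x => (M * \1_S x)%:E) = (fun x => M%:E * (\1_S x)%:E)%E.
  by apply/funext => x; rewrite EFinM.
apply: integrableZl => //; apply/integrableP; split; first exact/measurable_EFinP.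
under eq_integral => x _ do rewrite gee0_abs ?lee_fin//.
by rewrite integral_indic// setIT.
Qed.

Lemma bounded_support_integrable (F : T -> R) : measurable_fun setT F ->
  (forall x, S x -> `|F x| <= M) -> (forall x, ~ S x -> F x = 0) ->
  m.-integrable setT (EFin \o F).
Proof.
move=> mF FM F0.
apply: (@le_integrable _ _ _ m setT _ (EFin \o F) (fun x => (M * \1_S x)%:E)) => //.
- exact/measurable_EFinP.
- move=> x _; rewrite /= lee_fin indicE; have [/set_mem xS|/negP xS] := boolP (x \in S).
    by rewrite mulr1 (le_trans (FM x xS))// ler_norm.
  by rewrite F0 ?normr0// => ?; apply: xS; exact: mem_set.
Qed.

Lemma bounded_support_dct (F_ : nat -> T -> R) (F : T -> R) :
  (forall n, measurable_fun setT (F_ n)) -> measurable_fun setT F ->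
  (forall n x, S x -> `|F_ n x| <= M) -> (forall n x, ~ S x -> F_ n x = 0) ->
  {ae m, forall x, F_ n x @[n --> \oo] --> F x} ->
  \int[m]_x F_ n x @[n --> \oo] --> \int[m]_x F x.
Proof.
move=> mF_ mF FM F0 cF.
have [||||iF _ cint] := @dominated_convergence _ _ _ m setT measurableT
  (fun n x => (F_ n x)%:E) (fun x => (F x)%:E) _ _ _ _ ig _.
- by move=> n; exact/measurable_EFinP.
- exact/measurable_EFinP.
- by apply: filterS cF => x cx _; apply/cvg_EFin; [exact: nearW|exact: cx].
- apply: aeW => x n _; rewrite /= lee_fin indicE.
  have [/set_mem xS|/negP xS] := boolP (x \in S).
    by rewrite mulr1; exact: FM.
  by rewrite F0 ?normr0 ?mulr0// => ?; apply: xS; exact: mem_set.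
apply: fine_cvg; rewrite fineK; last exact: integrable_fin_num.
exact: cint.
Qed.

End dominated_box.

Section plane.
Context (R : realType).
Local Notation mu := (@lebesgue_measure R).
Local Notation mu2 := (mu \x mu)%E.

Definition box (B : R) : set (R * R) := `[- B, B] `*` `[- B, B].

Lemma boxP (B : R) p : box B p <-> `|p.1| <= B /\ `|p.2| <= B.
Proof. by rewrite /box /= !in_itv/= !ler_norml; split. Qed.

Lemma measurable_box B : measurable (box B).
Proof. exact: measurableX. Qed.

Lemma segment_lty (a b : R) : (mu `[a, b] < +oo)%E.
Proof. by rewrite lebesgue_measure_itv/=; case: ifPn => // _; rewrite ltry. Qed.

Lemma box_lty B : (mu2 (box B) < +oo)%E.
Proof.
rewrite product_measure1E//; apply: lte_mul_pinfty => //; last exact: segment_lty.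
by rewrite ge0_fin_numE//; exact: segment_lty.
Qed.

Lemma Rintegral_fubini (F : R * R -> R) : mu2.-integrable setT (EFin \o F) ->
  (\int[mu2]_p (F p)%:E = \int[mu]_t \int[mu]_x (F (t, x))%:E)%E.
Proof. by move=> iF; rewrite -[LHS](integral12_prod_meas1 iF). Qed.

Lemma integral_shift (F : R -> R) (b : R) : measurable_fun setT F ->
  (\int[mu]_x (F (x + b))%:E = \int[mu]_x (F x)%:E)%E.
Proof.
move=> mF; rewrite [RHS](@homeo_integral R (fun x => x + b) (fun x => x - b) (cst 1))//.
- by apply: eq_integral => x _; rewrite mulr1.
- by move=> x; rewrite subrK.
- by move=> x y; rewrite lerD2r.
- move=> x y xy; transitivity (\int[mu]_(z in `]x, y]) (cst 1%:E z))%E; first by [].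
  rewrite integral_cst//= mul1e lebesgue_measure_itv/= lte_fin.
  rewrite opprD addrACA subrr addr0; case: ltP => // yx.
  by rewrite (le_anti (introT andP (conj xy yx))) subrr.
Qed.

Lemma box_integrable (F : R * R -> R) (M B : R) : measurable_fun setT F ->
  (forall p, `|F p| <= M) -> (forall p, ~ box B p -> F p = 0) ->
  mu2.-integrable setT (EFin \o F).
Proof.
move=> mF FM F0; apply: (@bounded_support_integrable _ _ _ mu2 (box B) M) => //.
- exact: measurable_box.
- exact: box_lty.
Qed.

Lemma measurable_shift (F : R * R -> R) (a b : R) : measurable_fun setT F ->
  measurable_fun setT (fun p : R * R => F (p.1 + a, p.2 + b)).
Proof.
move=> mF; apply: (measurableT_comp mF).
by apply: measurable_fun_pair; apply: measurable_funD.
Qed.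

Lemma box_integrable_shift (F : R * R -> R) (M B a b : R) : measurable_fun setT F ->
  (forall p, `|F p| <= M) -> (forall p, ~ box B p -> F p = 0) ->
  mu2.-integrable setT (fun p : R * R => (F (p.1 + a, p.2 + b))%:E).
Proof.
move=> mF FM F0; apply: (@box_integrable _ M (B + `|a| + `|b|)) => //.
  exact: measurable_shift.
move=> p nb; apply: F0 => /boxP/= [h1 h2]; apply: nb; apply/boxP.
have := ler_normB (p.1 + a) a; have := ler_normB (p.2 + b) b.
by rewrite !addrK; have := normr_ge0 a; have := normr_ge0 b; split; lra.
Qed.

(** Fubini's theorem in either order lets the two variables be shifted one after the other. *)
Lemma integral_shift2 (F : R * R -> R) (M B a b : R) : measurable_fun setT F ->
  (forall p, `|F p| <= M) -> (forall p, ~ box B p -> F p = 0) ->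
  \int[mu2]_p F (p.1 + a, p.2 + b) = \int[mu2]_p F p.
Proof.
move=> mF FM F0; congr fine.
have iF := @box_integrable F M B mF FM F0.
have iFab := @box_integrable_shift F M B a b mF FM F0.
have iFa := @box_integrable_shift F M B a 0 mF FM F0.
rewrite Rintegral_fubini//.
transitivity (\int[mu]_t \int[mu]_x (F (t + a, x + 0))%:E)%E.
  apply: eq_integral => t _.
  have m1 : measurable_fun setT (fun x => F (t + a, x)).
    exact: (measurableT_comp mF (pair1_measurable _)).
  rewrite (integral_shift (fun x => F (t + a, x)) b m1).
  by apply: eq_integral => x _; rewrite addr0.
rewrite (integral12_prod_meas1 iFa) -(integral21_prod_meas1 iFa).
rewrite -(integral21_prod_meas1 iF) /fubini_G.
apply: eq_integral => x _ /=.
have m2 : measurable_fun setT (fun t => F (t, x)).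
  exact: (measurableT_comp mF (pair2_measurable _)).
rewrite -(integral_shift (fun t => F (t, x)) a m2).
by apply: eq_integral => t _; rewrite addr0.
Qed.

End plane.

(** * Functions of bounded variation and almost everywhere convergence *)

(** [discontinuity] means one-sided limits that exist and differ. For a monotone function they exist
    and enclose the value, so a point where they agree is a point of continuity; a covering by
    bounded intervals then gives countability. *)
Lemma nondecreasing_countable_discontinuity (R : realType) (F : R -> R) :
  {homo F : x y / x <= y} -> countable [set x | ~ {for x, continuous F}].
Proof.
move=> ndF.
pose S (k : nat) := [set x | x \in (`](- k%:R)%R, (k%:R : R)[) /\ discontinuity F x].
have cS k : countable (S k).
  by apply: discontinuity_countable => x y _ _; exact: ndF.
have : countable (\bigcup_k S k) by exact: bigcup_countable.
apply: sub_countable; apply: subset_card_le => x nc.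
exists (Num.truncn `|x|).+1 => //; split.
  by rewrite in_itv/= -ltr_norml truncnS_gt.
have cl : cvg (F y @[y --> x^'-]).
  apply: nondecreasing_at_left_is_cvgr; near=> z; first by move=> ? ? _ _; exact: ndF.
  exists (F x) => _ [y /= + <-]; rewrite in_itv/= => /andP[_ yx].
  exact/ndF/ltW.
have cr : cvg (F y @[y --> x^'+]).
  apply: nondecreasing_at_right_is_cvgr; near=> z; first by move=> ? ? _ _; exact: ndF.
  exists (F x) => _ [y /= + <-]; rewrite in_itv/= => /andP[xy _].
  exact/ndF/ltW.
split => //; apply/eqP => lr; apply: nc.
have l1 : lim (F y @[y --> x^'-]) <= F x.
  apply: limr_le => //; near=> z; apply/ndF/ltW; near: z; exact: nbhs_left_lt.
have l2 : F x <= lim (F y @[y --> x^'+]).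
  apply: limr_ge => //; near=> z; apply/ndF/ltW; near: z; exact: nbhs_right_gt.
apply/left_right_continuousP; split.
  have -> : F x = lim (F y @[y --> x^'-]) by apply/le_anti; rewrite l1 lr l2.
  exact: cl.
have -> : F x = lim (F y @[y --> x^'+]) by apply/le_anti; rewrite l2 -lr l1.
exact: cr.
Unshelve. all: by end_near. Qed.

Section bounded_variation.
Context (R : realType) (u : R -> R).
Hypothesis hu : BV u.

Lemma BV_bounded_variation a b : a <= b -> bounded_variation a b u.
Proof.
move=> ab; apply/bounded_variationP => //.
rewrite ge0_fin_numE ?total_variation_ge0//.
by apply: le_lt_trans hu; apply: ereal_sup_ubound; exists (a, b).
Qed.

Lemma BV_monotone_diff (k : nat) : exists p n : R -> R,
  [/\ {homo p : x y / x <= y}, {homo n : x y / x <= y} &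
      forall x, `|x| <= k%:R -> u x = p x - n x].
Proof.
pose a : R := - k%:R; pose b : R := k%:R.
have ab : a <= b by rewrite /a /b ge0_cp.
have bv := BV_bounded_variation a b ab.
have bvN : bounded_variation a b (\- u) by apply/bounded_variationN.
(* The Jordan decomposition concerns a segment; composing with the projection onto it makes both
   parts monotone on the whole line. *)
pose c x := Num.max a (Num.min b x).
have cab x : c x \in `[a, b].
  by rewrite in_itv/= /c le_max lexx/= ge_max ab ge_min lexx.
have c_mono : {homo c : x y / x <= y}.
  by move=> x y xy; rewrite /c ge_max le_max lexx/= le_max le_min !ge_min lexx/= xy !orbT.
exists (fine \o neg_tv a (\- u) \o c), (fine \o neg_tv a u \o c); split.
- move=> x y xy /=; apply: (fine_neg_tv_nondecreasing bvN) => //; exact: c_mono.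
- move=> x y xy /=; apply: (fine_neg_tv_nondecreasing bv) => //; exact: c_mono.
- move=> x; rewrite ler_norml => /andP[ax xb] /=.
  have -> : c x = x by rewrite /c (min_idPr xb) (max_idPr ax).
  by rewrite (bounded_variation_pos_neg_tvE bv) ?in_itv/= ?ax.
Qed.

Lemma BV_measurable : measurable_fun setT u.
Proof.
pose d (k : nat) : R * R -> R := cst 0.
have [p pP] := choice (fun k => BV_monotone_diff k).
have [n pnP] := choice pP.
apply: (@measurable_fun_cvgr _ _ _ _ (fun k x => p k x - n k x)) => [k|x _].
  have [pm nm _] := pnP k.
  by apply: measurable_funB; apply: nondecreasing_measurable.
apply: cvg_near_cst; near=> k.
have [_ _ ->] := pnP k => //.
by near: k; exact: nbhs_infty_ger.
Unshelve. all: by end_near. Qed.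

Lemma BV_countable_discontinuity : countable [set x | ~ {for x, continuous u}].
Proof.
have [p pP] := choice (fun k => BV_monotone_diff k).
have [n pnP] := choice pP.
pose S k := [set x | ~ {for x, continuous (p k)}] `|` [set x | ~ {for x, continuous (n k)}].
have cS k : countable (S k).
  have [pm nm _] := pnP k.
  have -> : S k = \bigcup_(b in [set: bool]) (if b then [set x | ~ {for x, continuous (p k)}]
      else [set x | ~ {for x, continuous (n k)}]).
    apply/seteqP; split => [x [h|h]|x [[] _ h]]; [by exists true|by exists false|by left|by right].
  by apply: bigcup_countable => // -[] _; exact: nondecreasing_countable_discontinuity.
have : countable (\bigcup_k S k) by exact: bigcup_countable.
apply: sub_countable; apply: subset_card_le => x nc.
exists (Num.truncn `|x|).+1 => //.
have [_ _ pn] := pnP (Num.truncn `|x|).+1.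
apply/not_andP => -[cp cn]; apply: nc.
rewrite /prop_for /continuous_at.
have -> : u x = p (Num.truncn `|x|).+1 x - n (Num.truncn `|x|).+1 x.
  by rewrite pn// ltW// truncnS_gt.
apply: cvg_trans (cvgB cp cn); apply: near_eq_cvg; near=> y.
rewrite pn//; near: y.
have K0 : 0 < (Num.truncn `|x|).+1%:R - `|x| by rewrite subr_gt0 truncnS_gt.
apply/nbhs_ballP; exists ((Num.truncn `|x|).+1%:R - `|x|) => // y; rewrite /ball/= => xy.
have := ler_normD x (y - x); rewrite subrKC (distrC y); lra.
Unshelve. all: by end_near. Qed.

End bounded_variation.

Section ae_product.
Context (R : realType).
Local Notation mu := (@lebesgue_measure R).
Local Notation mu2 := (mu \x mu)%E.

Lemma ae_mono (P Q : R -> Prop) : (forall x, P x -> Q x) ->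
  {ae mu, forall x, P x} -> {ae mu, forall x, Q x}.
Proof.
move=> PQ [N [mN N0 PN]]; exists N; split => // x /= nQ; apply: PN => /=.
by move=> Px; exact/nQ/PQ.
Qed.

Lemma countable_ae (A : set R) : countable A -> {ae mu, forall x, ~ A x}.
Proof.
move=> cA; exists A; split; first exact: countable_measurable.
  exact: countable_lebesgue_measure0.
by move=> x /= /contrapT.
Qed.

Lemma ysection_negligible (B : set (R * R)) : measurable B ->
  {ae mu, forall x, {ae mu, forall t, ~ B (t, x)}} -> mu2 B = 0%E.
Proof.
move=> mB aeB.
have mI : measurable_fun setT (fun p : R * R => (\1_B p)%:E : \bar R).
  by apply/measurable_EFinP; exact: measurable_indic.
have I0 (p : R * R) : (0 <= (\1_B p)%:E :> \bar R)%E by rewrite lee_fin.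
have <- : (\int[mu2]_p (\1_B p)%:E = mu2 B)%E.
  by rewrite integral_indic//; congr (mu2 _); exact: setIT.
transitivity (\int[mu]_x fubini_G mu (fun p : R * R => (\1_B p)%:E) x)%E.
  exact: (@fubini_tonelli2 _ _ _ _ R mu mu _ mI I0).
rewrite -[RHS](integral0 mu setT); apply: ae_eq_integral => //.
- exact: (@measurable_fun_fubini_tonelli_G _ _ _ _ R mu (fun p : R * R => (\1_B p)%:E)).
apply: ae_mono aeB => x aex _; rewrite /fubini_G /=.
rewrite -[RHS](integral0 mu setT); apply: ae_eq_integral => //.
- exact: (measurableT_comp mI (pair2_measurable _)).
by apply: ae_mono aex => t nB _; rewrite indicE memNset.
Qed.

Lemma xsection_ae (P : R * R -> Prop) : {ae mu2, forall p, P p} ->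
  {ae mu, forall t, {ae mu, forall x, P (t, x)}}.
Proof.
move=> [N [mN N0 PN]].
have mI : measurable_fun setT (fun p : R * R => (\1_N p)%:E : \bar R).
  by apply/measurable_EFinP; exact: measurable_indic.
have I0 (p : R * R) : (0 <= (\1_N p)%:E :> \bar R)%E by rewrite lee_fin.
have E0 : (\int[mu]_t `|\int[mu]_x (\1_N (t, x))%:E| = 0)%E.
  rewrite -[RHS]N0.
  have <- : (\int[mu2]_p (\1_N p)%:E = mu2 N)%E.
    by rewrite integral_indic//; congr (mu2 _); exact: setIT.
  apply/esym; transitivity (\int[mu]_t fubini_F mu (fun p : R * R => (\1_N p)%:E) t)%E.
    exact: (@fubini_tonelli1 _ _ _ _ R mu mu _ mI I0).
  apply: eq_integral => t _.
  by rewrite gee0_abs//; apply: integral_ge0 => x _; rewrite lee_fin.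
have mF : measurable_fun setT (fun t => (\int[mu]_x (\1_N (t, x))%:E)%E).
  exact: (@measurable_fun_fubini_tonelli_F _ _ _ _ R mu (fun p : R * R => (\1_N p)%:E)).
have := (ae_eq_integral_abs mu measurableT mF).1 E0.
apply: ae_mono => t /(_ I) /= Et.
have mNt : measurable (xsection N t) by exact: measurable_xsection.
exists (xsection N t); split => //.
  rewrite -integral_indicT// -[RHS]Et; apply: eq_integral => x _.
  by congr EFin; apply: eq_indic; rewrite xsectionE.
by move=> x nP; rewrite xsectionE; exact: PN.
Qed.

(** For the scheme, convergence is known for almost every label and then for almost every time. The
    set where the upper limit of [|f j - F|] is nonzero is measurable, and Tonelli's theorem turns
    its null sections into a null set of the plane. *)
Lemma ae_cvg_ysection (f : nat -> R * R -> R) (F : R * R -> R) (D : set (R * R)) :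
  measurable D -> (forall j, measurable_fun setT (f j)) -> measurable_fun setT F ->
  {ae mu, forall x, {ae mu, forall t, D (t, x) -> f j (t, x) @[j --> \oo] --> F (t, x)}} ->
  {ae mu2, forall p, D p -> f j p @[j --> \oo] --> F p}.
Proof.
move=> mD mf mF aef.
pose g p := limn_esup (fun j => `|f j p - F p|%:E).
have mg : measurable_fun setT g.
  apply: measurable_fun_limn_esup => j; apply/measurable_EFinP.
  by apply: measurableT_comp => //; exact: measurable_funB.
pose B := D `&` [set p | g p != 0%E].
have mB : measurable B.
  apply: measurableI => //; rewrite -[X in measurable X]setTI.
  by apply: emeasurable_neq => //; exact: measurable_cst.
exists B; split => //.
  apply: ysection_negligible => //; apply: ae_mono aef => x; apply: ae_mono => t cf [/= Dt].
  apply/negP; rewrite negbK; apply/eqP.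
  suff c0 : `|f j (t, x) - F (t, x)|%:E @[j --> \oo] --> 0%E.
    by have [_] := cvg_limn_einf_sup c0.
  apply/cvg_EFin; first exact: nearW.
  rewrite /= -(@normr0 _ R) -[X in `|X|](subrr (F (t, x))).
  by apply: cvg_norm; apply: cvgB; [exact: cf|exact: cvg_cst].
move=> p /= /not_implyP[Dp nc]; split => //=; apply/eqP => g0; apply: nc.
have := @limn_esup_le_cvg R (fun j => `|f j p - F p|%:E) 0%E.
rewrite -/(g p) g0 lexx => /(_ isT) c0.
have {}c0 : `|f j p - F p|%:E @[j --> \oo] --> 0%E by apply: c0 => j; rewrite lee_fin.
move/fine_cvgP : c0 => [_ c1].
apply/cvgrPdist_lt => e e0; have /cvgrPdist_lt/(_ e e0) := c1.
by apply: filterS => j; rewrite sub0r normrN normr_id distrC.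
Qed.

End ae_product.

(** * Concavity from a weak second derivative *)

Section smooth.
Context (R : realType).
Implicit Types (f g : R -> R).

Fixpoint differentiable_n (n : nat) f : Prop :=
  if n is n'.+1 then exists2 f' : R -> R, (forall x : R, is_derive x 1 f (f' x)) &
    differentiable_n n' f'
  else True.

Definition smooth f := forall n, differentiable_n n f.

Lemma is_derive_derive1 f (f' : R -> R) : (forall x : R, is_derive x 1 f (f' x)) -> derive1 f = f'.
Proof. by move=> ff'; apply/funext => x; rewrite derive1E (@derive_val _ _ _ _ _ _ _ (ff' x)). Qed.

Lemma smooth_derivable f : smooth f -> forall n x, derivable (derive1n n f) x 1.
Proof.
move=> sf n; move: {sf}(sf n.+1).
elim: n f => [|n ih] f.
  by move=> [f' ff' _] x; rewrite derive1n0; case: (ff' x).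
move=> [f' ff' sf'] x; rewrite derive1Sn (is_derive_derive1 _ _ ff').
exact: ih.
Qed.

Lemma differentiable_nW n f : differentiable_n n.+1 f -> differentiable_n n f.
Proof.
elim: n f => // n ih f [f' ff' sf']; exists f' => //; exact: ih.
Qed.

Lemma differentiable_n_comb n f g (a b : R) : differentiable_n n f -> differentiable_n n g ->
  differentiable_n n (fun x => a * f x + b * g x).
Proof.
elim: n f g => // n ih f g [f' ff' sf] [g' gg' sg].
exists (fun x => a * f' x + b * g' x); last exact: ih.
move=> x; have df := ff' x; have dg := gg' x.
exact: (@is_deriveD _ _ _ (fun x => a *: f x) (fun x => b *: g x)).
Qed.

Lemma differentiable_nM n f g : differentiable_n n f -> differentiable_n n g ->
  differentiable_n n (fun x => f x * g x).
Proof.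
elim: n f g => // n ih f g sf sg.
have /= [f' ff' sf'] := sf; have /= [g' gg' sg'] := sg.
exists (fun x => 1 * (f x * g' x) + 1 * (g x * f' x)).
  move=> x; have df := ff' x; have dg := gg' x; rewrite !mul1r.
  exact: (@is_deriveM _ _ f g).
by apply: differentiable_n_comb; apply: ih => //; exact: differentiable_nW.
Qed.

Lemma is_derive_affine f (f' : R -> R) (a b x : R) : (forall y : R, is_derive y 1 f (f' y)) ->
  is_derive x 1 (fun y => f (a * y + b)) (a * f' (a * x + b)).
Proof.
move=> ff'; have df := ff' (a * x + b).
have dg : is_derive x 1 (fun y : R => a *: y + b) (a *: 1 + 0).
  exact: is_deriveD.
have := @is_derive1_comp _ f (fun y : R => a *: y + b) x _ _ df dg.
have <- : f' (a *: x + b) * (a *: 1 + 0) = a * f' (a * x + b).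
  by rewrite addr0 /GRing.scale/= mulr1 mulrC.
exact.
Qed.

Lemma differentiable_n_affine n f (a b : R) : differentiable_n n f ->
  differentiable_n n (fun x => f (a * x + b)).
Proof.
elim: n f => // n ih f [f' ff' sf'].
exists (fun x => a * f' (a * x + b) + 0 * f' (a * x + b)).
  by move=> x; rewrite mul0r addr0; exact: is_derive_affine.
by apply: differentiable_n_comb; exact: ih.
Qed.

(** The function x^(-k) exp(-1/x) extended by 0. The exponent [k] is there because the derivatives
    of the case [k = 0] are combinations of members of this family, so smoothness follows by
    induction with [k] free. *)
Definition flat (k : nat) (x : R) : R :=
  if 0 < x then x^-1 ^+ k * expR (- x^-1) else 0.

(** From exp(1/x) >= x^(-(k+2)) / (k+2)!. The quadratic bound yields differentiability at the
    origin, with derivative 0. *)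
Lemma flat_le (k : nat) (x : R) : `|flat k x| <= (k.+2)`!%:R * `|x| ^+ 2.
Proof.
have r0 : 0 <= (k.+2)`!%:R * `|x| ^+ 2 :> R by rewrite mulr_ge0// exprn_ge0.
rewrite /flat; case: ifPn => [x0|_]; last by rewrite normr0.
rewrite ger0_norm; last by rewrite mulr_ge0 ?expR_ge0 ?exprn_ge0 ?invr_ge0 ?ltW.
rewrite gtr0_norm// expRN ler_pdivrMr ?expR_gt0//.
have y0 : 0 <= x^-1 by rewrite invr_ge0 ltW.
have := @expR_ge1Dxn R x^-1 k.+1 y0; set e := expR _ => he.
have f0 : 0 < (k.+2)`!%:R :> R by rewrite ltr0n fact_gt0.
have he' : x^-1 ^+ k.+2 <= (k.+2)`!%:R * e.
  rewrite -ler_pdivrMl// mulrC; apply: le_trans he; rewrite lerDr; exact: ler01.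
have -> : (k.+2)`!%:R * x ^+ 2 * e = x ^+ 2 * ((k.+2)`!%:R * e) by ring.
apply: le_trans (ler_wpM2l (exprn_ge0 2 (ltW x0)) he').
rewrite -(addn2 k) exprD mulrCA -exprMn divff ?gt_eqF// expr1n mulr1; exact: lexx.
Qed.

Lemma flat_derive (k : nat) (x : R) : is_derive x 1 (flat k) (flat k.+2 x - k%:R * flat k.+1 x).
Proof.
have [x0|x0|->] := ltgtP x 0.
- apply: (@near_eq_is_derive _ _ _ (cst 0)) => //.
    by near=> y; rewrite /flat ltNge ltW //=; near: y; exact: lt_nbhsl.
  by rewrite /flat ltNge ltW//= mulr0 subr0; exact: is_derive_cst.
- pose g (y : R) : R := (y^-1) ^+ k * expR (- y^-1).
  apply: (@near_eq_is_derive R R R g) => //.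
    by near=> y; rewrite /flat ifT //=; near: y; exact: lt_nbhsr.
  have dV : is_derive x 1 (fun y : R => y^-1) (- x ^- 2 *: 1).
    by apply: (@is_deriveV _ id) => //; rewrite gt_eqF.
  have dX := @is_deriveX _ _ _ k x 1 _ dV.
  have dN := @is_deriveN _ _ _ _ x 1 _ dV.
  have dE := @is_derive1_comp _ expR (fun y => - y^-1) x _ _ (is_derive_expR _) dN.
  have [D1 D2] := @is_deriveM _ _ _ _ x 1 _ _ dX dE.
  have gE : GRing.inv ^+ k * (expR \o (fun y : R => - y^-1)) = g.
    by apply/funext => y; rewrite /g mulrfctE exprfctE.
  rewrite gE in D1 D2; apply: DeriveDef; [exact: D1|apply: (etrans D2)].
  rewrite exprfctE /flat x0 /GRing.scale/= !mulr1.
  rewrite -exprVn; set y := x^-1; set E := expR _.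
  case: k {dX g gE D1 D2} => [|k] /=; first by ring.
  by rewrite !exprS; ring.
have z0 m : flat m 0 = 0 by rewrite /flat ltxx.
rewrite !z0 mulr0 subr0; apply/is_derive1_caratheodory.
exists (fun z => flat k z / z); split; first 1 last.
- have gle z : `|flat k z / z| <= (k.+2)`!%:R * `|z|.
    have [->|zn] := eqVneq z 0; first by rewrite z0 mul0r normr0 mulr0.
    rewrite normrM normfV ler_pdivrMr ?normr_gt0//.
    by rewrite -mulrA -expr2; exact: flat_le.
  rewrite /prop_for /continuous_at z0 mul0r.
  apply/cvgr0Pnorm_lt => e e0; near=> z.
  apply: le_lt_trans (gle z) _; rewrite mulrC -ltr_pdivlMr ?ltr0n ?fact_gt0//.
  near: z; apply/nbhs_ballP; exists (e / (k.+2)`!%:R) => /=.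
    by rewrite divr_gt0// ltr0n fact_gt0.
  by move=> z; rewrite /ball/= sub0r normrN.
- by rewrite z0 mul0r.
move=> z; rewrite z0 !subr0; have [->|zn] := eqVneq z 0; first by rewrite z0 mulr0.
by rewrite divfK.
Unshelve. all: by end_near. Qed.

Lemma differentiable_n_flat n (k : nat) : differentiable_n n (flat k).
Proof.
elim: n k => // n ih k.
exists (fun x => 1 * flat k.+2 x + (- k%:R) * flat k.+1 x).
  by move=> x; rewrite mul1r mulNr; exact: flat_derive.
exact: differentiable_n_comb.
Qed.

Definition bump (x : R) : R := flat 0 x * flat 0 (- 1 * x + 1).

Lemma smooth_bump : smooth bump.
Proof.
move=> n; apply: differentiable_nM; first exact: differentiable_n_flat.
by apply: differentiable_n_affine; exact: differentiable_n_flat.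
Qed.

Lemma flat_gt0 k (x : R) : 0 < x -> 0 < flat k x.
Proof.
by move=> x0; rewrite /flat x0 mulr_gt0 ?expR_gt0// exprn_gt0// invr_gt0.
Qed.

Lemma flat_ge0 k (x : R) : 0 <= flat k x.
Proof.
by have [/(flat_gt0 k)/ltW//|x0] := ltP 0 x; rewrite /flat ltNge x0.
Qed.

Lemma bump_ge0 x : 0 <= bump x.
Proof. by rewrite mulr_ge0// flat_ge0. Qed.

Lemma bump_gt0 x : 0 < x < 1 -> 0 < bump x.
Proof. by move=> /andP[x0 x1]; rewrite mulr_gt0// flat_gt0//; lra. Qed.

Lemma bump_left x : x <= 0 -> bump x = 0.
Proof. by move=> x0; rewrite /bump {1}/flat ltNge x0 /= mul0r. Qed.

Lemma bump_right x : 1 <= x -> bump x = 0.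
Proof.
move=> x1; rewrite /bump {2}/flat ltNge ifF ?mulr0//; apply/negbTE.
by rewrite negbK; lra.
Qed.

Lemma is_derive_continuous (f f' : R -> R) :
  (forall x : R, is_derive x 1 f (f' x)) -> continuous f.
Proof.
by move=> ff' x; apply/differentiable_continuous/derivable1_diffP; case: (ff' x).
Qed.

(* The antiderivative vanishing on the left, as an integral from -oo: this makes
   the fundamental theorem of calculus apply at every point. *)
Definition primitive (f : R -> R) (x : R) : R :=
  \int[@lebesgue_measure R]_(t in `]-oo, x]) f t.

Lemma primitive_left (f : R -> R) (x : R) : (forall y, y <= 0 -> f y = 0) ->
  x <= 0 -> primitive f x = 0.
Proof.
move=> f0 x0; rewrite /primitive; under eq_Rintegral => t.
  rewrite inE /= in_itv/= => tx; rewrite f0 ?(le_trans tx)//; over.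
by rewrite Rintegral_cst// mul0r.
Qed.

Lemma primitive_derive (f : R -> R) (x : R) : continuous f ->
  (forall y, y <= 0 -> f y = 0) -> is_derive x 1 (primitive f) (f x).
Proof.
move=> cf f0.
pose u := `|x| + 1; have xu : x < u by rewrite ltr_pwDr// ler_norm.
have [M [_ MP]] : bounded_set (f @` `[0, u]).
  apply: compact_bounded; apply: continuous_compact; last exact: segment_compact.
  exact: continuous_subspaceT.
have iu : (@lebesgue_measure R).-integrable `]-oo, u] (EFin \o f).
  have mf : measurable_fun setT f by exact: continuous_measurable_fun.
  have iS : (@lebesgue_measure R).-integrable setT (fun t => (`|M| + 1)%:E * (\1_(`[0, u]%classic) t)%:E)%E.
    by apply: integrableZl => //; exact: integrable_indic_itv.
  apply: (@le_integrable _ _ _ (@lebesgue_measure R) `]-oo, u]%classic _ (EFin \o f) (fun t => (`|M| + 1)%:E * (\1_(`[0, u]%classic) t)%:E)%E) => //.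
  - by apply/measurable_EFinP; exact: measurable_funTS.
  - move=> t /=; rewrite in_itv/= => tu; rewrite lee_fin indicE.
    have [t0|t0] := leP t 0; first by rewrite f0// normr0 normrM mulr_ge0.
    rewrite mem_set/= ?in_itv/= ?(ltW t0)// mulr1 (le_trans _ (ler_norm _))//.
    apply: MP; first by rewrite ltr_pwDr// ler_norm.
    by exists t => //; rewrite /= in_itv/= (ltW t0).
  - exact: integrableS iS.
have [|d1 d2] := continuous_FTC1 xu iu _ (cf x); first by rewrite ltNyr.
by apply: DeriveDef; [exact: d1|rewrite -derive1E].
Qed.

End smooth.

Section weak_concavity.
Context (R : realType).
Local Notation mu := (@lebesgue_measure R).

Lemma is_derive_MVT (f f' : R -> R) (x y : R) :
  (forall x : R, is_derive x 1 f (f' x)) -> x <= y ->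
  exists2 c, x <= c <= y & f y - f x = f' c * (y - x).
Proof.
move=> ff' xy.
have [|c] := @MVT_segment R f f' x y xy (fun z _ => ff' z).
  by apply: continuous_subspaceT; exact: is_derive_continuous ff'.
by rewrite in_itv/=; exists c.
Qed.

(** [Psi1] is a smooth step from 0 to [c0] and [Psi2], its primitive, a smooth convex function that
    vanishes for x <= 0 and is affine of slope [c0] for x >= 1: a mollified multiple of the positive
    part, from which smooth hat functions are assembled. *)
Let Psi1 := primitive R (bump R).
Let Psi2 := primitive R Psi1.

Let bump_continuous : continuous (bump R).
Proof. by have [f' ff' _] := smooth_bump R 1%N; exact: is_derive_continuous ff'. Qed.

Let dPsi1 : forall x : R, is_derive x 1 Psi1 (bump R x).
Proof. by move=> x; apply: primitive_derive => //; exact: bump_left. Qed.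

Let Psi1_left : forall x, x <= 0 -> Psi1 x = 0.
Proof. by move=> x; apply: primitive_left => //; exact: bump_left. Qed.

Let Psi1_continuous : continuous Psi1 := is_derive_continuous R _ _ dPsi1.

Let dPsi2 : forall x : R, is_derive x 1 Psi2 (Psi1 x).
Proof. by move=> x; exact: primitive_derive. Qed.

Let Psi2_left : forall x, x <= 0 -> Psi2 x = 0.
Proof. by move=> x; exact: primitive_left. Qed.

Let smooth_Psi2 : smooth R Psi2.
Proof.
case=> // -[|n]; first by exists Psi1 => //; exact: dPsi2.
exists Psi1; first exact: dPsi2.
by exists (bump R); [exact: dPsi1|exact: smooth_bump].
Qed.

Let Psi1_mono x y : x <= y -> Psi1 x <= Psi1 y.
Proof.
move=> xy; have [c _ e] := is_derive_MVT _ _ _ _ dPsi1 xy.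
by rewrite -subr_ge0 e mulr_ge0 ?bump_ge0// subr_ge0.
Qed.

Let c0 := Psi1 1.

Let c0_gt0 : 0 < c0.
Proof.
have q1 : (4%:R^-1 : R) <= 3 / 4 by lra.
have [c /andP[h1 h2] e] := is_derive_MVT _ _ _ _ dPsi1 q1.
have h3 : Psi1 (4%:R^-1) = Psi1 (3 / 4) - bump R c * (3 / 4 - 4%:R^-1) by rewrite -e; ring.
have h4 : 0 <= Psi1 (4%:R^-1).
  by rewrite -(Psi1_left 0 (lexx _)); apply: Psi1_mono; lra.
have h5 : Psi1 (3 / 4) <= c0 by apply: Psi1_mono; lra.
have h6 : 0 < bump R c by apply: bump_gt0; lra.
have h7 : 0 < bump R c * (3 / 4 - 4%:R^-1) by rewrite mulr_gt0//; lra.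
lra.
Qed.

Let Psi1_right x : 1 <= x -> Psi1 x = c0.
Proof.
move=> x1; have [c /andP[c1 _] e] := is_derive_MVT _ _ _ _ dPsi1 x1.
by apply/eqP; rewrite -subr_eq0 e bump_right// mul0r.
Qed.

Let Psi2_right x : 1 <= x -> Psi2 x = Psi2 1 + c0 * (x - 1).
Proof.
move=> x1; have [c /andP[c1 _] e] := is_derive_MVT _ _ _ _ dPsi2 x1.
by rewrite -(Psi1_right c c1) -e; ring.
Qed.

Let Psi2_convex (u w t : R) : u <= w -> 0 <= t <= 1 ->
  Psi2 ((1 - t) * u + t * w) <= (1 - t) * Psi2 u + t * Psi2 w.
Proof.
move=> uw /andP[t0 t1]; set v := _ + t * w.
have uv : u <= v by rewrite /v; nra.
have vw : v <= w by rewrite /v; nra.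
have [c1 /andP[_ cv] e1] := is_derive_MVT _ _ _ _ dPsi2 uv.
have [c2 /andP[vc _] e2] := is_derive_MVT _ _ _ _ dPsi2 vw.
have c12 : Psi1 c1 <= Psi1 c2 by apply: Psi1_mono; exact: le_trans cv vc.
have vu : v - u = t * (w - u) by rewrite /v; ring.
have wv : w - v = (1 - t) * (w - u) by rewrite /v; ring.
have -> : (1 - t) * Psi2 u + t * Psi2 w = Psi2 v +
   (t * (Psi2 w - Psi2 v) - (1 - t) * (Psi2 v - Psi2 u)) by ring.
rewrite lerDl e1 e2 vu wv.
have -> : t * (Psi1 c2 * ((1 - t) * (w - u))) - (1 - t) * (Psi1 c1 * (t * (w - u)))
  = (t * (1 - t) * (w - u)) * (Psi1 c2 - Psi1 c1) by ring.
by rewrite !mulr_ge0 ?subr_ge0.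
Qed.

Lemma continuous_integrable01 (h : R -> R) : continuous h ->
  mu.-integrable `]0, 1[ (EFin \o h).
Proof.
move=> ch; have : mu.-integrable `[0, 1] (EFin \o h).
  apply: continuous_compact_integrable; first exact: segment_compact.
  exact: continuous_subspaceT.
by apply: integrableS => //; exact: subset_itv_oo_cc.
Qed.
Lemma Rintegral01_derive (G g : R -> R) : (forall x : R, is_derive x 1 G (g x)) ->
  continuous g -> \int[mu]_(x in `]0, 1[) g x = G 1 - G 0.
Proof.
move=> Gg cg.
have cG := is_derive_continuous R _ _ Gg.
rewrite Rintegral_itv_obnd_cbnd; last first.
  exact: continuous_integrable01.
rewrite Rintegral_itv_bndo_bndc; last first.
  have : mu.-integrable `[0, 1] (EFin \o g).
    apply: continuous_compact_integrable; first exact: segment_compact.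
    exact: continuous_subspaceT.
  by apply: integrableS => // x /=; rewrite !in_itv/= => /andP[-> /ltW ->].
rewrite /Rintegral (@continuous_FTC2 R g G)//.
- exact: continuous_subspaceT.
- split; [by move=> x _; case: (Gg x)|exact/cvg_at_right_filter/cG|exact/cvg_at_left_filter/cG].
- by move=> x _; rewrite derive1E (@derive_val _ _ _ _ _ _ _ (Gg x)).
Qed.

Let bmp (a e x : R) := bump R (e^-1 * x + - (a / e)).

Let bmp_continuous a e : continuous (bmp a e).
Proof.
move=> x; apply: (@continuous_comp _ _ _ (fun x => e^-1 * x + - (a / e)) (bump R)).
  by apply: cvgD; [apply: cvgM; [exact: cvg_cst|exact: cvg_id]|exact: cvg_cst].
exact: bump_continuous.
Qed.

Let bmpE (a e x : R) : e^-1 * x + - (a / e) = (x - a) / e.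
Proof. by rewrite mulrBl mulrC. Qed.

Let bmp_int a e : 0 < a -> 0 < e -> a + e < 1 ->
  \int[mu]_(x in `]0, 1[) bmp a e x = e * c0.
Proof.
move=> a0 e0 ae1.
have dG (x : R) : is_derive x 1 (fun x => e * Psi1 (e^-1 * x + - (a / e))) (bmp a e x).
  have d1 := is_derive_affine R Psi1 (bump R) e^-1 (- (a / e)) x dPsi1.
  have d2 := @is_deriveZ _ _ _ _ e x 1 _ d1.
  have -> : bmp a e x = e *: (e^-1 * bump R (e^-1 * x + - (a / e))).
    by rewrite /GRing.scale/= mulrA divff ?gt_eqF// mul1r.
  exact: d2.
rewrite (Rintegral01_derive _ _ dG (bmp_continuous a e)).
rewrite !bmpE Psi1_right; last by rewrite ler_pdivlMr// mul1r lerBrDl ltW.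
by rewrite Psi1_left ?mulr0 ?subr0// sub0r pmulr_lle0 ?invr_gt0// oppr_le0 ltW.
Qed.

Let bmp_est (v : R -> R) (a e d : R) : continuous v -> 0 < a -> 0 < e -> a + e < 1 ->
  (forall x, a <= x <= a + e -> `|v x - v a| <= d) ->
  (v a - d) * (e * c0) <= \int[mu]_(x in `]0, 1[) (v x * bmp a e x) <=
  (v a + d) * (e * c0).
Proof.
move=> cv a0 e0 ae vd.
have i1 k : mu.-integrable `]0, 1[ (EFin \o (fun x => k * bmp a e x)).
  by apply: continuous_integrable01 => x; apply: cvgM; [exact: cvg_cst|exact: bmp_continuous].
have i2 : mu.-integrable `]0, 1[ (EFin \o (fun x => v x * bmp a e x)).
  by apply: continuous_integrable01 => x; apply: cvgM; [exact: cv|exact: bmp_continuous].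
have i3 : mu.-integrable `]0, 1[ (EFin \o bmp a e).
  by apply: continuous_integrable01; exact: bmp_continuous.
have key x : (v a - d) * bmp a e x <= v x * bmp a e x <= (v a + d) * bmp a e x.
  have b0 := bump_ge0 R (e^-1 * x + - (a / e)).
  have [xa|ax] := leP x a.
    have -> : bmp a e x = 0.
      by apply: bump_left; rewrite bmpE pmulr_lle0 ?invr_gt0// subr_le0.
    by rewrite !mulr0 lexx.
  have [ex|xe] := leP (a + e) x.
    have -> : bmp a e x = 0.
      by apply: bump_right; rewrite bmpE ler_pdivlMr// mul1r lerBrDl.
    by rewrite !mulr0 lexx.
  have := vd x; rewrite (ltW ax) (ltW xe) => /(_ isT); rewrite ler_norml => /andP[h1 h2].
  by apply/andP; split; rewrite ler_wpM2r//; lra.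
rewrite -!(bmp_int a e a0 e0 ae) -!RintegralZl//.
by apply/andP; split; apply: le_Rintegral => // x _; have /andP[] := key x.
Qed.

(** The test function [phi] is a mollified hat, the Green function of the second derivative on
    [a, b] with pole at the barycentre [m]. Its second derivative is a combination of bumps at [a],
    [m] and [b] with weights 1 - t, -1 and t, so that testing against it evaluates the concavity
    defect of [v]; the sign comes from [phi >= 0] and [g <= K]. *)
Lemma weak_concave (u g : R -> R) (K C a b t : R) : continuous u ->
  measurable_fun (`]0, 1[%classic : set R) g ->
  {ae mu, forall x : R, 0 < x < 1 -> `|g x| <= C /\ g x <= K} ->
  (forall phi : R -> R, test_unit_interval phi ->
    \int[mu]_(x in `]0, 1[) (u x * derive1n 2 phi x) =
    \int[mu]_(x in `]0, 1[) (g x * phi x)) ->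
  0 < a -> a <= b -> b < 1 -> 0 <= t <= 1 ->
  (1 - t) * (u a - K * (a ^+ 2 / 2)) + t * (u b - K * (b ^+ 2 / 2)) <=
  u ((1 - t) * a + t * b) - K * (((1 - t) * a + t * b) ^+ 2 / 2).
Proof.
move=> cu mg gCK wd a0 ab b1 /andP[t0 t1].
pose v x := u x - K * (x ^+ 2 / 2); rewrite -/(v a) -/(v b) -/(v _).
set m := _ + t * b.
have am : a <= m by rewrite /m; nra.
have mb : m <= b by rewrite /m; nra.
have cv : continuous v.
  move=> x; apply: cvgB; first exact: cu.
  apply: cvgM; first exact: cvg_cst.
  by apply: cvgM; [exact: exprn_continuous|exact: cvg_cst].
apply/ler_addgt0Pr => d' d'0.
pose d := d' / 2; have d0 : 0 < d by rewrite divr_gt0.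
have near_v y : exists2 r, 0 < r & forall x, y <= x <= y + r -> `|v x - v y| <= d.
  have /cvgrPdist_le/(_ d d0)/nbhs_ballP[r /= r0 rP] := cv y.
  exists (r / 2); first by rewrite divr_gt0.
  move=> x /andP[yx xr]; rewrite distrC; apply: rP; rewrite /ball/= distrC ger0_norm; lra.
have [ra ra0 raP] := near_v a.
have [rm rm0 rmP] := near_v m.
have [rb rb0 rbP] := near_v b.
(* A common width for the three bumps: on each of them [v] varies by at most [d], and [b + e < 1]
   keeps the support of the test function inside ]0, 1[. *)
pose e := Num.min (Num.min ra rm) (Num.min rb ((1 - b) / 2)).
have e0 : 0 < e by rewrite !lt_min ra0 rm0 rb0 divr_gt0// subr_gt0.
have era : e <= ra by rewrite !ge_min lexx.
have erm : e <= rm by rewrite !ge_min lexx orbT.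
have erb : e <= rb by rewrite !ge_min lexx !orbT.
have eb : e <= (1 - b) / 2 by rewrite !ge_min lexx !orbT.
pose B x := (1 - t) * bmp a e x - bmp m e x + t * bmp b e x.
have cB : continuous B.
  move=> x; apply: cvgD; last by apply: cvgM; [exact: cvg_cst|exact: bmp_continuous].
  apply: cvgB; last exact: bmp_continuous.
  by apply: cvgM; [exact: cvg_cst|exact: bmp_continuous].
(* Replacing [v] by its values at [a], [m], [b] costs [d] for each bump; the absolute weights 1 - t,
   1 and t add up to 2, and [2 * d] is [d']. *)
suff IB : \int[mu]_(x in `]0, 1[) (v x * B x) <= 0.
  have [] := (bmp_est v a e d cv a0 e0 (ltac:(lra)) (fun x h => raP x (ltac:(lra))),
              bmp_est v m e d cv (lt_le_trans a0 am) e0 (ltac:(lra)) (fun x h => rmP x (ltac:(lra)))).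
  have := bmp_est v b e d cv (lt_le_trans a0 ab) e0 (ltac:(lra)) (fun x h => rbP x (ltac:(lra))).
  have i2 y k : mu.-integrable `]0, 1[ (EFin \o (fun x => k * (v x * bmp y e x))).
    apply: continuous_integrable01 => x; apply: cvgM; first exact: cvg_cst.
    by apply: cvgM; [exact: cv|exact: bmp_continuous].
  have i3 y : mu.-integrable `]0, 1[ (EFin \o (fun x => (v x * bmp y e x))).
    apply: continuous_integrable01 => x.
    by apply: cvgM; [exact: cv|exact: bmp_continuous].
  move: IB.
  have -> : \int[mu]_(x in `]0, 1[) (v x * B x) =
     (1 - t) * \int[mu]_(x in `]0, 1[) (v x * bmp a e x) -
     \int[mu]_(x in `]0, 1[) (v x * bmp m e x) +
     t * \int[mu]_(x in `]0, 1[) (v x * bmp b e x).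
    rewrite -!RintegralZl// -RintegralB// -RintegralD//.
      by apply: eq_Rintegral => x _; rewrite /B; ring.
    apply: continuous_integrable01 => x; apply: cvgB.
      apply: cvgM; first exact: cvg_cst.
      by apply: cvgM; [exact: cv|exact: bmp_continuous].
    by apply: cvgM; [exact: cv|exact: bmp_continuous].
  set Ia := \int[mu]_(x in _) (v x * bmp a e x).
  set Im := \int[mu]_(x in _) (v x * bmp m e x).
  set Ib := \int[mu]_(x in _) (v x * bmp b e x).
  move=> IB /andP[hb _] [/andP[ha _] /andP[_ hm]].
  have ec : 0 < e * c0 by rewrite mulr_gt0.
  have h1 := ler_wpM2l (ltac:(lra) : 0 <= 1 - t) ha.
  have h2 := ler_wpM2l t0 hb.
  have h3 : ((1 - t) * v a + t * v b) * (e * c0) <= (v m + d') * (e * c0).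
    have -> : d' = d + d by rewrite /d; field.
    move: h1 h2 hm IB; set k := e * c0; nra.
  by rewrite (ler_pM2r ec) in h3.
pose phi x := (1 - t) * Psi2 (e^-1 * x + - (a / e)) - Psi2 (e^-1 * x + - (m / e))
   + t * Psi2 (e^-1 * x + - (b / e)).
pose phi1 x := (1 - t) * (e^-1 * Psi1 (e^-1 * x + - (a / e))) -
   e^-1 * Psi1 (e^-1 * x + - (m / e)) + t * (e^-1 * Psi1 (e^-1 * x + - (b / e))).
have dcomb (f0 f1 f2 f0' f1' f2' : R -> R) (x : R) :
  is_derive x 1 f0 (f0' x) -> is_derive x 1 f1 (f1' x) -> is_derive x 1 f2 (f2' x) ->
  is_derive x 1 (fun x => (1 - t) * f0 x - f1 x + t * f2 x)
    ((1 - t) * f0' x - f1' x + t * f2' x).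
  move=> h0 h1 h2.
  exact: (@is_deriveD _ _ _ (fun x => (1 - t) *: f0 x - f1 x) (fun x => t *: f2 x)).
have dphi (x : R) : is_derive x 1 phi (phi1 x).
  have h y := is_derive_affine R Psi2 Psi1 e^-1 (- (y / e)) x dPsi2.
  exact: (dcomb _ _ _ (fun x => e^-1 * Psi1 (e^-1 * x + - (a / e)))
    (fun x => e^-1 * Psi1 (e^-1 * x + - (m / e)))
    (fun x => e^-1 * Psi1 (e^-1 * x + - (b / e))) x (h a) (h m) (h b)).
have dphi1 (x : R) : is_derive x 1 phi1 (e^-1 ^+ 2 * B x).
  have -> : e^-1 ^+ 2 * B x = (1 - t) * (e^-1 * (e^-1 * bmp a e x)) -
     e^-1 * (e^-1 * bmp m e x) + t * (e^-1 * (e^-1 * bmp b e x)) by rewrite /B; ring.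
  have h y : is_derive x 1 (fun x => e^-1 * Psi1 (e^-1 * x + - (y / e)))
      (e^-1 * (e^-1 * bmp y e x)).
    have d1 := is_derive_affine R Psi1 (bump R) e^-1 (- (y / e)) x dPsi1.
    exact: (@is_deriveZ _ _ _ _ e^-1 x 1 _ d1).
  exact: (dcomb _ _ _ (fun x => e^-1 * (e^-1 * bmp a e x)) (fun x => e^-1 * (e^-1 * bmp m e x))
    (fun x => e^-1 * (e^-1 * bmp b e x)) x (h a) (h m) (h b)).
have phi_ge0 x : 0 <= phi x.
  rewrite /phi !bmpE.
  have -> : (x - m) / e = (1 - t) * ((x - b) / e) + t * ((x - b) / e)
     + (1 - t) * ((b - a) / e) by rewrite /m; field; rewrite gt_eqF.
  have -> : (1 - t) * ((x - b) / e) + t * ((x - b) / e) + (1 - t) * ((b - a) / e) =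
    (1 - (1 - t)) * ((x - b) / e) + (1 - t) * ((x - a) / e) by field; rewrite gt_eqF.
  have /(Psi2_convex _ _ (1 - t)) : (x - b) / e <= (x - a) / e.
    by rewrite ler_pM2r ?invr_gt0// lerB.
  move=> H; have {}H := H (ltac:(by apply/andP; split; lra)); lra.
have phi_left x : x <= a -> phi x = 0.
  move=> xa; rewrite /phi !bmpE !Psi2_left ?mulr0 ?subr0 ?addr0//.
  - by rewrite pmulr_lle0 ?invr_gt0//; lra.
  - by rewrite pmulr_lle0 ?invr_gt0//; lra.
  - by rewrite pmulr_lle0 ?invr_gt0//; lra.
(* To the right of all bumps the three copies of [Psi2] are affine, and they cancel because [m] is
   the barycentre of [a] and [b]. *)
have phi_right x : b + e <= x -> phi x = 0.
  move=> bx; have h y : y <= b -> 1 <= (x - y) / e.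
    by move=> yb; rewrite ler_pdivlMr// mul1r; lra.
  rewrite /phi !bmpE (Psi2_right _ (h a ab)) (Psi2_right _ (h m mb)).
  rewrite (Psi2_right _ (h b (lexx b))) /m.
  by move: (Psi2 1) c0 e^-1 => P c y; ring.
have phi2E : derive1n 2 phi = (fun x => e^-1 ^+ 2 * B x).
  rewrite derive1Sn (is_derive_derive1 _ _ _ dphi) derive1n1.
  exact: is_derive_derive1 dphi1.
have tphi : test_unit_interval phi.
  split.
    apply: smooth_derivable => n.
    have sP y : differentiable_n R n (fun x => Psi2 (e^-1 * x + - (y / e))).
      by apply: differentiable_n_affine; exact: smooth_Psi2.
    have -> : phi = fun x => 1 * ((1 - t) * Psi2 (e^-1 * x + - (a / e)) +
        (- 1) * Psi2 (e^-1 * x + - (m / e))) + t * Psi2 (e^-1 * x + - (b / e)).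
      by apply/funext => x; rewrite /phi; ring.
    by apply: differentiable_n_comb => //; exact: differentiable_n_comb.
  have : [set x | phi x != 0] `<=` `[a, b + e].
    move=> x /= px; rewrite in_itv/=; apply/andP; split; rewrite leNgt;
      apply/negP => h; move: px; rewrite ?(phi_left x (ltW h)) ?(phi_right x (ltW h)) eqxx//.
  have cl : closed (`[a, b + e]%classic : set R) by exact: interval_closed.
  move=> /closureS; rewrite -((closure_id _).1 cl).
  move=> /subset_trans; apply => x /=; rewrite !in_itv/= => /andP[h1 h2].
  by apply/andP; split; lra.
have cphi := is_derive_continuous R _ _ dphi.
have cphi1 := is_derive_continuous R _ _ dphi1.
have icphi k : mu.-integrable `]0, 1[ (EFin \o (fun x => k * phi x)).
  by apply: continuous_integrable01 => x; apply: cvgM; [exact: cvg_cst|exact: cphi].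
(* [phi] is recovered from [phi''] by integrating by parts against [x^2/2] *)
have Iphi : \int[mu]_(x in `]0, 1[) phi x =
    \int[mu]_(x in `]0, 1[) (x ^+ 2 / 2 * (e^-1 ^+ 2 * B x)).
  have cq : continuous (fun x : R => x ^+ 2 / 2 * (e^-1 ^+ 2 * B x)).
    move=> x; apply: cvgM.
      by apply: cvgM; [exact: exprn_continuous|exact: cvg_cst].
    by apply: cvgM; [exact: cvg_cst|exact: cB].
  apply/esym/eqP; rewrite -subr_eq0 -RintegralB//; last 2 first.
  - exact: continuous_integrable01.
  - exact: continuous_integrable01.
  have dH (x : R) : is_derive x 1 (fun x => x ^+ 2 / 2 * phi1 x - x * phi x)
      (x ^+ 2 / 2 * (e^-1 ^+ 2 * B x) - phi x).
    have dp1 := dphi1 x; have dp := dphi x.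
    have dq : is_derive x 1 (fun x : R => x ^+ 2 / 2) x.
      have dX := @is_deriveX _ _ id 2 x 1 _ (is_derive_id x 1).
      have [D1 D2] := @is_deriveZ _ _ _ _ (2^-1 : R) x 1 _ dX.
      have E : 2^-1 \*: id ^+ 2 = (fun x : R => x ^+ 2 / 2).
        by apply/funext => y; rewrite /= exprfctE /GRing.scale/= mulrC.
      rewrite E in D1 D2; apply: DeriveDef => //; rewrite D2 /GRing.scale/=.
      by rewrite expr1; field.
    have dM1 := @is_deriveM _ _ _ _ x 1 _ _ dq dp1.
    have dM2 := @is_deriveM _ _ _ _ x 1 _ _ (is_derive_id x 1) dp.
    have [D1 D2] := @is_deriveB _ _ _ _ _ x 1 _ _ dM1 dM2.
    apply: DeriveDef; [exact: D1|apply: (etrans D2)].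
    by rewrite /GRing.scale/=; ring.
  rewrite (Rintegral01_derive _ _ dH); last by move=> x; apply: cvgB; [exact: cq|exact: cphi].
  have z0 : phi 0 = 0 by apply: phi_left; exact: ltW.
  have z1 : phi 1 = 0 by apply: phi_right; lra.
  have -> : phi1 1 = 0.
    rewrite /phi1 !bmpE !Psi1_right; first by move: c0 e^-1 => c y; ring.
    + by rewrite ler_pdivlMr// mul1r; lra.
    + by rewrite ler_pdivlMr// mul1r; lra.
    + by rewrite ler_pdivlMr// mul1r; lra.
  by rewrite z0 z1 expr0n/= !mul0r !mulr0 !subrr.
have Igphi : \int[mu]_(x in `]0, 1[) (g x * phi x) <= K * \int[mu]_(x in `]0, 1[) phi x.
  pose C' := Num.max `|K| C.
  have KC' : - C' <= K.
    by rewrite lerNl (le_trans (ler_norm _))// normrN /C' le_max lexx.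
  have CC' : C <= C' by rewrite /C' le_max lexx orbT.
  have C'0 : 0 <= C' by rewrite /C' le_max normr_ge0.
  (* The bounds on [g] hold almost everywhere only. The truncation has the same integrals and is
     bounded everywhere, hence integrable against [phi], as the comparison of real-valued integrals
     requires. *)
  pose g1 x := Num.max (- C') (Num.min K (g x)).
  have g1K x : g1 x <= K by rewrite /g1 ge_max KC' ge_min lexx.
  have g1C x : `|g1 x| <= C'.
    rewrite ler_norml /g1 le_max lexx/= ge_max ge_min.
    by rewrite (le_trans _ C'0) ?oppr_le0//= /C' le_max ler_norm.
  have mphi : measurable_fun (`]0, 1[%classic : set R) phi.
    by apply: measurable_funTS; exact: continuous_measurable_fun.
  have mg1 : measurable_fun (`]0, 1[%classic : set R) g1.
    by apply: measurable_maxr => //; exact: measurable_minr.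
  have -> : \int[mu]_(x in `]0, 1[) (g x * phi x) = \int[mu]_(x in `]0, 1[) (g1 x * phi x).
    congr fine; apply: ae_eq_integral => //.
    - by apply/measurable_EFinP; exact: measurable_funM.
    - by apply/measurable_EFinP; exact: measurable_funM.
    apply: ae_mono gCK => x gx /=; rewrite in_itv/= => x01.
    have [gC gK] := gx x01; rewrite /g1 (min_idPr gK) (max_idPr _)//.
    by rewrite lerNl (le_trans (ler_norm _))// normrN (le_trans gC).
  rewrite -RintegralZl//; last exact: continuous_integrable01.
  apply: le_Rintegral => //; last by move=> x _; rewrite ler_wpM2r.
    apply: (@le_integrable _ _ _ mu `]0, 1[%classic _ _ (EFin \o (fun x => C' * phi x))) => //.
    - by apply/measurable_EFinP; exact: measurable_funM.
    - move=> x _; rewrite lee_fin normrM [leRHS]ger0_norm ?mulr_ge0//.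
      by rewrite (ger0_norm (phi_ge0 x)) ler_wpM2r.
have := wd phi tphi; rewrite phi2E => Eu.
have cuB : mu.-integrable `]0, 1[ (EFin \o (fun x => u x * (e^-1 ^+ 2 * B x))).
  apply: continuous_integrable01 => x; apply: cvgM; first exact: cu.
  by apply: cvgM; [exact: cvg_cst|exact: cB].
have cqB k : mu.-integrable `]0, 1[ (EFin \o (fun x => k * (x ^+ 2 / 2 * (e^-1 ^+ 2 * B x)))).
  apply: continuous_integrable01 => x; apply: cvgM; first exact: cvg_cst.
  apply: cvgM.
    by apply: cvgM; [exact: exprn_continuous|exact: cvg_cst].
  by apply: cvgM; [exact: cvg_cst|exact: cB].
have cqB1 : mu.-integrable `]0, 1[ (EFin \o (fun x => x ^+ 2 / 2 * (e^-1 ^+ 2 * B x))).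
  have := cqB 1; congr (_.-integrable _ _); apply/funext => x.
  by rewrite /= mul1r.
have cvB : mu.-integrable `]0, 1[ (EFin \o (fun x => v x * B x)).
  by apply: continuous_integrable01 => x; apply: cvgM; [exact: cv|exact: cB].
have e2 : 0 < e^-1 ^+ 2 by rewrite exprn_gt0// invr_gt0.
rewrite -(pmulr_rle0 _ e2) -RintegralZl//.
have -> : \int[mu]_(x in `]0, 1[) (e^-1 ^+ 2 * (v x * B x)) =
    \int[mu]_(x in `]0, 1[) (u x * (e^-1 ^+ 2 * B x)) -
    K * \int[mu]_(x in `]0, 1[) (x ^+ 2 / 2 * (e^-1 ^+ 2 * B x)).
  rewrite -RintegralZl// -RintegralB//.
  by apply: eq_Rintegral => x _; rewrite /v; ring.
by rewrite Eu -Iphi subr_le0.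
Qed.

End weak_concavity.

(** * The speed as a function of density and specific volume *)

Lemma cvg_natSSinv (R : realType) : (fun n : nat => n.+2%:R^-1 : R) @ \oo --> 0.
Proof. by have := @cvg_harmonic R; rewrite -(cvg_shiftS (@harmonic R)). Qed.

(** Contraction towards 1/2 is affine, so it preserves convex combinations while moving the end
    points into the open interval; continuity then lets it tend to the identity. *)
Lemma concave_closure (R : realType) (v : R -> R) : continuous v ->
  (forall a b t, 0 < a -> a <= b -> b < 1 -> 0 <= t <= 1 ->
    (1 - t) * v a + t * v b <= v ((1 - t) * a + t * b)) ->
  forall a b t, 0 <= a -> a <= b -> b <= 1 -> 0 <= t <= 1 ->
    (1 - t) * v a + t * v b <= v ((1 - t) * a + t * b).
Proof.
move=> cv H a b t a0 ab b1 t01.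
pose s n : R := n.+2%:R^-1.
have cs : s @ \oo --> 0 by exact: cvg_natSSinv.
have s0 n : 0 < s n by rewrite invr_gt0.
have s1 n : s n < 1 by rewrite invf_lt1// ltr1n.
pose A (x : R) n := x + s n * (2^-1 - x).
have cA x : v (A x n) @[n --> \oo] --> v x.
  apply: (continuous_cvg _ (cv x)).
  rewrite -[X in _ --> X]addr0 -[X in _ --> _ + X](mul0r (2^-1 - x)).
  by apply: cvgD; [exact: cvg_cst|apply: cvgM => //; exact: cvg_cst].
have cl : (1 - t) * v (A a n) + t * v (A b n) @[n --> \oo] --> (1 - t) * v a + t * v b.
  by apply: cvgD; apply: cvgM; first [exact: cvg_cst|exact: cA].
apply: (ler_cvg_to cl (cA ((1 - t) * a + t * b))); near=> n.
have -> : A ((1 - t) * a + t * b) n = (1 - t) * A a n + t * A b n by rewrite /A; ring.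
have sn0 := s0 n; have sn1 := s1 n.
by apply: H => //; rewrite /A; nra.
Unshelve. all: by end_near. Qed.

(** Integrability is irrelevant here, since [fine] sends both infinite values to 0. *)
Lemma RintegralN (d : measure_display) (T : measurableType d) (R : realType)
    (m : {measure set T -> \bar R}) (D : set T) (h : T -> R) :
  \int[m]_(x in D) (- h x) = - \int[m]_(x in D) h x.
Proof.
rewrite /Rintegral integralE [in RHS]integralE.
have -> : (fun x => (- h x)%:E) = (fun x => - (h x)%:E)%E :> (T -> \bar R).
  by apply/funext => x; rewrite EFinN.
rewrite funeposN funenegN.
have : (0 <= \int[m]_(x in D) ((fun x => (h x)%:E)^\+ x))%E by exact: integral_ge0.
have : (0 <= \int[m]_(x in D) ((fun x => (h x)%:E)^\- x))%E by exact: integral_ge0.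
case: (\int[m]_(x in D) _)%E => [a| |]; case: (\int[m]_(x in D) _)%E => [b| |] //= _ _.
- by rewrite opprB.
- by rewrite oppr0.
- by rewrite oppr0.
- by rewrite oppr0.
Qed.

Section flux_facts.
Context (R : realType).
Variables (Vmin Vmax : R -> R).
Local Notation mu := (@lebesgue_measure R).

(** The speeds are continuous on [0, 1] only; composing with this projection gives the continuity on
    the whole line that [weak_concave] asks for. *)
Definition clamp (x : R) : R := Num.max 0 (Num.min 1 x).

Lemma clamp_itv x : 0 <= clamp x <= 1.
Proof. by rewrite /clamp le_max lexx/= ge_max ler01 ge_min lexx. Qed.

Lemma clampE x : 0 <= x <= 1 -> clamp x = x.
Proof. by move=> /andP[x0 x1]; rewrite /clamp (min_idPr x1) (max_idPr x0). Qed.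

Lemma clamp_continuous : continuous clamp.
Proof.
have cE x : clamp x = if x < 0 then 0 else if 1 < x then 1 else x.
  rewrite /clamp; case: (ltP x 0) => x0.
    by rewrite (@min_r _ _ 1 x) ?(max_l (ltW x0))// ltW// (lt_trans x0).
  by case: (ltP 1 x) => x1; rewrite ?(max_r ler01) ?(max_r x0).
apply: (@lip_continuous _ _ 1) => x y; rewrite mul1r !cE.
have h1 := ler_norm (x - y); have := ler_norm (- (x - y)); rewrite normrN => h2.
rewrite ler_norml; case: (ltP x 0) => x0; case: (ltP y 0) => y0;
  case: (ltP 1 x) => x1; case: (ltP 1 y) => y1; apply/andP; split; lra.
Qed.

Lemma comp_clamp_continuous (u : R -> R) : {within `[0, 1], continuous u} ->
  continuous (u \o clamp).
Proof.
move=> /subspace_continuousP cu x.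
have cx : `[0, 1]%classic (clamp x) by rewrite /= in_itv/=; exact: clamp_itv.
apply: (cvg_comp _ _ _ (cu _ cx)).
move=> S [e /= e0 Se]; have := clamp_continuous x.
move=> /cvgrPdist_lt/(_ e e0); apply: filterS => y xy.
by apply: Se => //=; rewrite in_itv/=; exact: clamp_itv.
Qed.

Definition speed (r w : R) : R := (1 - w) * Vmin r + w * Vmax r.

Lemma flux_speed r w : flux Vmin Vmax r w = r * speed r w. Proof. by []. Qed.

Variables (eta eps : R).
Hypotheses (cVmin : {within `[0, 1], continuous Vmin})
  (cVmax : {within `[0, 1], continuous Vmax}).
Hypothesis Vmin0 : forall x : R, 0 <= x <= 1 -> 0 <= Vmin x.
Hypothesis Vmax0 : forall x : R, 0 <= x <= 1 -> 0 <= Vmax x.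
Hypothesis decr_min : forall x y : R, 0 <= x -> x <= y -> y <= 1 -> Vmin y <= Vmin x.
Hypothesis decr_max : forall x y : R, 0 <= x -> x <= y -> y <= 1 -> Vmax y <= Vmax x.
Hypothesis Vmin_le : forall x : R, 0 <= x <= 1 -> Vmin x <= Vmax x.
Hypothesis Vmin1 : Vmin 1 = 0.
Hypothesis Vmax1 : Vmax 1 = 0.
Hypothesis eta0 : 0 < eta.
Hypothesis conc : forall w : R, 0 <= w <= 1 ->
  exists2 g : R -> R, weak_derivative 2 (fun r => flux Vmin Vmax r w) g &
    {ae mu, forall r, 0 < r < 1 -> g r < - eta}.

Let fl (w r : R) : R := flux Vmin Vmax (clamp r) w.

Let fl_continuous w : continuous (fl w).
Proof.
have cm := comp_clamp_continuous _ cVmin; have cM := comp_clamp_continuous _ cVmax.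
move=> r; apply: cvgM; first exact: clamp_continuous.
by apply: cvgD; apply: cvgM; first [exact: cvg_cst|exact: cm|exact: cM].
Qed.

Let flE w r : 0 <= r <= 1 -> fl w r = flux Vmin Vmax r w.
Proof. by move=> r01; rewrite /fl clampE. Qed.

Let flux_weak (w : R) : 0 <= w <= 1 -> exists (g : R -> R) (C : R),
  [/\ measurable_fun (`]0, 1[%classic : set R) g,
      {ae mu, forall x : R, 0 < x < 1 -> `|g x| <= C /\ g x <= - eta},
      0 <= C &
      forall phi : R -> R, test_unit_interval phi ->
        \int[mu]_(x in `]0, 1[) (fl w x * derive1n 2 phi x) =
        \int[mu]_(x in `]0, 1[) (g x * phi x)].
Proof.
move=> w01; have [g [[C [mg gC]] gw] geta] := conc w w01.
exists g, `|C|; split => //.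
- apply: ae_mono (filterI gC geta) => x [/= h1 h2] x01; split; last exact/ltW/h2.
  have := h1; rewrite !in_itv/= x01 => /(_ isT); rewrite -ler_norml => /le_trans; apply.
  exact: ler_norm.
- move=> phi tphi; have := gw phi tphi; rewrite expr2 mulrN1 opprK mul1r => <-.
  apply: eq_Rintegral => x; rewrite inE/= in_itv/= => /andP[x0 x1].
  by rewrite flE// !ltW.
Qed.

(** This is [weak_concave] with [K = - eta], extended to the closed interval: the remaining term is
    the concavity defect of the parabola - eta x^2 / 2 on the chord. *)
Lemma flux_strong_concave (w a b t : R) : 0 <= w <= 1 -> 0 <= a -> a <= b -> b <= 1 ->
  0 <= t <= 1 ->
  (1 - t) * flux Vmin Vmax a w + t * flux Vmin Vmax b w
    + eta / 2 * (t * (1 - t) * (b - a) ^+ 2) <=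
  flux Vmin Vmax ((1 - t) * a + t * b) w.
Proof.
move=> w01 a0 ab b1 t01; have [g [C [mg aeg C0 wg]]] := flux_weak w w01.
have H := @weak_concave R (fl w) g (- eta) C _ _ _ (fl_continuous w) mg aeg wg.
pose v x := fl w x - - eta * (x ^+ 2 / 2).
have cv : continuous v.
  move=> x; apply: cvgB; first exact: fl_continuous.
  apply: cvgM; first exact: cvg_cst.
  by apply: cvgM; [exact: exprn_continuous|exact: cvg_cst].
have := concave_closure R v cv H a b t a0 ab b1 t01.
have /andP[t0 t1] := t01.
by rewrite /v !flE; [nra|nra|nra|nra].
Qed.

Lemma speed_bounds (r w : R) : 0 <= r <= 1 -> 0 <= w <= 1 -> 0 <= speed r w <= Vmax 0.
Proof.
move=> r01 /andP[w0 w1]; have /andP[r0 r1] := r01.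
have h1 := Vmin0 r r01; have h2 := Vmin_le r r01.
have h3 := decr_max 0 r (lexx _) r0 r1.
by rewrite /speed; apply/andP; split; nra.
Qed.

Lemma speed1 w : speed 1 w = 0.
Proof. by rewrite /speed Vmin1 Vmax1 !mulr0 addr0. Qed.

(** Since the second derivative is also bounded below, by - C, adding C r^2 / 2 makes the flux
    convex. Comparison with the chord from the origin, where the flux vanishes, places f(a) between
    [a * speed b w] and that value plus C a (b - a) / 2. The constant obtained this way depends on
    [w]; as the flux is affine in [w], the constants for 0 and 1 give a uniform one. *)
Lemma flux_lipschitz : exists2 L : R, 0 <= L & forall w a b : R, 0 <= w <= 1 ->
  0 <= a <= 1 -> 0 <= b <= 1 ->
  `|flux Vmin Vmax a w - flux Vmin Vmax b w| <= L * `|a - b|.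
Proof.
suff H (w : R) : 0 <= w <= 1 -> exists2 L : R, 0 <= L & forall a b : R, 0 <= a -> a < b -> b <= 1 ->
    `|flux Vmin Vmax a w - flux Vmin Vmax b w| <= L * (b - a).
  have [|L0 L00 L0P] := H 0; first by rewrite lexx ler01.
  have [|L1 L10 L1P] := H 1; first by rewrite lexx ler01.
  exists (L0 + L1); first by rewrite addr_ge0.
  move=> w a b /andP[w0 w1]; wlog ab : a b / a < b.
    move=> W a01 b01; have [ab|ba|->] := ltgtP a b; first exact: W.
      by rewrite distrC (distrC a); exact: W.
    by rewrite !subrr normr0 mulr0.
  move=> /andP[a0 a1] /andP[b0 b1].
  have h0 := L0P a b a0 ab b1; have h1 := L1P a b a0 ab b1.
  have -> : flux Vmin Vmax a w - flux Vmin Vmax b w =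
    (1 - w) * (flux Vmin Vmax a 0 - flux Vmin Vmax b 0)
    + w * (flux Vmin Vmax a 1 - flux Vmin Vmax b 1) by rewrite /flux; ring.
  rewrite (le_trans (ler_normD _ _))// !normrM (ger0_norm w0) ger0_norm ?subr_ge0//.
  rewrite (distrC a b) [`|b - a|]gtr0_norm ?subr_gt0//.
  rewrite [leRHS]mulrDl; have d0 : 0 <= b - a by rewrite subr_ge0 ltW.
  have := mulr_ge0 L00 d0; have := mulr_ge0 L10 d0.
  have w1' : 0 <= 1 - w by rewrite subr_ge0.
  have := ler_wpM2l w0 h1; have := ler_wpM2l w1' h0.
  move: (L0 * (b - a)) (L1 * (b - a)) => A0 A1 ? ? ? ?.
  have : (1 - w) * A0 <= 1 * A0 by rewrite ler_wpM2r//; lra.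
  have : w * A1 <= 1 * A1 by rewrite ler_wpM2r.
  lra.
move=> w01; have [g [C [mg aeg C0 wg]]] := flux_weak w w01.
exists (Vmax 0 + C); first by rewrite addr_ge0// Vmax0// lexx ler01.
move=> a b a0 ab b1.
have b0 : 0 < b by exact: le_lt_trans ab.
have fb := speed_bounds b w (ltac:(by rewrite ltW)) w01.
have fa := speed_bounds a w (ltac:(by rewrite a0/= (le_trans (ltW ab)))) w01.
have t01 : 0 <= a / b <= 1 by rewrite divr_ge0 ?(ltW b0)// ler_pdivrMr// mul1r ltW.
have ma : (1 - a / b) * 0 + a / b * b = a by rewrite mulr0 add0r divfK// gt_eqF.
have z0 : flux Vmin Vmax 0 w = 0 by rewrite flux_speed mul0r.
have up := flux_strong_concave w 0 b (a / b) w01 (lexx _) (ltW b0) b1 t01.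
rewrite ma z0 mulr0 add0r subr0 in up.
have wgN (phi : R -> R) : test_unit_interval phi ->
    \int[mu]_(x in `]0, 1[) (- fl w x * derive1n 2 phi x) =
    \int[mu]_(x in `]0, 1[) (- g x * phi x).
  move=> tphi.
  transitivity (\int[mu]_(x in `]0, 1[) - (fl w x * derive1n 2 phi x)).
    by apply: eq_Rintegral => x _; rewrite mulNr.
  rewrite RintegralN wg// -RintegralN.
  by apply: eq_Rintegral => x _; rewrite mulNr.
have cN : continuous (fun x => - fl w x) by move=> x; apply: cvgN; exact: fl_continuous.
have mgN : measurable_fun (`]0, 1[%classic : set R) (fun x => - g x) by exact: measurableT_comp.
have aegN : {ae mu, forall x : R, 0 < x < 1 -> `|- g x| <= C /\ - g x <= C}.
  apply: ae_mono aeg => x gx x01; have [gC _] := gx x01; rewrite normrN; split => //.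
  by apply: le_trans gC; rewrite -normrN ler_norm.
have H := @weak_concave R (fun x => - fl w x) (fun x => - g x) C C _ _ _ cN mgN aegN wgN.
pose v x := - fl w x - C * (x ^+ 2 / 2).
have cv : continuous v.
  move=> x; apply: cvgB; first exact: cN.
  apply: cvgM; first exact: cvg_cst.
  by apply: cvgM; [exact: exprn_continuous|exact: cvg_cst].
have := concave_closure R v cv H 0 b (a / b) (lexx _) (ltW b0) b1 t01.
rewrite ma /v !flE ?lexx ?ler01 ?(ltW b0) ?a0 ?(le_trans (ltW ab) b1)// z0 oppr0 expr0n/=.
rewrite !mul0r !mulr0 subrr mulr0 add0r => lo.
set fA := flux Vmin Vmax a w in up lo *; set fB := flux Vmin Vmax b w in up lo *.
have eB : fB = b * speed b w by [].
have E1 : a / b * fB = a * speed b w by rewrite eB mulrA divfK// gt_eqF.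
rewrite E1 in up.
have E2 : a / b * (- fB - C * (b ^+ 2 / 2)) = - a * speed b w - C * (a * b / 2).
  by rewrite eB; field; rewrite gt_eqF.
rewrite E2 in lo.
have /andP[sb0 sb1] := fb.
have e2 : 0 <= eta / 2 * (a / b * (1 - a / b) * b ^+ 2).
  have /andP[h1 h2] := t01.
  rewrite mulr_ge0//; first by rewrite divr_ge0// ltW.
  by rewrite mulr_ge0 ?sqr_ge0// mulr_ge0// subr_ge0.
have d0 : 0 <= b - a by rewrite subr_ge0 ltW.
have Cd : 0 <= C * (b - a) by rewrite mulr_ge0.
have sd0 : 0 <= speed b w * (b - a) by rewrite mulr_ge0.
have sd : speed b w * (b - a) <= Vmax 0 * (b - a) by rewrite ler_wpM2r.
have Cad : a * (C * (b - a)) <= 1 * (C * (b - a)).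
  by rewrite ler_wpM2r// (le_trans (ltW ab)).
have Cad0 : 0 <= a * (C * (b - a)) by rewrite mulr_ge0.
have E3 : fA - b * speed b w = (fA - a * speed b w) - speed b w * (b - a) by ring.
rewrite ler_norml eB E3 mulrDl; apply/andP; split; first lra.
have E4 : C * (a * b / 2) - C * (a ^+ 2 / 2) = a * (C * (b - a)) / 2 by field.
lra.
Qed.

Hypothesis eps01 : 0 < eps < 1.
Hypothesis Veps : forall x : R, 0 <= x <= eps -> Vmin x = Vmax x.

Let eps0 : 0 < eps. Proof. by case/andP: eps01. Qed.
Let eps1 : eps < 1. Proof. by case/andP: eps01. Qed.

Lemma speed_decr (a b w : R) : 0 <= w <= 1 -> 0 <= a -> a <= b -> b <= 1 ->
  speed b w <= speed a w.
Proof.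
move=> /andP[w0 w1] a0 ab b1.
by apply: lerD; rewrite ler_wpM2l ?subr_ge0// ?decr_min ?decr_max.
Qed.

(** Strong concavity is applied on the chord from the origin, where the flux vanishes. Dividing by
    [a] turns the quadratic gain into a linear gap between the speeds, which later allows the
    density to be recovered from the velocity. *)
Lemma speed_strict (a b w : R) : 0 <= w <= 1 -> 0 < a -> a <= b -> b <= 1 ->
  eta / 2 * (b - a) <= speed a w - speed b w.
Proof.
move=> w01 a0 ab b1; have b0 : 0 < b by exact: lt_le_trans ab.
have t01 : 0 <= a / b <= 1.
  by apply/andP; split; [rewrite divr_ge0// ltW|rewrite ler_pdivrMr// mul1r].
have := flux_strong_concave w 0 b (a / b) w01 (lexx _) (ltW b0) b1 t01.
rewrite !flux_speed mul0r !mulr0 !add0r subr0 divfK ?gt_eqF// => up.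
have E : a / b * (b * speed b w) + eta / 2 * (a / b * (1 - a / b) * b ^+ 2) =
   a * (speed b w + eta / 2 * (b - a)) by field; rewrite gt_eqF.
by move: up; rewrite E (ler_pM2l a0); lra.
Qed.

Lemma speed_eps (r w : R) : 0 <= r <= eps -> speed r w = Vmax r.
Proof. by move=> r0; rewrite /speed Veps//; ring. Qed.

Definition lagr (w x : R) : R := speed x^-1 w.

Let inv_itv (x : R) : 1 <= x -> x <= eps^-1 -> eps <= x^-1 <= 1.
Proof.
move=> x1 xe; have x0 : 0 < x by exact: lt_le_trans x1.
apply/andP; split; last by rewrite invf_le1.
by rewrite -(invrK eps) lef_pV2 ?posrE ?invr_gt0.
Qed.

Lemma lagr_ndecr (w x y : R) : 0 <= w <= 1 -> 1 <= x -> x <= y -> y <= eps^-1 ->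
  lagr w x <= lagr w y.
Proof.
move=> w01 x1 xy ye.
have /andP[h1 h2] := inv_itv x x1 (le_trans xy ye).
have /andP[h3 h4] := inv_itv y (le_trans x1 xy) ye.
have x0 : 0 < x by exact: lt_le_trans x1.
apply: speed_decr => //; first exact: le_trans (ltW eps0) h3.
by rewrite lef_pV2 ?posrE// (lt_le_trans x0).
Qed.

(** Divided by [x], the increment of the speed splits into an increment of the flux and a speed
    times [x^-1 - y^-1]; the latter difference is at most [x^-1 * (y - x)]. *)
Lemma lagr_lip (L w x y : R) : 0 <= L ->
  (forall w a b : R, 0 <= w <= 1 -> 0 <= a <= 1 -> 0 <= b <= 1 ->
    `|flux Vmin Vmax a w - flux Vmin Vmax b w| <= L * `|a - b|) ->
  0 <= w <= 1 -> 1 <= x -> x <= y -> y <= eps^-1 ->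
  lagr w y - lagr w x <= (Vmax 0 + L) * (y - x).
Proof.
move=> L0 fL w01 x1 xy ye.
have /andP[h1 h2] := inv_itv x x1 (le_trans xy ye).
have /andP[h3 h4] := inv_itv y (le_trans x1 xy) ye.
have x0 : 0 < x by exact: lt_le_trans x1.
have y0 : 0 < y by exact: lt_le_trans xy.
have iy : 0 <= y^-1 <= 1 by rewrite h4 invr_ge0 ltW.
have ix : 0 <= x^-1 <= 1 by rewrite h2 invr_ge0 ltW.
have := fL w _ _ w01 iy ix; rewrite !flux_speed -/(lagr w x) -/(lagr w y).
have /andP[s0 s1] : 0 <= lagr w y <= Vmax 0 by exact: speed_bounds.
have xyi : y^-1 <= x^-1 by rewrite lef_pV2.
rewrite (distrC y^-1) (ger0_norm (_ : 0 <= x^-1 - y^-1)) ?subr_ge0// => H.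
have {}H : y^-1 * lagr w y - x^-1 * lagr w x <= L * (x^-1 - y^-1).
  by apply: le_trans H; exact: ler_norm.
have E : x^-1 * (lagr w y - lagr w x) =
  (y^-1 * lagr w y - x^-1 * lagr w x) + lagr w y * (x^-1 - y^-1) by ring.
have xi0 : 0 < x^-1 by rewrite invr_gt0.
rewrite -(ler_pM2l xi0) E.
have d0 : 0 <= x^-1 - y^-1 by rewrite subr_ge0.
have h5 : lagr w y * (x^-1 - y^-1) <= Vmax 0 * (x^-1 - y^-1) by rewrite ler_wpM2r.
have h6 : x^-1 - y^-1 <= x^-1 * (y - x).
  have -> : x^-1 - y^-1 = y^-1 * (x^-1 * (y - x)) by field; rewrite !gt_eqF.
  by rewrite ler_piMl// mulr_ge0 ?subr_ge0// ltW.
have h7 : (Vmax 0 + L) * (x^-1 - y^-1) <= (Vmax 0 + L) * (x^-1 * (y - x)).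
  by rewrite ler_wpM2l// addr_ge0// Vmax0// lexx ler01.
have -> : x^-1 * ((Vmax 0 + L) * (y - x)) = (Vmax 0 + L) * (x^-1 * (y - x)) by ring.
by apply: le_trans h7; rewrite [leRHS]mulrDl addrC; exact: lerD h5 H.
Qed.

(* [lagr w x = x * f (1 / x)] is the perspective of the concave flux. *)
Lemma lagr_conc (w x y z : R) : 0 <= w <= 1 -> 1 <= x -> x < y -> y < z -> z <= eps^-1 ->
  eta / 2 * eps ^+ 3 * (z - x) * ((z - y) * (y - x)) <=
  (lagr w y - lagr w x) * (z - y) - (lagr w z - lagr w y) * (y - x).
Proof.
move=> w01 x1 xy yz ze.
have x0 : 0 < x by exact: lt_le_trans x1.
have y0 : 0 < y by exact: lt_trans xy.
have z0 : 0 < z by exact: lt_trans yz.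
have zx : 0 < z - x by rewrite subr_gt0; exact: lt_trans yz.
(* The weight for which [y^-1 = (1 - t) * z^-1 + t * x^-1]. *)
pose t := (z - y) * x / ((z - x) * y).
have tE : 1 - t = (y - x) * z / ((z - x) * y) by rewrite /t; field; rewrite !gt_eqF.
have zy0 : 0 < z - y by rewrite subr_gt0.
have yx0 : 0 < y - x by rewrite subr_gt0.
have t0 : 0 <= t by rewrite ltW// divr_gt0// mulr_gt0.
have t1 : 0 <= 1 - t by rewrite tE ltW// divr_gt0// mulr_gt0.
have zi : 0 <= z^-1 by rewrite invr_ge0 ltW.
have zxi : z^-1 <= x^-1 by rewrite lef_pV2 ?posrE// ltW// (lt_trans xy).
have xi1 : x^-1 <= 1 by rewrite invf_le1.
have t01 : 0 <= t <= 1 by rewrite t0 -subr_ge0.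
have := flux_strong_concave w z^-1 x^-1 t w01 zi zxi xi1 t01.
have -> : (1 - t) * z^-1 + t * x^-1 = y^-1.
  by rewrite tE /t; field; rewrite !gt_eqF.
rewrite !flux_speed -/(lagr w x) -/(lagr w y) -/(lagr w z) tE.
have -> : (y - x) * z / ((z - x) * y) * (z^-1 * lagr w z) + t * (x^-1 * lagr w x) +
   eta / 2 * (t * ((y - x) * z / ((z - x) * y)) * (x^-1 - z^-1) ^+ 2) =
   ((y - x) * lagr w z + (z - y) * lagr w x +
     eta / 2 * ((z - y) * (y - x) * (z - x)) / (x * y * z)) / ((z - x) * y).
  by rewrite /t; field; rewrite !gt_eqF.
rewrite ler_pdivrMr ?mulr_gt0//.
have -> : y^-1 * lagr w y * ((z - x) * y) = (z - x) * lagr w y by field; rewrite gt_eqF.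
have q0 : 0 <= eta / 2 * ((z - y) * (y - x) * (z - x)).
  by rewrite ltW// mulr_gt0 ?divr_gt0// mulr_gt0// mulr_gt0.
(* The perspective introduces the factor 1 / (x y z); volumes at most [eps^-1] bound it below by the
   power of [eps] in the modulus. *)
have e3 : eps ^+ 3 <= (x * y * z)^-1.
  have -> : eps ^+ 3 = (eps^-1 * eps^-1 * eps^-1)^-1 by field; rewrite gt_eqF.
  have ye : y <= eps^-1 by rewrite (le_trans (ltW yz)).
  have xe : x <= eps^-1 by rewrite (le_trans (ltW xy)).
  rewrite lef_pV2 ?posrE ?mulr_gt0 ?invr_gt0//.
  by rewrite !ler_pM ?mulr_ge0 ?(ltW x0) ?(ltW y0) ?(ltW z0).
have := ler_wpM2l q0 e3.
have -> : eta / 2 * ((z - y) * (y - x) * (z - x)) * eps ^+ 3 =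
  eta / 2 * eps ^+ 3 * (z - x) * ((z - y) * (y - x)) by ring.
move: (_ * _^-1) => q h1 h2; lra.
Qed.

End flux_facts.

(** What the scheme and its limit use about the speed [V rho w]; the inequalities in [x^-1] are
    statements about specific volumes. [A] is the Lipschitz constant and [kap] the concavity modulus
    in the volume, [al] the rate of strict decrease in the density, [L] the Lipschitz constant of
    the flux, [Cv] a bound for the speed. By [sp_LC] the CFL condition built on [A] also covers the
    entropy inequality. In [sp_T] the speed at density [eps] is independent of w, as needed for the
    upper barrier of the volumes. *)
Record speed_spec {R : realType} {V : R -> R -> R} {eps cm A kap al L Cv : R} : Prop :=
  SpeedSpec {
  sp_eps : 0 < eps < 1;
  sp_A : 0 < A;
  sp_kap : 0 < kap;
  sp_al : 0 < al;
  sp_L : 0 <= L;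
  sp_Cv : 0 <= Cv;
  sp_LC : L + Cv <= A;
  sp_1 : forall w, V 1 w = 0;
  sp_T : forall w, V eps w = cm;
  sp_ndecr : forall w x y, 0 <= w <= 1 -> 1 <= x -> x <= y -> y <= eps^-1 ->
    V x^-1 w <= V y^-1 w;
  sp_lip : forall w x y, 0 <= w <= 1 -> 1 <= x -> x <= y -> y <= eps^-1 ->
    V y^-1 w - V x^-1 w <= A * (y - x);
  sp_conc : forall w x y z, 0 <= w <= 1 -> 1 <= x -> x < y -> y < z -> z <= eps^-1 ->
    kap * (z - x) * ((z - y) * (y - x)) <=
    (V y^-1 w - V x^-1 w) * (z - y) - (V z^-1 w - V y^-1 w) * (y - x);
  sp_strict : forall a b w, 0 <= w <= 1 -> 0 < a -> a <= b -> b <= 1 ->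
    al * (b - a) <= V a w - V b w;
  sp_decr : forall a b w, 0 <= w <= 1 -> 0 <= a -> a <= b -> b <= 1 -> V b w <= V a w;
  sp_flux : forall w a b, 0 <= w <= 1 -> 0 <= a <= 1 -> 0 <= b <= 1 ->
    `|a * V a w - b * V b w| <= L * `|a - b|;
  sp_bound : forall r w, 0 <= r <= 1 -> 0 <= w <= 1 -> 0 <= V r w <= Cv;
  sp_affine : forall r w w', 0 <= r <= 1 -> `|V r w - V r w'| <= Cv * `|w - w'|;
  sp_meas : forall r w : R * R -> R, measurable_fun setT r -> measurable_fun setT w ->
    (forall p, 0 <= r p <= 1) -> measurable_fun setT (fun p => V (r p) (w p)) }.

Arguments speed_spec : clear implicits.

Lemma speed_specP (R : realType) (Vmin Vmax : R -> R) (eps eta : R)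
  (hVmin : W2inf_nonneg Vmin) (hVmax : W2inf_nonneg Vmax)
  (ha_min : forall x y : R, 0 <= x -> x <= y -> y <= 1 -> Vmin y <= Vmin x)
  (ha_max : forall x y : R, 0 <= x -> x <= y -> y <= 1 -> Vmax y <= Vmax x)
  (ha_le : forall x : R, 0 <= x <= 1 -> Vmin x <= Vmax x)
  (ha_min1 : Vmin 1 = 0) (ha_max1 : Vmax 1 = 0) (eta0 : 0 < eta)
  (hb : forall w : R, 0 <= w <= 1 ->
      exists2 g, weak_derivative 2 (fun r => flux Vmin Vmax r w) g &
        {ae @lebesgue_measure R, forall r, 0 < r < 1 -> g r < - eta})
  (heps : 0 < eps < 1)
  (hc : forall x : R, 0 <= x <= eps -> Vmin x = Vmax x) :
  exists cm A kap al L Cv, speed_spec R (speed R Vmin Vmax) eps cm A kap al L Cv.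
Proof.
have [cmin m0 _ _] := hVmin; have [cmax M0 _ _] := hVmax.
have [L L0 fL] := flux_lipschitz R Vmin Vmax eta cmin cmax m0 M0 ha_max ha_le eta0 hb.
have Cv0 : 0 <= Vmax 0 by apply: M0; rewrite lexx ler01.
have /andP[e0 e1] := heps.
(* The summand 1 makes [A] positive, and the concavity modulus is that of [lagr_conc]. *)
exists (Vmax eps), (Vmax 0 + L + 1), (eta / 2 * eps ^+ 3), (eta / 2), L, (Vmax 0).
split=> //.
- by rewrite ltr_pwDr// addr_ge0.
- by rewrite mulr_gt0 ?divr_gt0// exprn_gt0.
- by rewrite divr_gt0.
- by rewrite (addrC L) lerDl.
- exact: speed1.
- by move=> w; rewrite (speed_eps R Vmin Vmax eps hc)// lexx ltW.
- exact: (lagr_ndecr R Vmin Vmax eps ha_min ha_max heps).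
- move=> w x y w01 x1 xy ye.
  have := lagr_lip R Vmin Vmax eps m0 M0 ha_max ha_le heps L w x y L0 fL w01 x1 xy ye.
  move=> /le_trans; apply; rewrite ler_wpM2r ?subr_ge0//; lra.
- exact: (lagr_conc R Vmin Vmax eta eps cmin cmax eta0 hb heps).
- by move=> a b w ? ? ? ?; apply: (speed_strict R Vmin Vmax eta).
- by move=> a b w ? ? ? ?; apply: (speed_decr R Vmin Vmax).
- by move=> r w ? ?; apply: (speed_bounds R Vmin Vmax).
- move=> r w w' r01; have h1 := m0 r r01; have h2 := ha_le r r01.
  have /andP[r0 r1] := r01; have h3 := ha_max 0 r (lexx _) r0 r1.
  have -> : speed R Vmin Vmax r w - speed R Vmin Vmax r w' =
    (Vmax r - Vmin r) * (w - w') by rewrite /speed; ring.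
  by rewrite normrM ler_wpM2r// ger0_norm; lra.
- move=> r w mr mw r01.
  have -> : (fun p => speed R Vmin Vmax (r p) (w p)) =
      (fun p => (1 - w p) * (Vmin \o clamp R) (r p) + w p * (Vmax \o clamp R) (r p)).
    by apply/funext => p; rewrite /= clampE//; exact: r01.
  have mc (v : R -> R) : {within `[0, 1], continuous v} ->
      measurable_fun setT (fun p => (v \o clamp R) (r p)).
    move=> cv.
    have mvc := continuous_measurable_fun (comp_clamp_continuous R v cv).
    exact: (measurableT_comp mvc mr).
  apply: measurable_funD; apply: measurable_funM => //; try exact: mc.
  exact: measurable_funB.
Qed.

Lemma floorD1 (R : realType) (h X : R) : 0 < h -> Num.floor ((X + h) / h) = Num.floor (X / h) + 1.
Proof.
move=> h0; rewrite mulrDl divff ?gt_eqF//; apply: Num.Theory.floor_def.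
have /andP[h1 h2] := floor_itv (X / h).
rewrite intrD lerD2r h1/= (_ : (_ + 1 + 1)%:~R = (Num.floor (X / h) + 1)%:~R + 1) ?ltrD2r//.
by rewrite [LHS]intrD.
Qed.

Lemma truncnD1 (R : realType) (h t : R) : 0 < h -> 0 <= t ->
  Num.truncn ((t + h) / h) = (Num.truncn (t / h)).+1.
Proof.
move=> h0 t0; rewrite mulrDl divff ?gt_eqF//; apply: Num.Theory.truncn_def.
have /andP[h1 h2] : (Num.truncn (t / h))%:R <= t / h < (Num.truncn (t / h)).+1%:R.
  by apply: truncn_itv; rewrite divr_ge0// ltW.
by rewrite -!natr1 lerD2r h1 ltrD2r natr1.
Qed.

(** * Convergence of the scheme *)

Lemma inv_bounds (R : realType) (eps r : R) : 0 < eps -> eps <= r <= 1 ->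
  0 <= r^-1 <= eps^-1.
Proof.
move=> eps0 /andP[r0 r1]; have rp : 0 < r := lt_le_trans eps0 r0.
by rewrite invr_ge0 (ltW rp) lef_pV2.
Qed.

Lemma measurable_inv_ge (d : measure_display) (T : measurableType d) (R : realType)
    (eps : R) (f : T -> R) : 0 < eps -> (forall p, eps <= f p) ->
  measurable_fun setT f -> measurable_fun setT (fun p => (f p)^-1).
Proof.
move=> eps0 f1 mf; have c1 : continuous (fun y : R => (Num.max eps y)^-1).
  move=> y; apply: cvgV; first by rewrite gt_eqF// lt_max eps0.
  have cmax : {for y, continuous ((cst eps : R -> R) \max (id : R -> R))}.
    by apply: continuous_max; [exact: cst_continuous|exact: cvg_id].
  exact: cmax.
have := measurableT_comp (continuous_measurable_fun c1) mf.
by congr measurable_fun; apply/funext => p /=; rewrite (max_idPr (f1 p)).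
Qed.

Lemma ae_mono2 (d : measure_display) (T : measurableType d) (R : realType)
    (m : {measure set T -> \bar R}) (P Q S : T -> Prop) :
  (forall x, P x -> Q x -> S x) ->
  {ae m, forall x, P x} -> {ae m, forall x, Q x} -> {ae m, forall x, S x}.
Proof. by move=> PQS; apply: (@filterS2 _ _ (ae_filter_ringOfSetsType m)). Qed.

(** * Convergence of velocities along a converging trajectory *)

Section one_sided_limit.
Context (R : realType).
Variables (p v : nat -> nat -> R) (D : nat -> R) (y : R -> R) (cm K : R).
Hypothesis D0 : forall j, 0 < D j.
Hypothesis cD : D @ \oo --> 0.
Hypothesis K0 : 0 <= K.
Hypothesis pS : forall j n, p j n.+1 = p j n + D j * v j n.
Hypothesis v0 : forall j n, 0 <= v j n <= cm.
Hypothesis osl : forall j n N, (n <= N)%N ->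
  v j N - v j n <= (N - n)%:R * (K / n.+1%:R).

Let cm0 : 0 <= cm. Proof. by have /andP[] := v0 0 0; exact: le_trans. Qed.

Let p_sum j n N : (n <= N)%N -> p j N - p j n = D j * \sum_(n <= l < N) v j l.
Proof.
move=> nN; rewrite -(telescope_sumr (p j) nN) big_distrr/=.
by apply: eq_bigr => l _; rewrite pS addrAC subrr add0r.
Qed.

(** The slope [q] is the mean of the velocities at the steps [n <= l < N]. By the one-sided bound
    the velocity at [N] exceeds each of them by at most [e], and none of them exceeds the velocity
    at [n] by more than [e]; averaging over [l] gives both inequalities. *)
Let slope_bounds j n N : (n < N)%N ->
  let q := (p j N - p j n) / (N%:R * D j - n%:R * D j) in
  let e := K * (N%:R * D j - n%:R * D j) / (n.+1%:R * D j) in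
  [/\ 0 <= q <= cm, v j N <= q + e & q - e <= v j n].
Proof.
move=> nN q e; have Dj := D0 j.
have m0 : 0 < (N - n)%:R :> R by rewrite ltr0n subn_gt0.
have eE : e = (N - n)%:R * (K / n.+1%:R).
  rewrite /e natrB ?(ltnW nN)//; have : n.+1%:R != 0 :> R by rewrite pnatr_eq0.
  by move: n.+1%:R => a a0; field; rewrite a0 gt_eqF.
have qE : q = (\sum_(n <= l < N) v j l) / (N - n)%:R.
  rewrite /q p_sum ?(ltnW nN)// -mulrBl -natrB ?(ltnW nN)//.
  by field; rewrite !gt_eqF.
have cst (c : R) : \sum_(n <= l < N) c = c * (N - n)%:R.
  by rewrite sumr_const_nat mulr_natr.
rewrite eE qE; set e' := _ * (K / _); split.
- apply/andP; split.
    by rewrite divr_ge0 ?(ltW m0)// sumr_ge0// => l _; have /andP[] := v0 j l.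
  rewrite ler_pdivrMr// -cst; apply: ler_sum => l _; by have /andP[] := v0 j l.
- rewrite -lerBlDr ler_pdivlMr// -cst big_nat_cond [leRHS]big_nat_cond.
  apply: ler_sum => l; rewrite andbT => /andP[nl lN].
  rewrite lerBlDr -lerBlDl; apply: (le_trans (osl j _ _ (ltnW lN))).
  rewrite /e'; apply: ler_pM => //; first by rewrite divr_ge0.
    by rewrite ler_nat leq_sub2l.
  by rewrite ler_wpM2l// lef_pV2 ?posrE// ler_nat.
- rewrite lerBlDr ler_pdivrMr// -cst big_nat_cond [leRHS]big_nat_cond.
  apply: ler_sum => l; rewrite andbT => /andP[nl lN].
  rewrite -lerBlDl; apply: (le_trans (osl j _ _ nl)).
  rewrite /e'; apply: ler_pM => //; first by rewrite divr_ge0.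
  by rewrite ler_nat leq_sub2r// ltnW.
Qed.

Hypothesis cy : forall (t : R) (n : nat -> nat), 0 <= t ->
  (n j)%:R * D j @[j --> \oo] --> t -> p j (n j) @[j --> \oo] --> y t.

Let q (t s : R) : R := (y s - y t) / (s - t).
Let e (t s : R) : R := K * (s - t) / t.

Let q_bounds (t s : R) (n N : nat -> nat) : 0 < t -> t < s ->
  (n j)%:R * D j @[j --> \oo] --> t -> (N j)%:R * D j @[j --> \oo] --> s ->
  [/\ 0 <= q t s <= cm,
    forall d : R, 0 < d -> \forall j \near \oo, v j (N j) <= q t s + e t s + d &
    forall d : R, 0 < d -> \forall j \near \oo, q t s - e t s - d <= v j (n j)].
Proof.
move=> t0 ts cn cN.
have s0 : 0 < s := lt_trans t0 ts.
have st0 : s - t != 0 by rewrite gt_eqF// subr_gt0.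
have cnS : (n j).+1%:R * D j @[j --> \oo] --> t.
  have -> : (fun j => (n j).+1%:R * D j) = (fun j => (n j)%:R * D j + D j).
    by apply/funext => j; rewrite -natr1 mulrDl mul1r.
  by rewrite -[X in _ --> X]addr0; apply: cvgD.
have cq : (p j (N j) - p j (n j)) / ((N j)%:R * D j - (n j)%:R * D j) @[j --> \oo] --> q t s.
  by apply: cvgM; [apply: cvgB; apply: cy => //; exact: ltW|apply: cvgV => //; exact: cvgB].
have ce : K * ((N j)%:R * D j - (n j)%:R * D j) / ((n j).+1%:R * D j) @[j --> \oo] --> e t s.
  apply: cvgM; last by apply: cvgV => //; rewrite gt_eqF.
  by apply: cvgM; [exact: cvg_cst|exact: cvgB].
have nN : \forall j \near \oo, (n j < N j)%N.
  have : 0 < s - t by rewrite subr_gt0.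
  move/(cvgr_gt _ (cvgB cN cn)); apply: filterS => j.
  by rewrite subr_gt0 ltr_pM2r// ltr_nat.
split.
- apply/andP; split.
    have c0 : (fun _ : nat => 0 : R) @ \oo --> (0 : R) by exact: cvg_cst.
    apply: (ler_cvg_to c0 cq); apply: filterS nN => j nNj.
    by case: (slope_bounds j (n j) (N j) nNj) => /andP[].
  have c1 : (fun _ : nat => cm) @ \oo --> cm by exact: cvg_cst.
  apply: (ler_cvg_to cq c1); apply: filterS nN => j nNj.
  by case: (slope_bounds j (n j) (N j) nNj) => /andP[].
- move=> d d0; have : q t s + e t s < q t s + e t s + d by rewrite ltrDl.
  move/(cvgr_lt _ (cvgD cq ce)) => hq; apply: filterS2 nN hq => j nNj lt.
  case: (slope_bounds j (n j) (N j) nNj) => _ h _.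
  exact: le_trans h (ltW lt).
- move=> d d0; have : q t s - e t s - d < q t s - e t s by rewrite gtrBl.
  move/(cvgr_gt _ (cvgB cq ce)) => hq; apply: filterS2 nN hq => j nNj lt.
  case: (slope_bounds j (n j) (N j) nNj) => _ _ h.
  exact: le_trans (ltW lt) h.
Qed.

Let cvg_truncn (t : R) : 0 <= t -> (Num.truncn (t / D j))%:R * D j @[j --> \oo] --> t.
Proof.
move=> t0; have -> : (fun j => (Num.truncn (t / D j))%:R * D j) =
    (fun j => (Num.floor (t / D j))%:~R * D j); last exact: floor_cvg.
apply/funext => j; rewrite Num.Theory.truncn_floor divr_ge0 ?(ltW (D0 j))//.
by rewrite -[in RHS](@gez0_abs (Num.floor (t / D j))) ?Num.Theory.floor_ge0 ?divr_ge0 ?(ltW (D0 j)).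
Qed.

(** Slopes of the limit trajectory to the left of t, increased by [e], bound the velocities near t
    asymptotically from above; slopes to the right, decreased by [e], bound them from below. The
    best lower bound [sup (SL t)] stays below the best upper bound [inf (SU t)] only for countably
    many t, by [countable_gap] with constant [2 * K]. The index sequence is arbitrary, so the
    current and the next time step share the same limit. *)
Lemma one_sided_limit : exists2 B : set R, countable B &
  forall t : R, 0 < t -> ~ B t -> exists u : R, forall n : nat -> nat,
    (n j)%:R * D j @[j --> \oo] --> t -> v j (n j) @[j --> \oo] --> u.
Proof.
pose SU (s : R) := [set u | exists2 t, 0 < t < s & u = q t s + e t s].
pose SL (t : R) := [set l | exists2 s, t < s & l = q t s - e t s].
have qb (t s : R) : 0 < t -> t < s -> 0 <= q t s <= cm.
  move=> t0 ts; have s0 := lt_trans t0 ts.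
  by have [] := q_bounds t s _ _ t0 ts (cvg_truncn t (ltW t0)) (cvg_truncn s (ltW s0)).
have e0 (t s : R) : 0 < t -> t < s -> 0 <= e t s.
  by move=> t0 ts; rewrite divr_ge0 ?mulr_ge0 ?subr_ge0// ltW.
have lU s : has_lbound (SU s).
  exists 0 => _ [t /andP[t0 ts] ->]; have /andP[h _] := qb t s t0 ts.
  by rewrite addr_ge0// e0.
have uL t : 0 < t -> has_ubound (SL t).
  move=> t0; exists cm => _ [s ts ->]; have /andP[_ h] := qb t s t0 ts.
  by rewrite lerBlDr ler_wpDr// e0.
exists [set t | 0 < t /\ sup (SL t) < inf (SU t)].
  apply: (countable_gap R _ _ (2 * K)); first by rewrite mulr_ge0.
  move=> t s t0 ts.
  have h1 : inf (SU s) <= q t s + e t s by apply: ge_inf => //; exists t; rewrite ?t0.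
  have h2 : q t s - e t s <= sup (SL t) by apply: ub_le_sup; [exact: uL|exists s].
  have -> : 2 * K * (s - t) / t = 2 * e t s by rewrite /e; ring.
  lra.
move=> t t0 /= nB; exists (inf (SU t)) => n cn.
have UL : inf (SU t) <= sup (SL t) by rewrite leNgt; apply/negP => h; apply: nB.
apply/cvgrPdist_le => d d0.
have d2 : 0 < d / 2 by rewrite divr_gt0.
have U0 : SU t !=set0.
  by exists (q (t / 2) t + e (t / 2) t), (t / 2) => //; apply/andP; split; lra.
have [_ [r /andP[r0 rt] ->] hr] := inf_adherent d2 (conj U0 (lU t)).
have L0 : SL t !=set0 by exists (q t (t + 1) - e t (t + 1)), (t + 1) => //; rewrite ltrDl.
have [_ [s ts ->] hs] := sup_adherent d2 (conj L0 (uL t t0)).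
have [_ hU _] := q_bounds r t _ _ r0 rt (cvg_truncn r (ltW r0)) cn.
have [_ _ hL] := q_bounds t s _ _ t0 ts cn (cvg_truncn s (ltW (lt_trans t0 ts))).
apply: filterS2 (hU _ d2) (hL _ d2) => j h1 h2.
by rewrite ler_distlC; apply/andP; split; lra.
Qed.

End one_sided_limit.

(** Once [w j] is replaced by its limit, at a cost [Cv * |wl - w j|], strict decrease of the speed
    makes the densities Cauchy. Continuity in the density is available for the flux [r * V r w],
    hence the multiplication by the positive limit to identify the speed. *)
Lemma speed_inverse_cvg (R : realType) (V : R -> R -> R) (eps cm A kap al L Cv : R)
    (r w : nat -> R) (u wl : R) :
  speed_spec R V eps cm A kap al L Cv ->
  (forall j, eps <= r j <= 1) -> (forall j, 0 <= w j <= 1) -> 0 <= wl <= 1 ->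
  w @ \oo --> wl -> V (r j) (w j) @[j --> \oo] --> u ->
  exists rl : R, [/\ eps <= rl <= 1, r @ \oo --> rl & V rl wl = u].
Proof.
move=> sp r1 w1 wl1 cw cV.
have eps0 : 0 < eps by case/andP: (sp_eps sp).
have al0 := sp_al sp; have Cv0 := sp_Cv sp.
have r01 j : 0 <= r j <= 1 by have /andP[h1 ->] := r1 j; rewrite (le_trans (ltW eps0)).
have cV' : V (r j) wl @[j --> \oo] --> u.
  have c0 : V (r j) wl - V (r j) (w j) @[j --> \oo] --> 0.
    apply/norm_cvg0P; apply: (@squeeze_cvgr _ _ _ _ (cst 0) (fun j => Cv * `|wl - w j|)).
    - by apply: nearW => j; rewrite normr_ge0 (sp_affine sp).
    - exact: cvg_cst.
    - rewrite -(mulr0 Cv); apply: cvgM; first exact: cvg_cst.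
      rewrite -(@normr0 _ R) -(subrr wl).
      by apply: cvg_norm; apply: cvgB => //; exact: cvg_cst.
  rewrite -[u]add0r (_ : (fun j => V (r j) wl) =
    (fun j => (V (r j) wl - V (r j) (w j)) + V (r j) (w j))); last first.
    by apply/funext => j; rewrite subrK.
  exact: cvgD.
have strict i j : al * `|r i - r j| <= `|V (r i) wl - V (r j) wl|.
  wlog ij : i j / r i <= r j.
    move=> H; have [|/ltW] := leP (r i) (r j); first exact: H.
    by rewrite (distrC (r i)) (distrC (V (r i) wl)); exact: H.
  have /andP[h1 _] := r1 i; have /andP[_ h2] := r1 j.
  have := sp_strict sp _ _ _ wl1 (lt_le_trans eps0 h1) ij h2.
  rewrite distrC (ger0_norm (_ : 0 <= r j - r i)) ?subr_ge0// => h.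
  exact: le_trans h (ler_norm _).
have cr : cvgn r.
  apply/cauchy_cvgP/cauchy_exP => e e0 /=.
  have ae0 : 0 < al * e / 2 by rewrite divr_gt0// mulr_gt0.
  have /cvgrPdist_lt/(_ _ ae0) [N _ hN] := cV'.
  exists (r N); exists N => // j /= Nj; rewrite /ball/=.
  rewrite -(ltr_pM2l al0); apply: (le_lt_trans (strict _ _)).
  have := ler_distD u (V (r N) wl) (V (r j) wl).
  have := hN N (leqnn N); have := hN j Nj => /=; rewrite (distrC u (V (r N) wl)); lra.
have {cr} : r @ \oo --> lim (r @ \oo) by [].
move: (lim _) => rl cr.
have rl1 : eps <= rl <= 1.
  have ce : (fun _ : nat => eps) @ \oo --> eps by exact: cvg_cst.
  have c1 : (fun _ : nat => 1 : R) @ \oo --> (1 : R) by exact: cvg_cst.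
  apply/andP; split.
    by apply: (ler_cvg_to ce cr); apply: nearW => j; have /andP[] := r1 j.
  by apply: (ler_cvg_to cr c1); apply: nearW => j; have /andP[] := r1 j.
have rl0 : 0 < rl by have /andP[h _] := rl1; exact: lt_le_trans eps0 h.
exists rl; split => //; apply/eqP; rewrite -(inj_eq (mulfI (lt0r_neq0 rl0))); apply/eqP.
have c1 : r j * V (r j) wl @[j --> \oo] --> rl * u by exact: cvgM.
apply: (cvg_unique _ _ c1) => //.
apply/cvgrPdist_le => e e0.
have L0 := sp_L sp.
have L10 : 0 < L + 1 by rewrite ltr_pwDr.
have eL : 0 < e / (L + 1) by rewrite divr_gt0.
have /cvgrPdist_le/(_ _ eL) := cr; apply: filterS => j hj.
have rlb : 0 <= rl <= 1 by rewrite (ltW rl0); have /andP[] := rl1.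
apply: (le_trans (sp_flux sp _ _ _ wl1 rlb (r01 j))).
rewrite ler_pdivlMr// mulrC in hj; apply: le_trans hj.
by rewrite ler_wpM2r// lerDl.
Qed.

(* The data produced by the particle scheme with mass step [h j] and time step
   [lam * h j], as step functions of time and mass, together with their limits
   [x] (trajectories) and [rl] (density along the trajectories). *)
Record lagrangian_limit {R : realType} {V : R -> R -> R} {eps cm : R} {W xo : R -> R}
    {lam : R} {h : nat -> R} {Wj : nat -> R -> R} {xj rj vj : nat -> R * R -> R}
    {x rl : R * R -> R} : Prop := LagrangianLimit {
  ll_h : forall j, 0 < h j;
  ll_h1 : forall j, h j <= 1;
  ll_lam : 0 < lam;
  ll_cm : 0 <= cm;
  ll_ch : h @ \oo --> 0;
  ll_W : forall j X, Wj j X = W ((Num.floor (X / h j))%:~R * h j);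
  ll_step : forall j t s X Y, Num.truncn (t / (lam * h j)) = Num.truncn (s / (lam * h j)) ->
    Num.floor (X / h j) = Num.floor (Y / h j) ->
    xj j (t, X) = xj j (s, Y) /\ rj j (t, X) = rj j (s, Y);
  ll_xj0 : forall j t X, t < lam * h j -> xj j (t, X) = xo ((Num.floor (X / h j))%:~R * h j);
  ll_time : forall j t X, 0 <= t ->
    xj j (t + lam * h j, X) = xj j (t, X) + lam * h j * vj j (t, X);
  ll_space : forall j t X, xj j (t, X + h j) = xj j (t, X) + h j * (rj j (t, X))^-1;
  ll_mono : forall j t X Y, X <= Y -> xj j (t, X) <= xj j (t, Y);
  ll_coercive : forall j t X, 0 <= t ->
    `|X| <= `|xj j (t, X)| + (`|xo 0| + (cm * (t + lam) + 1));
  ll_r : forall j p, eps <= rj j p <= 1;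
  ll_v : forall j p, 0 <= vj j p <= cm;
  ll_mx : forall j, measurable_fun setT (xj j);
  ll_mr : forall j, measurable_fun setT (rj j);
  ll_mv : forall j, measurable_fun setT (vj j);
  ll_rl : forall p, eps <= rl p <= 1;
  ll_mrl : measurable_fun setT rl;
  ll_cx : forall p, xj j p @[j --> \oo] --> x p;
  ll_cr : {ae (@lebesgue_measure R \x @lebesgue_measure R)%E, forall p, 0 <= p.1 ->
    rj j p @[j --> \oo] --> rl p};
  ll_crS : {ae (@lebesgue_measure R \x @lebesgue_measure R)%E, forall p, 0 <= p.1 ->
    rj j (p.1 + lam * h j, p.2) @[j --> \oo] --> rl p};
  ll_cv : {ae (@lebesgue_measure R \x @lebesgue_measure R)%E, forall p, 0 <= p.1 ->
    vj j p @[j --> \oo] --> V (rl p) (W p.2)};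
  ll_cvS : {ae (@lebesgue_measure R \x @lebesgue_measure R)%E, forall p, 0 <= p.1 ->
    vj j (p.1, p.2 + h j) @[j --> \oo] --> V (rl p) (W p.2)};
  ll_space_lim : forall t X Y, X <= Y -> Y - X <= x (t, Y) - x (t, X) <= (Y - X) / eps;
  ll_time_lim : forall t s X, t <= s -> 0 <= x (s, X) - x (t, X) <= cm * (s - t);
  ll_init : forall t X, t <= 0 -> x (t, X) = xo X;
  ll_entropy : forall j k t X, 0 <= k <= 1 -> 0 <= t ->
    `|1 - k / rj j (t + lam * h j, X)| <= `|1 - k / rj j (t, X)|
      + lam * k * (`|vj j (t, X + h j) - V k (Wj j (X + h j))|
                   - `|vj j (t, X) - V k (Wj j X)|)
      + lam * k * `|V k (Wj j (X + h j)) - V k (Wj j X)| }.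

Arguments lagrangian_limit : clear implicits.

Section approximation.
Context (R : realType).
Variables (V : R -> R -> R) (eps cm A kap al L Cv : R).
Hypothesis sp : speed_spec R V eps cm A kap al L Cv.
Variables (W xo : R -> R) (h : nat -> R).
Hypothesis W01 : forall X, 0 <= W X <= 1.
Hypothesis xoP : forall X Y : R, X <= Y -> Y - X <= xo Y - xo X <= (Y - X) / eps.
Hypothesis h0 : forall j, 0 < h j.

Let eps0 : 0 < eps. Proof. by case/andP: (sp_eps sp). Qed.
Let eps1 : eps < 1. Proof. by case/andP: (sp_eps sp). Qed.
Let A0 : 0 < A. Proof. exact: (sp_A sp). Qed.

Definition lam : R := (2 * A)^-1.

Lemma lam0 : 0 < lam. Proof. by rewrite invr_gt0 mulr_gt0. Qed.

Lemma CFL : A * lam <= 2^-1.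
Proof. by rewrite /lam invfM mulrCA divff ?gt_eqF// mulr1. Qed.

Definition Dt j : R := lam * h j.

Lemma Dt0 j : 0 < Dt j. Proof. by rewrite mulr_gt0// lam0. Qed.

Definition node j (i : int) : R := i%:~R * h j.
Definition Hj j (i : int) (x : R) : R := V x^-1 (W (node j i)).
Definition posj j := pos R (Hj j) lam (h j) (fun i => xo (node j i)).
Definition tauj j := tau R (Hj j) lam (h j) (fun i => xo (node j i)).
Definition velj j := vel R (Hj j) lam (h j) (fun i => xo (node j i)).
Definition tn j (t : R) : nat := Num.truncn (t / Dt j).
Definition ix j (X : R) : int := Num.floor (X / h j).
Definition xx j (p : R * R) : R := posj j (tn j p.1) (ix j p.2).
(** The two lower bounds that [vel_osl] imposes on its constant, with 1 added for strict
    positivity. *)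
Definition osl_const : R := Num.max (16 * cm) (A ^+ 2 / kap) + 1.

Let kap0 : 0 < kap. Proof. exact: (sp_kap sp). Qed.
Let Tm1 : 1 <= eps^-1. Proof. by rewrite invf_ge1// ltW. Qed.
Let H1 j i : Hj j i 1 = 0.
Proof. by rewrite /Hj invr1; exact: (sp_1 sp). Qed.
Let HT j i : Hj j i eps^-1 = cm.
Proof. by rewrite /Hj invrK; exact: (sp_T sp). Qed.
Let H_ndecr j i x y : 1 <= x -> x <= y -> y <= eps^-1 -> Hj j i x <= Hj j i y.
Proof. exact: (sp_ndecr sp). Qed.
Let H_lip j i x y : 1 <= x -> x <= y -> y <= eps^-1 ->
  Hj j i y - Hj j i x <= A * (y - x).
Proof. exact: (sp_lip sp). Qed.
Let H_conc j i x y z : 1 <= x -> x < y -> y < z -> z <= eps^-1 ->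
  kap * (z - x) * ((z - y) * (y - x)) <=
  (Hj j i y - Hj j i x) * (z - y) - (Hj j i z - Hj j i y) * (y - x).
Proof. exact: (sp_conc sp). Qed.

Lemma nodeS j i : node j (i + 1) = node j i + h j.
Proof. by rewrite /node intrD mulrDl mul1r. Qed.

Let x0P j i : h j <= xo (node j (i + 1)) - xo (node j i) <= eps^-1 * h j.
Proof.
have le : node j i <= node j (i + 1) by rewrite nodeS lerDl ltW.
by have := xoP _ _ le; rewrite nodeS addrAC subrr add0r mulrC.
Qed.

Ltac scheme_hyp := first [exact: lam0|exact: CFL|exact: h0|exact: H1|exact: HT|
  exact: H_ndecr|exact: H_lip|exact: H_conc|exact: x0P|assumption].

Lemma taujP j n i : 1 <= tauj j n i <= eps^-1.
Proof. by apply: (tauP R (Hj j) eps^-1 cm A lam (h j)); scheme_hyp. Qed.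

Lemma velj_bounds j n i : 0 <= velj j n i <= cm.
Proof. by apply: (vel_bounds R (Hj j) eps^-1 cm A lam (h j)); scheme_hyp. Qed.

Lemma cm0 : 0 <= cm.
Proof. by have /andP[] := velj_bounds 0 0 0; exact: le_trans. Qed.

Lemma velj_osl j n N i : (n <= N)%N ->
  velj j N i - velj j n i <= (N - n)%:R * (osl_const / n.+1%:R).
Proof.
have K1 : 0 <= A ^+ 2 / kap by rewrite divr_ge0 ?sqr_ge0 ?ltW.
apply: (vel_osl R (Hj j) eps^-1 cm A kap lam (h j)); try scheme_hyp.
- by rewrite /osl_const ltr_wpDl// le_max K1 orbT.
- by rewrite /osl_const ler_wpDr// ?ler01// le_max lexx.
- by rewrite mulrC -ler_pdivrMr// /osl_const ler_wpDr// le_max lexx orbT.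
Qed.

Lemma posj_lip_t j n N i : (n <= N)%N ->
  0 <= posj j N i - posj j n i <= Dt j * cm * (N - n)%:R.
Proof. by apply: (pos_lip_t R (Hj j) eps^-1 cm A lam (h j)); scheme_hyp. Qed.

Lemma posj_mono_x j n i i' (p : nat) : i' = i + p%:Z ->
  h j * p%:R <= posj j n i' - posj j n i <= eps^-1 * h j * p%:R.
Proof. by apply: (pos_mono_x R (Hj j) eps^-1 cm A lam (h j)); scheme_hyp. Qed.

Lemma nodeP j X : X - h j < node j (ix j X) <= X.
Proof. exact: floor_approx. Qed.

Lemma tnP j t : 0 <= t -> t - Dt j < (tn j t)%:R * Dt j <= t.
Proof.
move=> t0; have D0 := Dt0 j.
have /andP[h1 h2] : (tn j t)%:R <= t / Dt j < (tn j t).+1%:R.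
  by apply: truncn_itv; rewrite divr_ge0// ltW.
rewrite -ler_pdivlMr// h1 andbT ltrBlDr.
by move: h2; rewrite ltr_pdivrMr// -natr1 mulrDl mul1r.
Qed.

Lemma tn_le0 j t : t <= 0 -> tn j t = 0%N.
Proof.
move=> t0; rewrite /tn Num.Theory.truncn_floor; case: ifP => // t1.
have -> : t / Dt j = 0.
  by apply: le_anti; rewrite t1 andbT pmulr_lle0// invr_gt0 Dt0.
by rewrite Num.Theory.floor0.
Qed.

Lemma xx_time j t s X : t <= s ->
  0 <= xx j (s, X) - xx j (t, X) <= cm * (s - t) + cm * Dt j.
Proof.
move=> ts; have D0 := Dt0 j.
have le : (tn j t <= tn j s)%N.
  by apply: Num.Theory.le_truncn; rewrite ler_pM2r// invr_gt0.
have /andP[h1 h2] := posj_lip_t j _ _ (ix j X) le.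
rewrite h1/=; apply: (le_trans h2); rewrite mulrAC mulrC -mulrDr ler_wpM2l ?cm0//.
have [s0|s0] := leP 0 s; last first.
  have -> : tn j s = 0%N by apply: tn_le0; exact: ltW.
  have -> : tn j t = 0%N by apply: tn_le0; exact: le_trans ts (ltW s0).
  by rewrite subnn mulr0 addr_ge0 ?subr_ge0// ltW.
have /andP[_ h4] := tnP j s s0.
rewrite natrB// mulrBr mulrC.
have [t0|t0] := leP 0 t.
  have /andP[h5 _] := tnP j t t0; rewrite (mulrC (Dt j)); lra.
rewrite [tn j t]tn_le0 ?(ltW t0)// mulr0; lra.
Qed.

Lemma xx_space j t X Y : X <= Y ->
  Y - X - h j <= xx j (t, Y) - xx j (t, X) <= eps^-1 * (Y - X + h j).
Proof.
move=> XY.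
have le : ix j X <= ix j Y.
  by apply: Num.Theory.le_floor; rewrite ler_pM2r// invr_gt0.
have /andP[h1 h2] := nodeP j X; have /andP[h3 h4] := nodeP j Y.
have e : ix j Y = ix j X + `|ix j Y - ix j X|%N%:Z by rewrite gez0_abs ?subr_ge0//; ring.
have /andP[h5 h6] := posj_mono_x j (tn j t) _ _ _ e.
have hp : h j * `|ix j Y - ix j X|%N%:R = node j (ix j Y) - node j (ix j X).
  rewrite /node -mulrBl -intrB mulrC; congr (_ * _).
  by rewrite -[in RHS](gez0_abs (m := ix j Y - ix j X)) ?subr_ge0.
rewrite /xx/=; apply/andP; split.
  by apply: le_trans h5; rewrite hp; lra.
apply: (le_trans h6); rewrite -mulrA hp ler_wpM2l ?invr_ge0 ?(ltW eps0)//; lra.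
Qed.

(** The trajectories are Lipschitz at the nodes of the grid; reading them as step functions adds at
    most one time step and one mass step, an error that vanishes with [h j]. *)
Lemma xx_lip j p q : `|xx j p - xx j q| <=
  (cm + eps^-1) * (`|p.1 - q.1| + `|p.2 - q.2|) + (cm * Dt j + eps^-1 * h j).
Proof.
case: p q => [t X] [s Y] /=.
have e0 : 0 <= eps^-1 by rewrite invr_ge0 ltW.
have T t' s' : `|xx j (t', X) - xx j (s', X)| <= cm * `|t' - s'| + cm * Dt j.
  wlog ts : t' s' / t' <= s'.
    move=> H; have [|/ltW] := leP t' s'; first exact: H.
    by rewrite distrC (distrC t'); exact: H.
  have /andP[h1 h2] := xx_time j _ _ X ts.
  by rewrite distrC ger0_norm// (distrC t') ger0_norm ?subr_ge0.
have S X' Y' : `|xx j (s, X') - xx j (s, Y')| <= eps^-1 * `|X' - Y'| + eps^-1 * h j.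
  wlog XY : X' Y' / X' <= Y'.
    move=> H; have [|/ltW] := leP X' Y'; first exact: H.
    by rewrite distrC (distrC X'); exact: H.
  have /andP[h1 h2] := xx_space j s _ _ XY.
  rewrite distrC (distrC X') [`|Y' - X'|]ger0_norm ?subr_ge0// -mulrDr ler_norml.
  rewrite h2 andbT; apply: le_trans h1.
  have : 1 * (Y' - X' + h j) <= eps^-1 * (Y' - X' + h j).
    by rewrite ler_wpM2r// addr_ge0 ?subr_ge0// ltW.
  have := h0 j; lra.
have := ler_distD (xx j (s, X)) (xx j (t, X)) (xx j (s, Y)).
have := T t s; have := S X Y.
have := mulr_ge0 cm0 (normr_ge0 (X - Y)); have := mulr_ge0 e0 (normr_ge0 (t - s)).
rewrite !mulrDl !mulrDr; lra.
Qed.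

Hypothesis ch : h @ \oo --> 0.

Lemma cvg_Dt : Dt @ \oo --> 0.
Proof. by rewrite -(mulr0 lam); apply: cvgM => //; exact: cvg_cst. Qed.

Lemma xx_extraction : (forall j, h j <= 1) ->
  exists phi : nat -> nat, exists G : R * R -> R,
    (forall j, (j <= phi j)%N) /\ forall p, xx (phi j) p @[j --> \oo] --> G p.
Proof.
move=> h1.
have L0' : 0 <= cm + eps^-1 by rewrite addr_ge0 ?cm0// invr_ge0 ltW.
apply: (equicontinuous_extraction R xx
  (fun p => `|xo 0| + ((cm + eps^-1) * (`|p.1| + `|p.2|) + (cm * lam + eps^-1)))
  (cm + eps^-1) (fun j => cm * Dt j + eps^-1 * h j)) => //.
- rewrite -(addr0 0) -[X in X + _](mulr0 cm) -[X in _ + X](mulr0 eps^-1).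
  by apply: cvgD; apply: cvgM => //; first [exact: cvg_cst|exact: cvg_Dt].
- move=> j p; have := xx_lip j p (0, 0); rewrite !subr0.
  have -> : xx j (0, 0) = xo 0.
    by rewrite /xx/= tn_le0// /ix mul0r Num.Theory.floor0 /posj/= /node mul0r.
  have := ler_normD (xx j p - xo 0) (xo 0); rewrite subrK.
  have c1 : cm * Dt j <= cm * lam.
    by rewrite ler_wpM2l ?cm0// /Dt -[leRHS]mulr1 ler_wpM2l// ltW// lam0.
  have c2 : eps^-1 * h j <= eps^-1 by rewrite -[leRHS]mulr1 ler_wpM2l// invr_ge0 ltW.
  lra.
- by move=> j p q; exact: xx_lip.
Qed.

Variable x : R * R -> R.
Hypothesis cx : forall p, xx j p @[j --> \oo] --> x p.

Lemma x_space t (X Y : R) : X <= Y -> Y - X <= x (t, Y) - x (t, X) <= (Y - X) / eps.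
Proof.
move=> XY; have cB : xx j (t, Y) - xx j (t, X) @[j --> \oo] --> x (t, Y) - x (t, X).
  exact: cvgB (cx _) (cx _).
apply/andP; split.
  have c1 : Y - X - h j @[j --> \oo] --> Y - X.
    by rewrite -[X in _ --> X]subr0; apply: cvgB => //; exact: cvg_cst.
  by apply: (ler_cvg_to c1 cB); apply: nearW => j; have /andP[] := xx_space j t _ _ XY.
have c1 : eps^-1 * (Y - X + h j) @[j --> \oo] --> (Y - X) / eps.
  rewrite (_ : (Y - X) / eps = eps^-1 * (Y - X + 0)); last by rewrite addr0 mulrC.
  by apply: cvgM; [exact: cvg_cst|apply: cvgD => //; exact: cvg_cst].
by apply: (ler_cvg_to cB c1); apply: nearW => j; have /andP[] := xx_space j t _ _ XY.
Qed.

Lemma x_time (t s X : R) : t <= s -> 0 <= x (s, X) - x (t, X) <= cm * (s - t).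
Proof.
move=> ts; have cB : xx j (s, X) - xx j (t, X) @[j --> \oo] --> x (s, X) - x (t, X).
  exact: cvgB (cx _) (cx _).
apply/andP; split.
  by apply: (ler_cvg_to (cvg_cst _) cB); apply: nearW => j; have /andP[] := xx_time j _ _ X ts.
have c1 : cm * (s - t) + cm * Dt j @[j --> \oo] --> cm * (s - t).
  rewrite [X in _ --> X](_ : _ = cm * (s - t) + cm * 0); last by rewrite mulr0 addr0.
  by apply: cvgD; [exact: cvg_cst|apply: cvgM; [exact: cvg_cst|exact: cvg_Dt]].
by apply: (ler_cvg_to cB c1); apply: nearW => j; have /andP[] := xx_time j _ _ X ts.
Qed.

Lemma cvg_node X : node j (ix j X) @[j --> \oo] --> X.
Proof. exact: floor_cvg. Qed.

Lemma xo_continuous : continuous xo.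
Proof.
apply: (@lip_continuous _ _ eps^-1) => X Y; wlog XY : X Y / X <= Y.
  move=> H; have [|/ltW] := leP X Y; first exact: H.
  by rewrite distrC (distrC X); exact: H.
have /andP[h1 h2] := xoP _ _ XY.
rewrite distrC (distrC X) [`|Y - X|]ger0_norm ?subr_ge0//.
by rewrite ger0_norm ?(le_trans _ h1) ?subr_ge0// mulrC.
Qed.

Lemma x_init t X : t <= 0 -> x (t, X) = xo X.
Proof.
move=> t0; apply: (cvg_unique _ (cx (t, X))) => //.
have -> : (fun j => xx j (t, X)) = (fun j => xo (node j (ix j X))).
  by apply/funext => j; rewrite /xx/= tn_le0.
exact: (continuous_cvg _ (xo_continuous X) (cvg_node X)).
Qed.

Lemma cvg_tn t : 0 <= t -> (tn j t)%:R * Dt j @[j --> \oo] --> t.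
Proof.
move=> t0; apply: (@squeeze_cvgr _ _ _ _ (fun j => t - Dt j) (cst t)).
- by apply: nearW => j; have /andP[/ltW -> ->] := tnP j t t0.
- by rewrite -[X in _ --> X]subr0; apply: cvgB; [exact: cvg_cst|exact: cvg_Dt].
- exact: cvg_cst.
Qed.

Lemma cvg_tnS t : 0 <= t -> (tn j t).+1%:R * Dt j @[j --> \oo] --> t.
Proof.
move=> t0; have -> : (fun j => (tn j t).+1%:R * Dt j) = (fun j => (tn j t)%:R * Dt j + Dt j).
  by apply/funext => j; rewrite -natr1 mulrDl mul1r.
rewrite -[X in _ --> X]addr0; apply: cvgD; [exact: cvg_tn|exact: cvg_Dt].
Qed.

Hypothesis Wm : measurable_fun setT W.
Hypothesis Wc : {ae @lebesgue_measure R, forall X : R, {for X, continuous W}}.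

Definition Wj j (X : R) : R := W (node j (ix j X)).
Definition rj j (p : R * R) : R := (tauj j (tn j p.1) (ix j p.2))^-1.
Definition vj j (p : R * R) : R := velj j (tn j p.1) (ix j p.2).

Lemma rjP j p : eps <= rj j p <= 1.
Proof.
have /andP[h1 h2] := taujP j (tn j p.1) (ix j p.2).
rewrite /rj; move: (tauj _ _ _) h1 h2 => u h1 h2.
have u0 : 0 < u by exact: lt_le_trans h1.
by rewrite -[eps]invrK lef_pV2 ?posrE ?invr_gt0// h2 invf_le1.
Qed.

Lemma cvg_pos_seq (t X : R) (n : nat -> nat) : 0 <= t -> (n j)%:R * Dt j @[j --> \oo] --> t ->
  posj j (n j) (ix j X) @[j --> \oo] --> x (t, X).
Proof.
move=> t0 cn.
have lip j n1 n2 i : `|posj j n1 i - posj j n2 i| <= cm * `|n1%:R * Dt j - n2%:R * Dt j|.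
  wlog le : n1 n2 / (n2 <= n1)%N.
    move=> H; have /orP[] := leq_total n2 n1; first exact: H.
    by rewrite distrC (distrC (n1%:R * _)); exact: H.
  have /andP[h1 h2] := posj_lip_t j _ _ i le.
  rewrite ger0_norm// -mulrBl -natrB// ger0_norm; last by rewrite mulr_ge0// ltW ?Dt0.
  by rewrite (mulrC _ (Dt j)) mulrA (mulrC cm).
have c0 : posj j (n j) (ix j X) - xx j (t, X) @[j --> \oo] --> 0.
  apply/norm_cvg0P; apply: (@squeeze_cvgr _ _ _ _ (cst 0)
    (fun j => cm * `|(n j)%:R * Dt j - (tn j t)%:R * Dt j|)).
  - by apply: nearW => j; rewrite normr_ge0 lip.
  - exact: cvg_cst.
  - rewrite -(mulr0 cm); apply: cvgM; first exact: cvg_cst.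
    rewrite -(@normr0 _ R) -(subrr t).
    by apply: cvg_norm; apply: cvgB => //; exact: cvg_tn.
rewrite -[x (t, X)]add0r (_ : (fun j => posj j (n j) (ix j X)) =
  (fun j => (posj j (n j) (ix j X) - xx j (t, X)) + xx j (t, X))); last first.
  by apply/funext => j; rewrite subrK.
exact: cvgD.
Qed.

Lemma vel_cvg X : exists2 B : set R, countable B & forall t : R, 0 < t -> ~ B t ->
  exists u : R, velj j (tn j t) (ix j X) @[j --> \oo] --> u /\
                velj j (tn j t).+1 (ix j X) @[j --> \oo] --> u.
Proof.
have K0 : 0 <= osl_const by rewrite /osl_const addr_ge0// le_max mulr_ge0// cm0.
have [B cB BP] := one_sided_limit R (fun j n => posj j n (ix j X))
  (fun j n => velj j n (ix j X)) Dt (fun t => x (t, X)) cm osl_const Dt0 cvg_Dt K0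
  (fun j n => erefl) (fun j n => velj_bounds j n _) (fun j n N => velj_osl j n N _)
  (fun t n => cvg_pos_seq t X n).
exists B => // t t0 nB; have [u uP] := BP t t0 nB.
by exists u; split; apply: uP; [exact: cvg_tn (ltW t0)|exact: cvg_tnS (ltW t0)].
Qed.

(** The densities converge almost everywhere only. The clamped upper limit is measurable, lies in
    [eps, 1] everywhere, and equals the limit wherever there is one. *)
Definition rl (p : R * R) : R :=
  Num.max eps (Num.min 1 (fine (limn_esup (fun j => (rj j p)%:E)))).

Lemma rlP p : eps <= rl p <= 1.
Proof. by rewrite /rl le_max lexx/= ge_max (ltW eps1) ge_min lexx. Qed.

Lemma measurable_rj j : measurable_fun setT (rj j).
Proof. exact: (measurable_step_nat R (fun n i => (tauj j n i)^-1) _ _ (Dt0 j) (h0 j)). Qed.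

Lemma measurable_vj j : measurable_fun setT (vj j).
Proof. exact: (measurable_step_nat R (velj j) _ _ (Dt0 j) (h0 j)). Qed.

Lemma measurable_xx j : measurable_fun setT (xx j).
Proof. exact: (measurable_step_nat R (posj j) _ _ (Dt0 j) (h0 j)). Qed.

Lemma measurable_rl : measurable_fun setT rl.
Proof.
apply: measurable_maxr => //; apply: measurable_minr => //.
apply: measurableT_comp => //; apply: measurable_fun_limn_esup => j.
by apply/measurable_EFinP; exact: measurable_rj.
Qed.

Lemma Wj_cvg X : {for X, continuous W} -> Wj j X @[j --> \oo] --> W X.
Proof. by move=> cW; exact: (continuous_cvg _ cW (cvg_node X)). Qed.

(** At a continuity point of [W] the parameter of the particle converges, so the limit velocity
    determines a limit density by strict monotonicity. The next time step has the same limit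
    velocity and therefore the same density. *)
Lemma fiber_cvg X : {for X, continuous W} -> exists2 B : set R, countable B &
  forall t : R, 0 < t -> ~ B t ->
  [/\ rj j (t, X) @[j --> \oo] --> rl (t, X),
      rj j (t + Dt j, X) @[j --> \oo] --> rl (t, X),
      vj j (t, X) @[j --> \oo] --> V (rl (t, X)) (W X) &
      vj j (t, X + h j) @[j --> \oo] --> V (rl (t, X)) (W X)].
Proof.
move=> cW; have [B cB BP] := vel_cvg X; exists B => // t t0 nB.
have [u [cu cu']] := BP t t0 nB.
have tnD j : tn j (t + Dt j) = (tn j t).+1 by apply: truncnD1; [exact: Dt0|exact: ltW].
have ixD j : ix j (X + h j) = ix j X + 1 by exact: floorD1.
have Wj01 j : 0 <= Wj j X <= 1 by exact: W01.
have [r [r1 cr rE]] := speed_inverse_cvg R V eps cm A kap al L Cv (fun j => rj j (t, X))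
  (fun j => Wj j X) u (W X) sp (fun j => rjP j _) Wj01 (W01 X) (Wj_cvg X cW) cu.
have cu2 : V (rj j (t + Dt j, X)) (Wj j X) @[j --> \oo] --> u.
  rewrite (_ : (fun j => _) = fun j => velj j (tn j t).+1 (ix j X))//.
  by apply/funext => j; rewrite /rj/= tnD.
have [r' [r'1 cr' r'E]] := speed_inverse_cvg R V eps cm A kap al L Cv (fun j => rj j (t + Dt j, X))
  (fun j => Wj j X) u (W X) sp (fun j => rjP j _) Wj01 (W01 X) (Wj_cvg X cW) cu2.
have al0 := sp_al sp.
have uniq a b : eps <= a <= 1 -> eps <= b <= 1 -> V a (W X) = V b (W X) -> a <= b.
  move=> /andP[a0 a1] /andP[b0 b1] ab; rewrite leNgt; apply/negP => ba.
  have := sp_strict sp _ _ _ (W01 X) (lt_le_trans eps0 b0) (ltW ba) a1.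
  by rewrite ab subrr leNgt mulr_gt0// subr_gt0.
have rr' : r' = r by apply: le_anti; apply/andP; split; apply: uniq => //; rewrite rE r'E.
have rlE : rl (t, X) = r.
  rewrite /rl; have -> : limn_esup (fun j => (rj j (t, X))%:E) = r%:E.
    have ce : (rj j (t, X))%:E @[j --> \oo] --> r%:E by apply: cvg_EFin => //; exact: nearW.
    by rewrite is_cvg_limn_esupE; [exact: cvg_lim|apply/cvg_ex; exists r%:E].
  by have /andP[h1 h2] := r1; rewrite /= (min_idPr h2) (max_idPr h1).
rewrite rlE rE; split => //; first by rewrite -rr'.
have l0 := lam0; have ct : tauj j (tn j t) (ix j X) @[j --> \oo] --> r^-1.
  rewrite (_ : (fun j => _) = fun j => (rj j (t, X))^-1).
    by apply: cvgV => //; rewrite gt_eqF//; have /andP[h1 _] := r1; exact: lt_le_trans h1.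
  by apply/funext => j; rewrite /rj invrK.
have ct' : tauj j (tn j t).+1 (ix j X) @[j --> \oo] --> r^-1.
  rewrite (_ : (fun j => _) = fun j => (rj j (t + Dt j, X))^-1).
    by rewrite -rr'; apply: cvgV => //; rewrite gt_eqF//; have /andP[h1 _] := r'1; exact: lt_le_trans h1.
  by apply/funext => j; rewrite /rj invrK/= tnD.
(* The leader of the particle at [X] is a different particle for each [j], so [vel_cvg] does not
   apply to it. Its velocity is read off the update of the specific volume, whose old and new values
   have the same limit. *)
rewrite (_ : (fun j => _) = fun j => velj j (tn j t) (ix j X) +
    lam^-1 * (tauj j (tn j t).+1 (ix j X) - tauj j (tn j t) (ix j X))); last first.
  apply/funext => j; rewrite /vj/= ixD /tauj (tauS R (Hj j) lam (h j) _ (h0 j)) -/(velj j) -/(tauj j).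
  by rewrite addrAC subrr add0r mulrA mulVf ?gt_eqF// mul1r [RHS]addrC subrK.
rewrite -[u]addr0 -(mulr0 lam^-1) -(subrr r^-1).
by apply: cvgD => //; apply: cvgM; [exact: cvg_cst|exact: cvgB].
Qed.

Local Notation mu := (@lebesgue_measure R).
Local Notation mu2 := (mu \x mu)%E.

Lemma fiber_ae (P : R -> R -> Prop) :
  (forall X, {for X, continuous W} -> exists2 B : set R, countable B &
     forall t : R, 0 < t -> ~ B t -> P t X) ->
  {ae mu, forall X, {ae mu, forall t, 0 <= t -> P t X}}.
Proof.
move=> H; apply: ae_mono Wc => X /H [B cB BP].
have ae1 := countable_ae R _ cB; have ae2 := countable_ae R _ (@countable1 R 0).
apply: (ae_mono2 _ _ R _ _ _ _ _ ae1 ae2) => t nB n0 t0; apply: BP => //.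
by rewrite lt_neqAle t0 andbT; apply/negP => /eqP e; apply: n0; exact: esym.
Qed.

Lemma plane_cvg (f : nat -> R * R -> R) (F : R * R -> R) :
  (forall j, measurable_fun setT (f j)) -> measurable_fun setT F ->
  (forall X, {for X, continuous W} -> exists2 B : set R, countable B &
     forall t : R, 0 < t -> ~ B t -> f j (t, X) @[j --> \oo] --> F (t, X)) ->
  {ae mu2, forall p, 0 <= p.1 -> f j p @[j --> \oo] --> F p}.
Proof.
move=> mf mF H; apply: (ae_cvg_ysection R f F [set p | 0 <= p.1]) => //; last first.
  exact: (fiber_ae (fun t X => f j (t, X) @[j --> \oo] --> F (t, X))).
rewrite (_ : [set p | 0 <= p.1] = `[0, +oo[%classic `*` setT); first exact: measurableX.
by apply/seteqP; split => -[t X] /=; rewrite in_itv/= andbT; [split|case].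
Qed.

(** [scheme_entropy] with the speeds of the constant state [k] under the two neighbouring parameters
    as [g] and [g']. The sign condition is the monotonicity of the speed, and the smallness
    condition follows from [L + Cv <= A] and the CFL condition. *)
Lemma entropyj j (k t X : R) : 0 <= k <= 1 -> 0 <= t ->
  `|1 - k / rj j (t + lam * h j, X)| <= `|1 - k / rj j (t, X)|
    + lam * k * (`|vj j (t, X + h j) - V k (Wj j (X + h j))|
                 - `|vj j (t, X) - V k (Wj j X)|)
    + lam * k * `|V k (Wj j (X + h j)) - V k (Wj j X)|.
Proof.
move=> /andP[k0 k1] t0.
have tnD : tn j (t + lam * h j) = (tn j t).+1 by apply: truncnD1; [exact: Dt0|].
have ixD : ix j (X + h j) = ix j X + 1 by exact: floorD1.
have := rjP j (t, X).
rewrite /vj /Wj /rj /= tnD ixD !invrK.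
have rE : velj j (tn j t) (ix j X) = V (tauj j (tn j t) (ix j X))^-1 (W (node j (ix j X))) by [].
set i := ix j X in rE *; set n := tn j t in rE *; set r := (tauj j n i)^-1 in rE *.
have tE : tauj j n i = r^-1 by rewrite /r invrK.
move=> /andP[r0 r1]; have rp : 0 < r := lt_le_trans eps0 r0.
set w := W (node j i) in rE *; have w1 : 0 <= w <= 1 by exact: W01.
have e : 1 - k * r^-1 = (r - k) / r by field; rewrite gt_eqF.
apply: (scheme_entropy R (Hj j) lam (h j)) => //; first exact: lam0.
- rewrite -/(velj j n i) -/(tauj j n i) rE tE e normrM (ger0_norm (x := r^-1)) ?invr_ge0 ?(ltW rp)//.
  apply: (@le_trans _ _ `|r - k|); last first.
    by rewrite ler_peMr// invf_ge1.
  have rb : 0 <= r <= 1 by rewrite ltW.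
  have kb : 0 <= k <= 1 by rewrite k0.
  have h1 := sp_flux sp _ _ _ w1 rb kb.
  have /andP[V0 V1] := sp_bound sp _ _ rb w1.
  have h2 : k * `|V r w - V k w| <= A * `|r - k|.
    rewrite -{1}(ger0_norm k0) -normrM.
    have -> : k * (V r w - V k w) = (r * V r w - k * V k w) - (r - k) * V r w by ring.
    apply: (le_trans (ler_normB _ _)); rewrite normrM (ger0_norm V0).
    apply: (le_trans (lerD h1 (ler_wpM2l (normr_ge0 _) V1))).
    by rewrite (mulrC `|_|) -mulrDl ler_wpM2r// (sp_LC sp).
  rewrite -mulrA; apply: (le_trans (ler_wpM2l (ltW lam0) h2)).
  rewrite mulrA (mulrC lam) ler_piMl//; apply: (le_trans CFL); lra.
- by rewrite tE invr_ge0 ltW.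
- rewrite -/(velj j n i) -/(tauj j n i) rE tE e.
  have V2 := sp_decr sp _ _ _ w1.
  have [rk|kr] := leP r k.
    rewrite mulr_ge0_le0 ?subr_ge0 ?V2 ?(ltW rp)//.
    by rewrite mulr_le0_ge0 ?subr_le0// invr_ge0 ltW.
  rewrite mulr_le0_ge0 ?subr_le0 ?V2 ?(ltW kr)//.
  by rewrite divr_ge0 ?subr_ge0 ?(ltW kr)// ltW.
Qed.

(** Specific volumes are at least 1, so a label is at most the distance travelled from particle 0
    plus one mass step, and particle 0 itself moves at most [cm * (t + lam)]. Consequently test
    functions read along the trajectories have supports bounded in X uniformly in [j]. *)
Lemma coercivej j (t X : R) : (forall j, h j <= 1) -> 0 <= t ->
  `|X| <= `|xx j (t, X)| + (`|xo 0| + (cm * (t + lam) + 1)).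
Proof.
move=> h1 t0; have /andP[a1 a2] := xx_time j _ _ 0 t0.
have e0 : xx j (0, 0) = xo 0.
  by rewrite /xx/= tn_le0// /ix mul0r Num.Theory.floor0 /posj/= /node mul0r.
have c1 : cm * Dt j <= cm * lam.
  by rewrite ler_wpM2l ?cm0// /Dt -[leRHS]mulr1 ler_wpM2l// ltW// lam0.
rewrite e0 subr0 in a1 a2.
have hj := h1 j; have n1 := ler_norm (xx j (t, X)); have n2 := ler_norm (- xx j (t, X)).
have n3 := ler_norm (xo 0); have n4 := ler_norm (- xo 0); rewrite !normrN in n2 n4.
have [X0|/ltW X0] := leP 0 X.
  by have /andP[s1 _] := xx_space j t _ _ X0; rewrite ger0_norm//; lra.
by have /andP[s1 _] := xx_space j t _ _ X0; rewrite ler0_norm//; lra.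
Qed.

Lemma scheme_limit : (forall j, h j <= 1) ->
  lagrangian_limit R V eps cm W xo lam h Wj xx rj vj x rl.
Proof.
move=> h1.
have mV : measurable_fun setT (fun p : R * R => V (rl p) (W p.2)).
  apply: (sp_meas sp) => //; first exact: measurable_rl.
    exact: (measurableT_comp Wm).
  by move=> p; have /andP[r0 ->] := rlP p; rewrite (le_trans (ltW eps0)).
split => //.
- exact: lam0.
- exact: cm0.
- by move=> j t s X Y et eX; rewrite /xx /rj/= /tn et /ix eX.
- move=> j t X tD; rewrite /xx/=; have -> : tn j t = 0%N; last by [].
  have [t0|/ltW] := leP 0 t; last exact: tn_le0.
  apply: Num.Theory.truncn_def; apply/andP; split; first by rewrite divr_ge0// ltW// Dt0.
  by rewrite ltr_pdivrMr ?Dt0// mul1r.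
- move=> j t X t0; rewrite /xx/=; have -> : tn j (t + lam * h j) = (tn j t).+1.
    by apply: truncnD1; [exact: Dt0|].
  by [].
- move=> j t X; rewrite /xx /rj/=; have -> : ix j (X + h j) = ix j X + 1 by exact: floorD1.
  by rewrite invrK /tauj /tau -/(posj j) mulrC divfK ?gt_eqF// [RHS]addrC subrK.
- move=> j t X Y XY; rewrite /xx/=.
  have le : ix j X <= ix j Y by apply: Num.Theory.le_floor; rewrite ler_pM2r// invr_gt0.
  have e : ix j Y = ix j X + `|ix j Y - ix j X|%N%:Z by rewrite gez0_abs ?subr_ge0//; ring.
  have /andP[h5 _] := posj_mono_x j (tn j t) _ _ _ e.
  by rewrite -subr_ge0; apply: le_trans h5; rewrite mulr_ge0// ltW.
- by move=> j t X; exact: coercivej.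
- exact: rjP.
- by move=> j p; exact: velj_bounds.
- exact: measurable_xx.
- exact: measurable_rj.
- exact: measurable_vj.
- exact: rlP.
- exact: measurable_rl.
- apply: plane_cvg; [exact: measurable_rj|exact: measurable_rl|move=> X /fiber_cvg [B cB BP]].
  by exists B => // t t0 nB; have [] := BP t t0 nB.
- apply: (plane_cvg (fun j p => rj j (p.1 + lam * h j, p.2))); [|exact: measurable_rl|].
    move=> j; have := measurable_shift R _ (lam * h j) 0 (measurable_rj j).
    by under eq_fun do rewrite addr0.
  by move=> X /fiber_cvg [B cB BP]; exists B => // t t0 nB; have [] := BP t t0 nB.
- apply: plane_cvg; [exact: measurable_vj|exact: mV|move=> X /fiber_cvg [B cB BP]].
  by exists B => // t t0 nB; have [] := BP t t0 nB.
- apply: (plane_cvg (fun j p => vj j (p.1, p.2 + h j))); [|exact: mV|].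
    move=> j; have := measurable_shift R _ 0 (h j) (measurable_vj j).
    by under eq_fun do rewrite addr0.
  by move=> X /fiber_cvg [B cB BP]; exists B => // t t0 nB; have [] := BP t t0 nB.
- exact: x_space.
- exact: x_time.
- exact: x_init.
- by move=> j k t X; exact: entropyj.
Qed.

End approximation.

(** * Test functions *)

Section test_functions.
Context (R : realType).
Implicit Types (phi : R * R -> R) (p : R * R).

Lemma test_continuous phi : test_half_plane phi ->
  [/\ continuous phi, continuous (dt phi) & continuous (dx phi)].
Proof. by case=> /(_ 1%N) [c0 [_ _ [c1 _] [c2 _]]] _. Qed.

Lemma test_bounds phi : test_half_plane phi -> exists M B : R,
  [/\ 0 <= M, 0 <= B, forall p, [/\ `|phi p| <= M, `|dt phi p| <= M & `|dx phi p| <= M] &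
      forall p, ~ box R B p -> [/\ phi p = 0, dt phi p = 0 & dx phi p = 0]].
Proof.
move=> tphi; have [c0 c1 c2] := test_continuous phi tphi.
have [_ cK] := tphi; set K := closure _ in cK.
have off p : ~ K p -> [/\ phi p = 0, dt phi p = 0 & dx phi p = 0].
  move=> nK.
  have nz : \near p, phi p = (cst 0 : R * R -> R) p.
    have oC : open (~` K) by apply: closed_openC; exact: closed_closure.
    have /= := open_nbhs_nbhs (conj oC nK); apply: filterS => q nq.
    by apply/eqP/negP => q0; apply: nq; apply: subset_closure; apply/negP.
  have d0 v : 'D_v phi p = 0 by rewrite (near_eq_derive _ nz) derive_cst.
  by split; [exact: nbhs_singleton nz|exact: d0|exact: d0].
have bd (g : R * R -> R) : continuous g -> (forall p, ~ K p -> g p = 0) ->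
    exists2 M : R, 0 <= M & forall p, `|g p| <= M.
  move=> cg g0.
  have /compact_bounded[N [_ hN]] := continuous_compact (continuous_subspaceT cg) cK.
  exists (`|N| + 1); first by rewrite addr_ge0.
  move=> p; have [Kp|nKp] := pselect (K p).
    by apply: (hN (`|N| + 1)); [rewrite (le_lt_trans (ler_norm N))// ltrDl|exists p].
  by rewrite g0// normr0 addr_ge0.
have [M0 M00 M0P] := bd phi c0 (fun p n => let: And3 a _ _ := off p n in a).
have [M1 M10 M1P] := bd _ c1 (fun p n => let: And3 _ a _ := off p n in a).
have [M2 M20 M2P] := bd _ c2 (fun p n => let: And3 _ _ a := off p n in a).
have /compact_bounded[N [_ hN]] := cK.
exists (M0 + M1 + M2), (`|N| + 1); split; rewrite ?addr_ge0//.
  move=> p; have := M0P p; have := M1P p; have := M2P p.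
  by move=> ? ? ?; split; lra.
move=> p nb; apply: off => Kp; apply: nb; apply/boxP.
have : `|p| <= `|N| + 1.
  by apply: hN => //; rewrite (le_lt_trans (ler_norm N))// ltrDl.
by rewrite prod_normE ge_max => /andP.
Qed.

Lemma is_derive_dt phi (t x : R) : test_half_plane phi ->
  is_derive t 1 (fun s => phi (s, x)) (dt phi (t, x)).
Proof.
case=> /(_ 1%N) [_ [d1 _ _ _]] _.
have e : (fun h : R => h^-1 *: (phi (h *: (1, 0) + (t, x)) - phi (t, x))) =
         (fun h : R => h^-1 *: (phi (h *: 1 + t, x) - phi (t, x))).
  apply/funext => h; congr (_ *: (phi _ - _)).
  by rewrite [LHS]/(_ + _)/= /add_pair/= scaler0 add0r.
have := d1 (t, x); rewrite /derivable e => d; split => //.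
by rewrite /dt /derive e.
Qed.

Lemma is_derive_dx phi (t x : R) : test_half_plane phi ->
  is_derive x 1 (fun y => phi (t, y)) (dx phi (t, x)).
Proof.
case=> /(_ 1%N) [_ [_ d1 _ _]] _.
have e : (fun h : R => h^-1 *: (phi (h *: (0, 1) + (t, x)) - phi (t, x))) =
         (fun h : R => h^-1 *: (phi (t, h *: 1 + x) - phi (t, x))).
  apply/funext => h; congr (_ *: (phi _ - _)).
  by rewrite [LHS]/(_ + _)/= /add_pair/= scaler0 add0r.
have := d1 (t, x); rewrite /derivable e => d; split => //.
by rewrite /dx /derive e.
Qed.

Lemma test_increment phi (t x a b : R) : test_half_plane phi -> 0 <= a -> 0 <= b ->
  exists c d : R, [/\ t <= c <= t + a, x <= d <= x + b &
    phi (t + a, x + b) - phi (t, x) = dt phi (c, x + b) * a + dx phi (t, d) * b].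
Proof.
move=> tphi a0 b0.
have ta : t <= t + a by rewrite lerDl.
have xb : x <= x + b by rewrite lerDl.
have [c hc ec] := is_derive_MVT R (fun s => phi (s, x + b)) _ t (t + a)
  (fun s => is_derive_dt phi s (x + b) tphi) ta.
have [d hd ed] := is_derive_MVT R (fun y => phi (t, y)) _ x (x + b)
  (fun y => is_derive_dx phi t y tphi) xb.
exists c, d; split => //; rewrite -[LHS](subrKA (phi (t, x + b))) ec ed.
by congr (_ * _ + _ * _); ring.
Qed.

(** The mean value theorem, applied once in time and once in space, gives two intermediate points
    that both tend to [(t0, x0)]; with [b] the speeds and [a] the time steps, the limit is the
    derivative along the trajectory. *)
Lemma test_quotient_cvg phi (t x a b : nat -> R) (t0 x0 v : R) : test_half_plane phi ->
  (forall j, 0 < a j) -> (forall j, 0 <= b j) -> a @ \oo --> 0 ->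
  b j * a j @[j --> \oo] --> 0 -> b @ \oo --> v -> t @ \oo --> t0 -> x @ \oo --> x0 ->
  (phi (t j + a j, x j + b j * a j) - phi (t j, x j)) / a j @[j --> \oo] -->
    dt phi (t0, x0) + dx phi (t0, x0) * v.
Proof.
move=> tphi a0 b0 ca cba cb ct cx.
have [c0 c1 c2] := test_continuous phi tphi.
have ba0 j : 0 <= b j * a j by rewrite mulr_ge0// ltW.
have /choice[c] := fun j => test_increment phi (t j) (x j) _ _ tphi (ltW (a0 j)) (ba0 j).
move=> /choice[d cdP].
have cc : c @ \oo --> t0.
  apply: (@squeeze_cvgr _ _ _ _ t (fun j => t j + a j)) => //.
    by apply: nearW => j; have [] := cdP j.
  by rewrite -[X in _ --> X]addr0; exact: cvgD.
have cd : d @ \oo --> x0.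
  apply: (@squeeze_cvgr _ _ _ _ x (fun j => x j + b j * a j)) => //.
    by apply: nearW => j; have [] := cdP j.
  by rewrite -[X in _ --> X]addr0; exact: cvgD.
have cxb : x j + b j * a j @[j --> \oo] --> x0.
  by rewrite -[X in _ --> X]addr0; exact: cvgD.
rewrite (_ : (fun j => _) = fun j => dt phi (c j, x j + b j * a j) + dx phi (t j, d j) * b j).
  apply: cvgD; first exact: (continuous_cvg_pair R _ c1).
  by apply: cvgM => //; exact: (continuous_cvg_pair R _ c2).
apply/funext => j; have [_ _ ->] := cdP j.
by have := a0 j; move: (dt phi _) (dx phi _) => ? ? ?; field; rewrite gt_eqF.
Qed.

Lemma test_quotient_le phi (M t x a b C : R) : test_half_plane phi -> 0 <= M ->
  (forall p, `|dt phi p| <= M /\ `|dx phi p| <= M) -> 0 < a -> 0 <= b <= C ->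
  `|(phi (t + a, x + b * a) - phi (t, x)) / a| <= M * (1 + C).
Proof.
move=> tphi M0 MP a0 /andP[b0 bC].
have [c [d [_ _ ->]]] := test_increment phi t x a (b * a) tphi (ltW a0) (mulr_ge0 b0 (ltW a0)).
have [h1 _] := MP (c, x + b * a); have [_ h2] := MP (t, d).
move: (dt _ _) (dx _ _) h1 h2 => u v h1 h2.
have -> : (u * a + v * (b * a)) / a = u + v * b by field; rewrite gt_eqF.
apply: (le_trans (ler_normD _ _)); rewrite normrM (ger0_norm b0) mulrDr mulr1 lerD//.
exact: ler_pM.
Qed.

End test_functions.

(** * Integration of bounded functions with bounded support *)

Section bounded_box_supported.
Context (R : realType).
Local Notation mu := (@lebesgue_measure R).
Local Notation mu2 := (mu \x mu)%E.

(** A class stable under shifts, sums and bounded factors, all of whose members are integrable. The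
    real-valued integral is additive only for integrable functions, so the summations by parts are
    carried out inside this class. *)
Definition bbs (F : R * R -> R) : Prop :=
  [/\ measurable_fun setT F, exists M : R, forall p, `|F p| <= M &
      exists B : R, forall p, ~ box R B p -> F p = 0].

Lemma bbs_integrable F : bbs F -> mu2.-integrable setT (EFin \o F).
Proof. by case=> mF [M FM] [B F0]; exact: box_integrable F0. Qed.

Lemma bbs_shift F (a b : R) : bbs F -> bbs (fun p => F (p.1 + a, p.2 + b)).
Proof.
case=> mF [M FM] [B F0]; split; [exact: measurable_shift|by exists M|].
exists (B + `|a| + `|b|) => p nb; apply: F0 => /boxP/= [h1 h2]; apply: nb; apply/boxP.
have := ler_normB (p.1 + a) a; have := ler_normB (p.2 + b) b.
by rewrite !addrK; have := normr_ge0 a; have := normr_ge0 b; split; lra.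
Qed.

Lemma bbs_int_shift F (a b : R) : bbs F ->
  \int[mu2]_p F (p.1 + a, p.2 + b) = \int[mu2]_p F p.
Proof. by case=> mF [M FM] [B F0]; exact: integral_shift2 F0. Qed.

Lemma bbsMl (G F : R * R -> R) (C : R) : measurable_fun setT G -> (forall p, `|G p| <= C) ->
  bbs F -> bbs (fun p => G p * F p).
Proof.
move=> mG GC [mF [M FM] [B F0]]; split; first exact: measurable_funM.
  exists (C * M) => p; rewrite normrM; exact: ler_pM.
by exists B => p /F0 ->; rewrite mulr0.
Qed.

Lemma bbsD F G : bbs F -> bbs G -> bbs (fun p => F p + G p).
Proof.
move=> [mF [M FM] [B F0]] [mG [N GN] [C G0]]; split; first exact: measurable_funD.
  by exists (M + N) => p; apply: (le_trans (ler_normD _ _)); rewrite lerD.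
exists (Num.max B C) => p nb; rewrite F0 ?G0 ?addr0// => /boxP[h1 h2]; apply: nb; apply/boxP.
  by rewrite !le_max h1 h2 !orbT.
by rewrite !le_max h1 h2.
Qed.

Lemma bbsN F : bbs F -> bbs (fun p => - F p).
Proof.
move=> bF; have -> : (fun p => - F p) = (fun p => -1 * F p).
  by apply/funext => p; rewrite mulN1r.
apply: (bbsMl (cst (-1)) F 1) => // p; by rewrite normrN normr1.
Qed.

Lemma bbsB F G : bbs F -> bbs G -> bbs (fun p => F p - G p).
Proof. by move=> bF /bbsN; exact: bbsD. Qed.

Lemma bbs_intD F G : bbs F -> bbs G ->
  \int[mu2]_p (F p + G p) = \int[mu2]_p F p + \int[mu2]_p G p.
Proof. by move=> /bbs_integrable iF /bbs_integrable iG; rewrite RintegralD. Qed.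

Lemma bbs_intB F G : bbs F -> bbs G ->
  \int[mu2]_p (F p - G p) = \int[mu2]_p F p - \int[mu2]_p G p.
Proof. by move=> /bbs_integrable iF /bbs_integrable iG; rewrite RintegralB. Qed.

Lemma bbs_intZ (c : R) F : bbs F -> \int[mu2]_p (c * F p) = c * \int[mu2]_p F p.
Proof. by move=> /bbs_integrable iF; rewrite RintegralZl. Qed.

Lemma bbs_le F G : bbs F -> bbs G -> (forall p, F p <= G p) ->
  \int[mu2]_p F p <= \int[mu2]_p G p.
Proof. by move=> /bbs_integrable iF /bbs_integrable iG FG; apply: le_Rintegral. Qed.

(** Integrals over the half-plane become integrals over the plane, where translations act; the
    failure of [chi] to be invariant in time is what produces the initial term. *)
Definition chi (p : R * R) : R := \1_(@half_plane R) p.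

Lemma measurable_half_plane : measurable (@half_plane R).
Proof. exact: measurableX. Qed.

Lemma chiT (p : R * R) : 0 <= p.1 -> chi p = 1.
Proof.
by move=> p0; rewrite /chi indicE mem_set// /half_plane /= in_itv/= p0.
Qed.

Lemma chiF (p : R * R) : p.1 < 0 -> chi p = 0.
Proof.
move=> p0; rewrite /chi indicE memNset// => -[]; rewrite /= in_itv/= andbT.
by rewrite leNgt p0.
Qed.

Lemma measurable_chi : measurable_fun setT chi.
Proof. by apply: measurable_indic; exact: measurable_half_plane. Qed.

Lemma chi_le1 p : `|chi p| <= 1.
Proof. by have [/chiT ->|/chiF ->] := leP 0 p.1; rewrite ?normr1 ?normr0. Qed.

Lemma half_plane_dct (F_ : nat -> R * R -> R) (F : R * R -> R) (M B : R) :
  (forall j, measurable_fun setT (F_ j)) -> measurable_fun setT F ->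
  (forall j p, 0 <= p.1 -> `|F_ j p| <= M) ->
  (forall j p, 0 <= p.1 -> ~ box R B p -> F_ j p = 0) ->
  {ae mu2, forall p, 0 <= p.1 -> F_ j p @[j --> \oo] --> F p} ->
  \int[mu2]_p (chi p * F_ j p) @[j --> \oo] --> \int[mu2]_p (chi p * F p).
Proof.
move=> mF_ mF FM F0 cF.
apply: (@bounded_support_dct _ _ R mu2 (box R B) `|M|).
- exact: measurable_box.
- exact: box_lty.
- by move=> j; exact: (measurable_funM measurable_chi (mF_ j)).
- exact: (measurable_funM measurable_chi mF).
- move=> j p _; have [p0|p0] := leP 0 p.1; last by rewrite chiF// mul0r normr0.
  by rewrite chiT// mul1r (le_trans (FM j p p0))// ler_norm.
- move=> j p nb; have [p0|p0] := leP 0 p.1; last by rewrite chiF// mul0r.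
  by rewrite F0// mulr0.
- apply: (ae_mono2 _ _ R _ _ _ _ _ cF cF) => p cp _; have [p0|p0] := leP 0 p.1.
    by rewrite chiT//; under eq_fun do rewrite mul1r; rewrite mul1r; exact: cp.
  by rewrite chiF//; under eq_fun do rewrite mul0r; rewrite mul0r; exact: cvg_cst.
Qed.

Lemma half_plane_bbs (F : R * R -> R) (M B : R) : measurable_fun setT F ->
  (forall p, 0 <= p.1 -> `|F p| <= M) -> (forall p, 0 <= p.1 -> ~ box R B p -> F p = 0) ->
  bbs (fun p => chi p * F p).
Proof.
move=> mF FM F0; split.
- exact: (measurable_funM measurable_chi mF).
- exists `|M| => p; have [p0|p0] := leP 0 p.1; last by rewrite chiF// mul0r normr0.
  by rewrite chiT// mul1r (le_trans (FM p p0))// ler_norm.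
- exists B => p nb; have [p0|p0] := leP 0 p.1; last by rewrite chiF// mul0r.
  by rewrite F0// mulr0.
Qed.

Lemma bbs_fubini F : bbs F ->
  \int[mu2]_p F p = \int[mu]_t \int[mu]_x F (t, x).
Proof.
move=> bF; have iF := bbs_integrable F bF.
rewrite /Rintegral Rintegral_fubini//; congr fine; apply: eq_integral => t _.
rewrite fineK//; have [mF [M FM] [B F0]] := bF.
apply: integrable_fin_num => //.
apply: (@bounded_support_integrable _ _ R mu `[- B, B]%classic M) => //.
- exact: segment_lty.
- exact: (measurableT_comp mF (pair1_measurable _)).
- by move=> x nb; apply: F0 => -[].
Qed.

End bounded_box_supported.

(** * Passage to the limit in Lagrangian coordinates *)

Section limit_passage.
Context (R : realType).
Local Notation mu := (@lebesgue_measure R).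
Local Notation mu2 := (mu \x mu)%E.
Variables (V : R -> R -> R) (eps cm A kap al L Cv : R).
Hypothesis sp : speed_spec R V eps cm A kap al L Cv.
Variables (W xo : R -> R) (lam : R) (h : nat -> R) (Wj : nat -> R -> R).
Variables (xj rj vj : nat -> R * R -> R) (x rl : R * R -> R).
Hypothesis ll : lagrangian_limit R V eps cm W xo lam h Wj xj rj vj x rl.
Hypothesis W01 : forall X, 0 <= W X <= 1.
Hypothesis Wm : measurable_fun setT W.
Variables (phi : R * R -> R) (M B : R).
Hypothesis tphi : test_half_plane phi.
Hypothesis M0 : 0 <= M.
Hypothesis B0 : 0 <= B.
Hypothesis phiM : forall p, [/\ `|phi p| <= M, `|dt phi p| <= M & `|dx phi p| <= M].
Hypothesis phiB : forall p, ~ box R B p -> [/\ phi p = 0, dt phi p = 0 & dx phi p = 0].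

Let h0 j : 0 < h j. Proof. by case: ll. Qed.
Let h1 j : h j <= 1. Proof. by case: ll. Qed.
Let lam0 : 0 < lam. Proof. by case: ll. Qed.
Let cm0 : 0 <= cm. Proof. by case: ll. Qed.
Let ch : h @ \oo --> 0. Proof. by case: ll. Qed.
Let eps0 : 0 < eps. Proof. by case/andP: (sp_eps sp). Qed.
Local Notation D := (fun j => lam * h j).
Let D0 j : 0 < lam * h j. Proof. exact: mulr_gt0. Qed.
Let D1 j : lam * h j <= lam. Proof. by rewrite ler_piMr// ltW. Qed.
Let cD : lam * h j @[j --> \oo] --> 0.
Proof. by rewrite -(mulr0 lam); apply: cvgM => //; exact: cvg_cst. Qed.
Let mxj j : measurable_fun setT (xj j). Proof. by case: ll. Qed.
Let mvj j : measurable_fun setT (vj j). Proof. by case: ll. Qed.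
Let vjP j p : 0 <= vj j p <= cm. Proof. by case: ll. Qed.

(** With the time rounded down to the grid, [psi j] is constant on the cells of the scheme, a fact
    used on the first time layer and on single mass cells. *)
Definition Tj j (t : R) : R := (Num.truncn (t / (lam * h j)))%:R * (lam * h j).

Lemma Tj_shift j t : 0 <= t -> Tj j (t + lam * h j) = Tj j t + lam * h j.
Proof. by move=> t0; rewrite /Tj truncnD1// -natr1 mulrDl mul1r. Qed.

Lemma Tj_le j t : 0 <= t -> t - lam * h j < Tj j t <= t.
Proof.
move=> t0; have /andP[a1 a2] : (Num.truncn (t / (lam * h j)))%:R <= t / (lam * h j)
    < (Num.truncn (t / (lam * h j))).+1%:R.
  by apply: truncn_itv; rewrite divr_ge0// ltW.
rewrite -ler_pdivlMr// a1 andbT ltrBlDr.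
by move: a2; rewrite ltr_pdivrMr// -natr1 mulrDl mul1r.
Qed.

Lemma Tj_cvg t : 0 <= t -> Tj j t @[j --> \oo] --> t.
Proof.
move=> t0; apply: (@squeeze_cvgr _ _ _ _ (fun j => t - lam * h j) (cst t)).
- by apply: nearW => j; have /andP[/ltW -> ->] := Tj_le j t t0.
- by rewrite -[X in _ --> X]subr0; apply: cvgB => //; exact: cvg_cst.
- exact: cvg_cst.
Qed.

Lemma measurable_Tj j : measurable_fun setT (fun p : R * R => Tj j p.1).
Proof.
have := measurable_step_nat R (fun n _ => n%:R * (lam * h j)) _ _ (D0 j) ltr01.
exact.
Qed.

Definition psi j (p : R * R) : R := phi (Tj j p.1, xj j p).

Lemma measurable_psi j : measurable_fun setT (psi j).
Proof.
have [c0 _ _] := test_continuous R phi tphi.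
apply: (measurableT_comp (continuous_measurable2 R phi c0)).
by apply: measurable_fun_pair => //; exact: measurable_Tj.
Qed.

Lemma psi_le j p : `|psi j p| <= M.
Proof. by have [] := phiM (Tj j p.1, xj j p). Qed.

(** One radius for both coordinates: [B + lam] for the time, and for the label the bound of
    [ll_coercive] at times up to [B + lam], with a further 1 for a shift by one mass step. *)
Definition support_radius : R := (B + lam) + (B + (`|xo 0| + (cm * (B + 2 * lam) + 1)) + 1).

Lemma psi_box j (p : R * R) (a b : R) : 0 <= p.1 -> 0 <= a <= lam -> 0 <= b <= 1 ->
  ~ box R support_radius p -> psi j (p.1 + a, p.2 + b) = 0.
Proof.
move=> p0 /andP[a0 a1] /andP[b0 b1] nb; apply: contrapT => nz; apply: nb.
have /boxP[/= t1 x1] : box R B (Tj j (p.1 + a), xj j (p.1 + a, p.2 + b)).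
  by apply: contrapT => /phiB [e _ _]; apply: nz.
have pa0 : 0 <= p.1 + a by rewrite addr_ge0.
have /andP[t2 t3] := Tj_le j _ pa0.
have := ll_coercive ll j _ (p.2 + b) pa0.
have := D1 j; have := ler_norm (Tj j (p.1 + a)) => T1 D1j co.
have p1B : p.1 + a <= B + lam by lra.
have c2 : cm * (p.1 + a + lam) <= cm * (B + 2 * lam) by rewrite ler_wpM2l//; lra.
have := normr_ge0 (xo 0); have := mulr_ge0 cm0 (addr_ge0 pa0 (ltW lam0)).
have := ler_normB (p.2 + b) b; rewrite (ger0_norm b0) => n1 n2 n3.
have l0 := lam0; have B0' := B0; rewrite addrK in n1.
apply/boxP; rewrite /support_radius ger0_norm//; split; lra.
Qed.

Lemma psi_box0 j (p : R * R) : 0 <= p.1 -> ~ box R support_radius p -> psi j p = 0.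
Proof.
move=> p0 nb; have := psi_box j p 0 0 p0; rewrite !addr0 -surjective_pairing; apply => //.
  by rewrite lexx ltW.
by rewrite lexx ler01.
Qed.

Lemma psi_boxD j (p : R * R) : 0 <= p.1 -> ~ box R support_radius p ->
  psi j (p.1 + lam * h j, p.2) = 0.
Proof.
move=> p0 nb; have := psi_box j p (lam * h j) 0 p0; rewrite addr0; apply => //.
  by rewrite ltW//=.
by rewrite lexx ler01.
Qed.

Definition dq j (p : R * R) : R := (psi j (p.1 + lam * h j, p.2) - psi j p) / (lam * h j).
Definition Lphi (p : R * R) : R :=
  dt phi (p.1, x p) + dx phi (p.1, x p) * V (rl p) (W p.2).

Lemma psi_time j (p : R * R) : 0 <= p.1 ->
  psi j (p.1 + lam * h j, p.2) =
  phi (Tj j p.1 + lam * h j, xj j p + vj j p * (lam * h j)).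
Proof.
move=> p0; rewrite /psi/= Tj_shift//.
rewrite (ll_time ll)// -surjective_pairing.
by rewrite (mulrC (vj j p)).
Qed.

Lemma dq_le j p : 0 <= p.1 -> `|dq j p| <= M * (1 + cm).
Proof.
move=> p0; rewrite /dq psi_time// /psi; apply: test_quotient_le => //.
by move=> q; have [_ ? ?] := phiM q.
Qed.

Lemma dq_box j p : 0 <= p.1 -> ~ box R support_radius p -> dq j p = 0.
Proof. by move=> p0 nb; rewrite /dq psi_boxD// psi_box0// subrr mul0r. Qed.

Lemma measurable_dq j : measurable_fun setT (dq j).
Proof.
apply: measurable_funM => //; apply: measurable_funB; last exact: measurable_psi.
have := measurable_shift R _ (lam * h j) 0 (measurable_psi j).
by under eq_fun do rewrite addr0.
Qed.

Lemma measurable_x : measurable_fun setT x.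
Proof.
apply: (@measurable_fun_cvgr _ _ _ setT xj) => // p _.
exact: (ll_cx ll).
Qed.

Lemma measurable_V : measurable_fun setT (fun p : R * R => V (rl p) (W p.2)).
Proof.
apply: (sp_meas sp) => //; first by case: ll.
  exact: (measurableT_comp Wm).
by move=> p; have /andP[r0 ->] := ll_rl ll p;
  rewrite (le_trans (ltW eps0)).
Qed.

Lemma measurable_along (g : R * R -> R) : continuous g ->
  measurable_fun setT (fun p : R * R => g (p.1, x p)).
Proof.
move=> cg; apply: (measurableT_comp (continuous_measurable2 R g cg)).
by apply: measurable_fun_pair => //; exact: measurable_x.
Qed.

Lemma measurable_Lphi : measurable_fun setT Lphi.
Proof.
have [_ c1 c2] := test_continuous R phi tphi.
apply: measurable_funD; first exact: measurable_along.
by apply: measurable_funM; [exact: measurable_along|exact: measurable_V].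
Qed.

Lemma dq_cvg : {ae mu2, forall p, 0 <= p.1 -> dq j p @[j --> \oo] --> Lphi p}.
Proof.
have cv := ll_cv ll.
apply: (ae_mono2 _ _ R _ _ _ _ _ cv cv) => p cvp _ p0.
rewrite (_ : (fun j => dq j p) = fun j => (phi (Tj j p.1 + lam * h j,
    xj j p + vj j p * (lam * h j)) - phi (Tj j p.1, xj j p)) / (lam * h j)); last first.
  by apply/funext => j; rewrite /dq psi_time.
apply: test_quotient_cvg => //.
- by move=> j; have /andP[] := vjP j p.
- by rewrite -(mulr0 (V (rl p) (W p.2))); apply: cvgM => //; exact: cvp.
- exact: cvp.
- exact: Tj_cvg.
- exact: (ll_cx ll).
Qed.

Lemma along_box (p : R * R) : 0 <= p.1 -> ~ box R support_radius p -> ~ box R B (p.1, x p).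
Proof.
move=> p0 nb /boxP[/= h1' h2']; apply: nb.
have co : `|p.2| <= `|x p| + (`|xo 0| + (cm * (p.1 + lam) + 1)).
  have cx := ll_cx ll p.
  have c1 : `|xj j p| + (`|xo 0| + (cm * (p.1 + lam) + 1)) @[j --> \oo] -->
      `|x p| + (`|xo 0| + (cm * (p.1 + lam) + 1)).
    by apply: cvgD; [exact: cvg_norm|exact: cvg_cst].
  have c0 : (fun _ : nat => `|p.2|) @ \oo --> `|p.2| by exact: cvg_cst.
  apply: (ler_cvg_to c0 c1); apply: nearW => j.
  by have := ll_coercive ll j _ p.2 p0; rewrite -surjective_pairing.
rewrite ger0_norm// in h1'; have l0 := lam0; have B0' := B0.
have c2 : cm * (p.1 + lam) <= cm * (B + 2 * lam) by rewrite ler_wpM2l//; lra.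
have := normr_ge0 (xo 0); have := mulr_ge0 cm0 (addr_ge0 p0 (ltW lam0)) => n1 n2.
by apply/boxP; rewrite /support_radius ger0_norm//; split; lra.
Qed.

Lemma Lphi_bbs (E : R * R -> R) (C : R) : measurable_fun setT E -> (forall p, `|E p| <= C) ->
  bbs R (fun p => chi R p * (E p * Lphi p)).
Proof.
move=> mE EC; apply: (half_plane_bbs R _ (C * (M + M * Cv)) support_radius).
- by apply: measurable_funM => //; exact: measurable_Lphi.
- move=> p p0; rewrite normrM; apply: ler_pM => //; apply: (le_trans (ler_normD _ _)).
  have [_ d1 d2] := phiM (p.1, x p); rewrite lerD// normrM; apply: ler_pM => //.
  have /andP[r0 r1] := ll_rl ll p.
  have r01 : 0 <= rl p <= 1 by rewrite r1 (le_trans (ltW eps0)).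
  by have /andP[v0 v1] := sp_bound sp _ _ r01 (W01 p.2); rewrite ger0_norm.
- move=> p p0 nb; have [_ d1 d2] := phiB _ (along_box p p0 nb).
  by rewrite /Lphi d1 d2 mul0r addr0 mulr0.
Qed.

Section summation_by_parts.
Variables (E_ : nat -> R * R -> R) (E : R * R -> R) (C : R).
Hypothesis mE_ : forall j, measurable_fun setT (E_ j).
Hypothesis mE : measurable_fun setT E.
Hypothesis EC : forall j p, `|E_ j p| <= C.
Hypothesis cE : {ae mu2, forall p, 0 <= p.1 -> E_ j p @[j --> \oo] --> E p}.
Hypothesis E0 : forall j t X, 0 <= t -> t < lam * h j -> E_ j (t, X) = E_ j (0, X).

Let C0 : 0 <= C. Proof. exact: le_trans (EC 0 (0, 0)). Qed.

(** On the first layer neither [E_ j] nor [psi j] depends on time, so the strip contributes its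
    width times the slice at time 0. *)
Lemma initial_layer j :
  \int[mu2]_p (chi R p * (\1_[set q : R * R | q.1 < lam * h j] p * (E_ j p * psi j p))) =
  lam * h j * \int[mu]_X (E_ j (0, X) * psi j (0, X)).
Proof.
rewrite bbs_fubini; last first.
  apply: (half_plane_bbs R _ (C * M) support_radius).
  - apply: measurable_funM; last by apply: measurable_funM => //; exact: measurable_psi.
    apply: measurable_indic; rewrite (_ : mkset _ = `]-oo, (lam * h j)[%classic `*` setT).
      exact: measurableX.
    by apply/seteqP; split => -[t X]; rewrite /= in_itv/=; [split|case].
  - move=> p _; rewrite !normrM -[leRHS]mul1r; apply: ler_pM => //.
      by rewrite indicE; case: (_ \in _); rewrite ?normr1 ?normr0.
    by apply: ler_pM => //; exact: psi_le.
  - by move=> p p0 nb; rewrite psi_box0// !mulr0.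
pose c := \int[mu]_X (E_ j (0, X) * psi j (0, X)); rewrite -/c.
transitivity (\int[mu]_t (c * \1_(`[0, lam * h j[%classic) t)).
  apply: eq_Rintegral => t _; have [t0|t0] := leP 0 t; last first.
    rewrite indicE memNset ?mulr0//; last by rewrite /= in_itv/= leNgt t0.
    rewrite (@eq_Rintegral _ _ _ mu setT (cst 0)) ?Rintegral_cst ?mul0r// => X _.
    by rewrite chiF// mul0r.
  have [tD|tD] := ltP t (lam * h j); last first.
    rewrite indicE memNset ?mulr0//; last by rewrite /= in_itv/= ltNge tD andbF.
    rewrite (@eq_Rintegral _ _ _ mu setT (cst 0)) ?Rintegral_cst ?mul0r// => X _.
    by rewrite [X in _ * (X * _)]indicE memNset ?mul0r ?mulr0//= ltNge tD.
  rewrite indicE mem_set ?mulr1//; last by rewrite /= in_itv/= t0.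
  apply: eq_Rintegral => X _; rewrite chiT// mul1r indicE mem_set// mul1r E0//.
  rewrite /psi/= !(ll_xj0 ll)//; congr (_ * phi (_, _)).
  rewrite /Tj mul0r; congr (_%:R * _); rewrite (_ : Num.truncn (t / _) = 0%N).
    by apply/esym; apply: Num.Theory.truncn_def; rewrite lexx ltr01.
  apply: Num.Theory.truncn_def; apply/andP; split; first by rewrite divr_ge0// ltW.
  by rewrite ltr_pdivrMr// mul1r.
rewrite RintegralZl//; last first.
  have -> : EFin \o (\1_`[0, lam * h j[ : R -> R) = fun t => (\1_`[0, lam * h j[ t)%:E by [].
  apply/integrableP; split; first exact/measurable_EFinP.
  under eq_integral => t _ do rewrite gee0_abs ?lee_fin//.
  rewrite integral_indicT// lebesgue_measure_itv/=; case: ifPn => // _.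
  by rewrite ltry.
rewrite mulrC; congr (_ * _).
rewrite /Rintegral integral_indicT// lebesgue_measure_itv/= lte_fin D0.
by rewrite oppr0 adde0.
Qed.

Lemma summation_by_parts j :
  \int[mu2]_p (chi R p * ((E_ j (p.1 + lam * h j, p.2) - E_ j p) / (lam * h j) *
                          psi j (p.1 + lam * h j, p.2)))
  + \int[mu]_X (E_ j (0, X) * psi j (0, X)) =
  - \int[mu2]_p (chi R p * (E_ j p * dq j p)).
Proof.
pose d := lam * h j.
pose G p := chi R p * (E_ j p * psi j p).
(* The shift of [G] by one time step also covers the strip [- d <= t < 0], absent from the
   half-plane integral. [H] is this surplus; [initial_layer] evaluates it and it becomes the initial
   term. *)
pose H p := chi R p * (\1_[set q : R * R | q.1 < d] p * (E_ j p * psi j p)).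
have mI : measurable_fun setT (\1_[set q : R * R | q.1 < d] : R * R -> R).
  apply: measurable_indic; rewrite (_ : mkset _ = `]-oo, d[%classic `*` setT).
    exact: measurableX.
  by apply/seteqP; split => -[t X]; rewrite /= in_itv/=; [split|case].
have mEpsi : measurable_fun setT (fun p => E_ j p * psi j p).
  by apply: measurable_funM => //; exact: measurable_psi.
have bG : bbs R G.
  apply: (half_plane_bbs R _ (C * M) support_radius) => //.
  - by move=> p _; rewrite normrM; apply: ler_pM => //; exact: psi_le.
  - by move=> p p0 nb; rewrite psi_box0// mulr0.
have bH : bbs R H.
  apply: (half_plane_bbs R _ (C * M) support_radius) => //.
  - exact: measurable_funM.
  - move=> p _; rewrite !normrM -[leRHS]mul1r; apply: ler_pM => //.
      by rewrite indicE; case: (_ \in _); rewrite ?normr1 ?normr0.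
    by apply: ler_pM => //; exact: psi_le.
  - by move=> p p0 nb; rewrite psi_box0// !mulr0.
have bQ : bbs R (fun p => chi R p * (E_ j p * dq j p)).
  apply: (half_plane_bbs R _ (C * (M * (1 + cm))) support_radius) => //.
  - by apply: measurable_funM => //; exact: measurable_dq.
  - by move=> p p0; rewrite normrM; apply: ler_pM => //; exact: dq_le.
  - by move=> p p0 nb; rewrite dq_box// mulr0.
have d0 : 0 < d by exact: D0.
have dd : d * d^-1 = 1 by rewrite divff// gt_eqF.
pose Gs p := G (p.1 + d, p.2 + 0); pose Hs p := H (p.1 + d, p.2 + 0).
have bGs : bbs R Gs by exact: bbs_shift.
have bHs : bbs R Hs by exact: bbs_shift.
have pw p : chi R p * ((E_ j (p.1 + d, p.2) - E_ j p) / d * psi j (p.1 + d, p.2)) =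
    d^-1 * (Gs p - Hs p - G p) - chi R p * (E_ j p * dq j p).
  have dqE : psi j (p.1 + d, p.2) = psi j p + d * dq j p.
    by rewrite /dq -/d mulrCA divff ?gt_eqF// mulr1 [RHS]addrC subrK.
  have GH : Gs p - Hs p = chi R p * (E_ j (p.1 + d, p.2) * psi j (p.1 + d, p.2)).
    rewrite /Gs /Hs /G /H addr0; have [p0|p0] := leP 0 p.1.
      rewrite (chiT R p p0) chiT/=; last by rewrite addr_ge0// ltW.
      rewrite [X in _ - _ * (X * _)]indicE memNset ?mul0r ?mulr0 ?subr0//=.
      by apply/negP; rewrite -leNgt lerDr.
    rewrite (chiF R p p0) mul0r.
    rewrite [X in _ - _ * (X * _)]indicE mem_set ?mul1r ?subrr//=.
    by rewrite gtrDr.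
  rewrite GH /G dqE; move: (chi R p) (E_ j _) (E_ j p) (psi j p) (dq j p) => c e' e f q.
  by field; rewrite gt_eqF.
have -> : \int[mu2]_p (chi R p * ((E_ j (p.1 + d, p.2) - E_ j p) / d *
      psi j (p.1 + d, p.2))) =
    d^-1 * (\int[mu2]_p G p - \int[mu2]_p H p - \int[mu2]_p G p) -
    \int[mu2]_p (chi R p * (E_ j p * dq j p)).
  under eq_Rintegral => p _ do rewrite pw.
  have b1 : bbs R (fun p => Gs p - Hs p) by exact: bbsB.
  have b2 : bbs R (fun p => Gs p - Hs p - G p) by exact: bbsB.
  have b3 : bbs R (fun p => d^-1 * (Gs p - Hs p - G p)).
    by apply: (bbsMl R (cst d^-1) _ `|d^-1|).
  rewrite bbs_intB// bbs_intZ// bbs_intB// bbs_intB//.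
  by rewrite /Gs /Hs (bbs_int_shift R _ _ _ bG) (bbs_int_shift R _ _ _ bH).
rewrite (_ : \int[mu2]_p H p = d * \int[mu]_X (E_ j (0, X) * psi j (0, X))); last first.
  exact: initial_layer.
move: (\int[mu2]_p G p) (\int[mu]_X _) (\int[mu2]_p (chi R p * _)) => g b a.
by field; rewrite gt_eqF.
Qed.

Lemma summation_limit :
  \int[mu2]_p (chi R p * (E_ j p * dq j p)) @[j --> \oo] -->
  \int[mu2]_p (chi R p * (E p * Lphi p)).
Proof.
apply: (half_plane_dct R _ _ (C * (M * (1 + cm))) support_radius).
- by move=> j; apply: measurable_funM => //; exact: measurable_dq.
- by apply: measurable_funM => //; exact: measurable_Lphi.
- by move=> j p p0; rewrite normrM; apply: ler_pM => //; exact: dq_le.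
- by move=> j p p0 nb; rewrite dq_box// mulr0.
- apply: (ae_mono2 _ _ R _ _ _ _ _ cE dq_cvg) => p c1 c2 p0.
  by apply: cvgM; [exact: c1|exact: c2].
Qed.

End summation_by_parts.

Lemma initial_limit (e_ : nat -> R -> R) (e : R -> R) (C : R) :
  (forall j, measurable_fun setT (e_ j)) -> measurable_fun setT e ->
  (forall j X, `|e_ j X| <= C) -> {ae mu, forall X, e_ j X @[j --> \oo] --> e X} ->
  \int[mu]_X (e_ j X * psi j (0, X)) @[j --> \oo] --> \int[mu]_X (e X * phi (0, xo X)).
Proof.
move=> me_ me eC ce; have [c0 _ _] := test_continuous R phi tphi.
have x0E X : x (0, X) = xo X by apply: (ll_init ll).
have mp j : measurable_fun setT (fun X => psi j (0, X)).
  exact: (measurableT_comp (measurable_psi j) (pair1_measurable _)).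
have mphi : measurable_fun setT (fun X => phi (0, xo X)).
  have := measurableT_comp (measurable_along phi c0) (pair1_measurable (0 : R)).
  by congr measurable_fun; apply/funext => X /=; rewrite x0E.
apply: (@bounded_support_dct _ _ R mu `[- support_radius, support_radius]%classic (C * M)) => //.
- exact: segment_lty.
- by move=> j; exact: (measurable_funM (me_ j) (mp j)).
- exact: (measurable_funM me mphi).
- by move=> j X _; rewrite normrM; apply: ler_pM => //; exact: psi_le.
- move=> j X nb; rewrite psi_box0 ?mulr0// => /boxP[/= _ h2]; apply: nb.
  by rewrite /= in_itv/= -ler_norml.
- apply: ae_mono ce => X ceX; apply: cvgM => //; rewrite -x0E; apply: continuous_cvg_pair => //.
    exact: Tj_cvg.
  exact: (ll_cx ll).
Qed.

(** A function of the label alone has zero discrete time derivative, so [summation_by_parts] is an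
    exact conservation law before any limit is taken. The weights 1 and [W] yield the equations for
    rho and for rho w. *)
Lemma weak_limit (om : R -> R) (C : R) : measurable_fun setT om -> (forall X, `|om X| <= C) ->
  \int[mu2]_p (chi R p * (om p.2 * Lphi p)) + \int[mu]_X (om X * phi (0, xo X)) = 0.
Proof.
move=> mom omC.
have mE : measurable_fun setT (fun p : R * R => om p.2) by exact: measurableT_comp.
have l1 := @summation_limit (fun _ p => om p.2) (fun p => om p.2) C (fun _ => mE) mE
  (fun _ p => omC p.2) (aeW _ (fun p _ => cvg_cst _)).
have ae1 : {ae mu, forall X, (fun _ : nat => om X) @ \oo --> om X}.
  by apply: aeW => X; exact: cvg_cst.
have l2 := initial_limit (fun _ => om) om C (fun _ => mom) mom (fun _ => omC) ae1.
have e j : \int[mu]_X (om X * psi j (0, X)) = - \int[mu2]_p (chi R p * (om p.2 * dq j p)).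
  rewrite -(@summation_by_parts (fun _ p => om p.2) C (fun _ => mE) (fun _ p => omC p.2))//.
  rewrite [X in X + _](_ : _ = 0) ?add0r//.
  rewrite (@eq_Rintegral _ _ _ mu2 setT (cst 0)) ?Rintegral_cst ?mul0r// => p _.
  by rewrite subrr !mul0r mulr0.
have l3 : \int[mu]_X (om X * psi j (0, X)) @[j --> \oo] -->
    - \int[mu2]_p (chi R p * (om p.2 * Lphi p)).
  rewrite (_ : (fun j => \int[mu]_X (om X * psi j (0, X))) =
    (fun j => - \int[mu2]_p (chi R p * (om p.2 * dq j p)))); first by apply: cvgN; exact: l1.
  by apply/funext => j; rewrite e.
by rewrite (cvg_unique _ l2 l3)// subrr.
Qed.

(** Taken at the new time because the entropy inequality is multiplied by [psi j] at the new time. A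
    label step [h j] moves the position by [h j] times the specific volume, whence the limit
    [dx phi] over the density. *)
Definition dqx j (p : R * R) : R :=
  (psi j (p.1 + lam * h j, p.2 + h j) - psi j (p.1 + lam * h j, p.2)) / h j.

Let rjP j p : eps <= rj j p <= 1. Proof. by case: ll. Qed.
Let rlP p : eps <= rl p <= 1. Proof. by case: ll. Qed.

Let rinv (r : R) := inv_bounds R eps r eps0.

Lemma dqxE j p : exists2 d : R, xj j (p.1 + lam * h j, p.2) <= d <=
    xj j (p.1 + lam * h j, p.2) + h j * (rj j (p.1 + lam * h j, p.2))^-1 &
  dqx j p = dx phi (Tj j (p.1 + lam * h j), d) * (rj j (p.1 + lam * h j, p.2))^-1.
Proof.
rewrite /dqx /psi/= (ll_space ll).
have /andP[i0 _] := rinv _ (rjP j (p.1 + lam * h j, p.2)).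
set y := xj _ _; set i := (rj _ _)^-1 in i0 *; set T := Tj _ _.
have yi : y <= y + h j * i by rewrite lerDl mulr_ge0// ltW.
have [d hd ed] := is_derive_MVT R (fun z => phi (T, z)) _ y (y + h j * i)
  (fun z => is_derive_dx R phi T z tphi) yi.
exists d => //; rewrite ed.
have h0' := h0 j; move: (dx _ _) => u.
by field; rewrite gt_eqF.
Qed.

Lemma dqx_le j p : `|dqx j p| <= M * eps^-1.
Proof.
have [d _ ->] := dqxE j p; have [_ _ h3] := phiM (Tj j (p.1 + lam * h j), d).
have /andP[i0 i1] := rinv _ (rjP j (p.1 + lam * h j, p.2)).
by rewrite normrM (ger0_norm i0); apply: ler_pM.
Qed.

Lemma dqx_box j p : 0 <= p.1 -> ~ box R support_radius p -> dqx j p = 0.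
Proof.
move=> p0 nb; rewrite /dqx psi_boxD// (psi_box _ _ _ _ p0) ?subrr ?mul0r//.
- by rewrite ltW//=.
- by rewrite ltW//=.
Qed.

Lemma measurable_psiS j : measurable_fun setT (fun p : R * R => psi j (p.1 + lam * h j, p.2)).
Proof.
have := measurable_shift R _ (lam * h j) 0 (measurable_psi j).
by under eq_fun do rewrite addr0.
Qed.

Lemma measurable_dqx j : measurable_fun setT (dqx j).
Proof.
apply: measurable_funM => //; apply: measurable_funB; last exact: measurable_psiS.
exact: measurable_shift (measurable_psi j).
Qed.

Lemma xjS_cvg p : 0 <= p.1 -> xj j (p.1 + lam * h j, p.2) @[j --> \oo] --> x p.
Proof.
move=> p0; have cx := ll_cx ll.
apply: (@squeeze_cvgr _ _ _ _ (fun j => xj j p) (fun j => xj j p + lam * h j * cm)) => //.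
  apply: nearW => j; rewrite (ll_time ll)// -surjective_pairing.
  have /andP[v0 v1] := vjP j p.
  by rewrite lerDl lerD2l mulr_ge0 ?ler_wpM2l// ltW.
rewrite -[X in _ --> X]addr0 -[X in _ --> _ + X](mul0r cm).
by apply: cvgD => //; apply: cvgM => //; exact: cvg_cst.
Qed.

Lemma TjS_cvg t : 0 <= t -> Tj j (t + lam * h j) @[j --> \oo] --> t.
Proof.
move=> t0; have -> : (fun j => Tj j (t + lam * h j)) = (fun j => Tj j t + lam * h j).
  by apply/funext => j; rewrite Tj_shift.
by rewrite -[X in _ --> X]addr0; apply: cvgD => //; exact: Tj_cvg.
Qed.

Lemma dqx_cvg : {ae mu2, forall p, 0 <= p.1 ->
  dqx j p @[j --> \oo] --> dx phi (p.1, x p) * (rl p)^-1}.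
Proof.
have cr := ll_crS ll.
have [_ _ c2] := test_continuous R phi tphi.
apply: (ae_mono2 _ _ R _ _ _ _ _ cr cr) => p crp _ p0.
have /choice[d dP] : forall j, exists d : R, xj j (p.1 + lam * h j, p.2) <= d <=
    xj j (p.1 + lam * h j, p.2) + h j * (rj j (p.1 + lam * h j, p.2))^-1 /\
  dqx j p = dx phi (Tj j (p.1 + lam * h j), d) * (rj j (p.1 + lam * h j, p.2))^-1.
  by move=> j; have [d h1' h2'] := dqxE j p; exists d.
have ci : (rj j (p.1 + lam * h j, p.2))^-1 @[j --> \oo] --> (rl p)^-1.
  apply: cvgV; last exact: crp.
  by have /andP[a1 _] := rlP p; rewrite gt_eqF// (lt_le_trans eps0).
rewrite (_ : (fun j => dqx j p) = fun j => dx phi (Tj j (p.1 + lam * h j), d j) *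
  (rj j (p.1 + lam * h j, p.2))^-1); last by apply/funext => j; have [] := dP j.
apply: cvgM => //; apply: continuous_cvg_pair => //; first exact: TjS_cvg.
apply: (@squeeze_cvgr _ _ _ _ (fun j => xj j (p.1 + lam * h j, p.2))
  (fun j => xj j (p.1 + lam * h j, p.2) + h j * (rj j (p.1 + lam * h j, p.2))^-1)).
- by apply: nearW => j; have [] := dP j.
- exact: xjS_cvg.
- rewrite -[X in _ --> X]addr0 -[X in _ --> _ + X](mul0r (rl p)^-1).
  by apply: cvgD; [exact: xjS_cvg|exact: cvgM].
Qed.

Lemma cell_integral j (t : R) (i : int) : 0 <= t ->
  \int[mu]_X ((Num.floor (X / h j) == i)%:R / h j * psi j (t + lam * h j, X)) =
  psi j (t + lam * h j, i%:~R * h j).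
Proof.
move=> t0; set c := psi _ _.
have hj0 := h0 j.
have floor_i X : (Num.floor (X / h j) == i) = (X \in `[i%:~R * h j, i%:~R * h j + h j[).
  rewrite in_itv/= -ler_pdivlMr// -[X in _ + X]mul1r -mulrDl -ltr_pdivrMr//.
  apply/eqP/andP => [<-|[a1 a2]].
    have /andP[a1 a2] := floor_itv (X / h j); rewrite a1; split => //.
    by move: a2; rewrite intrD.
  by apply: Num.Theory.floor_def; rewrite a1 intrD.
transitivity (\int[mu]_X (c / h j * \1_(`[i%:~R * h j, i%:~R * h j + h j[%classic) X)).
  apply: eq_Rintegral => X _; rewrite indicE.
  have -> : (X \in `[i%:~R * h j, i%:~R * h j + h j[%classic) = (Num.floor (X / h j) == i).
    by rewrite floor_i; apply/idP/idP => [/set_mem|] // Xi; exact: mem_set.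
  have [e|] := eqVneq (Num.floor (X / h j)) i; last by rewrite !mul0r mulr0.
  rewrite mulr1 mul1r mulrC; congr (_ * _); rewrite /c /psi/=; congr (phi (_, _)).
  have [|-> _] // := ll_step ll j
    (t + lam * h j) (t + lam * h j) X (i%:~R * h j) erefl.
  by rewrite e mulfK ?gt_eqF// Num.Theory.intrKfloor.
rewrite RintegralZl//; last first.
  apply: (@bounded_support_integrable _ _ R mu `[i%:~R * h j, i%:~R * h j + h j]%classic 1) => //.
  - exact: segment_lty.
  - by move=> X _; rewrite indicE; case: (_ \in _); rewrite ?normr1 ?normr0.
  - move=> X nX; rewrite indicE memNset// => /= /itvP Xi; apply: nX.
    by rewrite /= in_itv/= !Xi.
rewrite /Rintegral integral_indicT// lebesgue_measure_itv/= lte_fin ltrDl hj0.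
by rewrite -EFinB/= addrAC subrr add0r divfK// gt_eqF.
Qed.

(** The normalised indicator of a cell within one mass step of [Dm] acts as an approximate Dirac
    mass. Since [psi j] is constant on cells, the integral in X is a nodal value, and the node is
    squeezed between the trajectories of [Dm - h j] and [Dm]. *)
Lemma cell_limit (Dm : R) (i_ : nat -> int) :
  (forall j, Dm - h j <= (i_ j)%:~R * h j <= Dm) ->
  \int[mu2]_p (chi R p * ((Num.floor (p.2 / h j) == i_ j)%:R / h j *
    psi j (p.1 + lam * h j, p.2))) @[j --> \oo] -->
  \int[mu]_(t in `[0, +oo[) phi (t, x (t, Dm)).
Proof.
move=> iP; have [c0 _ _] := test_continuous R phi tphi.
pose f j t := chi R (t, 0) * psi j (t + lam * h j, (i_ j)%:~R * h j).
pose g t := chi R (t, 0) * phi (t, x (t, Dm)).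
have -> : \int[mu]_(t in `[0, +oo[) phi (t, x (t, Dm)) = \int[mu]_t g t.
  rewrite Rintegral_mkcond; apply: eq_Rintegral => t _; rewrite patchE /g.
  have [t0|t0] := leP 0 t.
    by rewrite mem_set ?chiT ?mul1r//= in_itv/= t0.
  by rewrite memNset ?chiF ?mul0r//= in_itv/= leNgt t0.
have mI j : measurable_fun setT (fun p : R * R => (Num.floor (p.2 / h j) == i_ j)%:R : R).
  exact: (measurable_step R (fun _ i => (i == i_ j)%:R) _ _ ltr01 (h0 j)).
rewrite (_ : (fun j => _) = (fun j => \int[mu]_t f j t)); last first.
  apply/funext => j; rewrite bbs_fubini; last first.
    apply: (half_plane_bbs R _ (1 * `|(h j)^-1| * M) support_radius).
    - apply: measurable_funM; last exact: measurable_psiS.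
      exact: measurable_funM.
    - move=> p _; rewrite !normrM; apply: ler_pM => //; last exact: psi_le.
      apply: ler_pM => //; by case: (_ == _); rewrite ?normr1 ?normr0.
    - by move=> p p0 nb; rewrite psi_boxD// mulr0.
  apply: eq_Rintegral => t _; rewrite /f; have [t0|t0] := leP 0 t.
    rewrite [RHS]mulrC chiT// mulr1 -cell_integral//.
    by apply: eq_Rintegral => X _; rewrite chiT// mul1r.
  rewrite chiF// mul0r (@eq_Rintegral _ _ _ mu setT (cst 0)) ?Rintegral_cst ?mul0r// => X _.
  by rewrite chiF// mul0r.
have mc : measurable_fun setT (fun t : R => chi R (t, 0)).
  exact: (measurableT_comp (measurable_chi R) (pair2_measurable (0 : R))).
have cg t : 0 <= t -> psi j (t + lam * h j, (i_ j)%:~R * h j) @[j --> \oo] --> phi (t, x (t, Dm)).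
  move=> t0; apply: continuous_cvg_pair => //; first exact: TjS_cvg.
  have cx := xjS_cvg (t, Dm) t0; rewrite /= in cx.
  apply: (@squeeze_cvgr _ _ _ _ (fun j => xj j (t + lam * h j, Dm) - h j * eps^-1)
    (fun j => xj j (t + lam * h j, Dm))) => //.
    apply: nearW => j; have /andP[i1 i2] := iP j.
    have mono := ll_mono ll j (t + lam * h j).
    apply/andP; split; last exact: mono.
    apply: le_trans (mono _ _ i1).
    have := ll_space ll j (t + lam * h j) (Dm - h j).
    rewrite subrK => ->; rewrite lerBlDr lerD2l ler_pM2l//.
    by have /andP[_] := rinv _ (rjP j (t + lam * h j, Dm - h j)).
  rewrite -[X in _ --> X]subr0 -[X in _ --> _ - X](mul0r eps^-1).
  by apply: cvgB => //; apply: cvgM => //; exact: cvg_cst.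
have mf j : measurable_fun setT (f j).
  apply: measurable_funM => //.
  exact: (measurableT_comp (measurable_psiS j) (pair2_measurable ((i_ j)%:~R * h j))).
have cf t : f j t @[j --> \oo] --> g t.
  rewrite /f /g; have [t0|t0] := leP 0 t; last by rewrite chiF// mul0r;
    under eq_fun do rewrite mul0r; exact: cvg_cst.
  by rewrite chiT// mul1r; under eq_fun do rewrite mul1r; exact: cg.
apply: (@bounded_support_dct _ _ R mu `[- support_radius, support_radius]%classic M) => //.
- exact: segment_lty.
- by apply: (@measurable_fun_cvgr _ _ _ setT f) => // t _; exact: cf.
- move=> j t _; rewrite normrM -[leRHS]mul1r; apply: ler_pM => //; last exact: psi_le.
  exact: chi_le1.
- move=> j t nt; rewrite /f; have [t0|t0] := leP 0 t; last by rewrite chiF// mul0r.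
  rewrite (_ : psi _ _ = 0) ?mulr0//.
  have := psi_boxD j (t, (i_ j)%:~R * h j) t0; apply => /boxP[/= t1 _]; apply: nt.
  by rewrite /= in_itv/= -ler_norml.
- by apply: aeW.
Qed.

(** * The entropy inequality in the limit *)

Section entropy.
Hypothesis Wc : {ae mu, forall X : R, {for X, continuous W}}.
Hypothesis phi0 : forall p, half_plane p -> 0 <= phi p.
Variable k : R.
Hypothesis k01 : 0 <= k <= 1.

(** The Kruzhkov entropy per unit of mass. Its flux is [Qk] up to the factor - k, [Jk] is the
    production due to a change of parameter between neighbours, and [Q0] is the limit of [Qk]. *)
Definition Ek j (p : R * R) : R := `|1 - k / rj j p|.
Definition Qk j (p : R * R) : R := `|vj j p - V k (Wj j p.2)|.
Definition Jk j (X : R) : R := `|V k (Wj j (X + h j)) - V k (Wj j X)|.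
Definition Q0 (p : R * R) : R := `|V (rl p) (W p.2) - V k (W p.2)|.

Let mrj j : measurable_fun setT (rj j). Proof. by case: ll. Qed.

Let minv (f : R * R -> R) : measurable_fun setT f -> (forall p, eps <= f p <= 1) ->
  measurable_fun setT (fun p => (f p)^-1).
Proof.
by move=> mf f1; apply: (measurable_inv_ge _ _ R eps) => // p; have /andP[] := f1 p.
Qed.

Let mEk (f : R * R -> R) : measurable_fun setT f -> (forall p, eps <= f p <= 1) ->
  measurable_fun setT (fun p => `|1 - k / f p|).
Proof.
move=> mf f1; apply: measurableT_comp => //; apply: measurable_funB => //.
by apply: measurable_funM => //; exact: minv.
Qed.

Let mWj j : measurable_fun setT (fun p : R * R => Wj j p.2).
Proof.
have := measurable_step R (fun _ i => W (i%:~R * h j)) _ _ ltr01 (h0 j).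
by congr measurable_fun; apply/funext => p; rewrite (ll_W ll).
Qed.

Let mVk (w : R * R -> R) : measurable_fun setT w -> measurable_fun setT (fun p => V k (w p)).
Proof. by move=> mw; apply: (sp_meas sp (cst k) w). Qed.

Let Wj01 j X : 0 <= Wj j X <= 1.
Proof. by rewrite (ll_W ll). Qed.

Let Vk w : 0 <= w <= 1 -> 0 <= V k w <= Cv.
Proof. exact: (sp_bound sp). Qed.

Let mQk j : measurable_fun setT (Qk j).
Proof. by apply: measurableT_comp => //; apply: measurable_funB => //; exact: mVk. Qed.

Let mQkS j : measurable_fun setT (fun p : R * R => Qk j (p.1, p.2 + h j)).
Proof. by have := measurable_shift R _ 0 (h j) (mQk j); under eq_fun do rewrite addr0. Qed.

Let mJk j : measurable_fun setT (fun p : R * R => Jk j p.2).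
Proof.
rewrite /Jk; apply: (@measurableT_comp _ _ _ _ _ _ (@Num.norm R R)) => //.
apply: measurable_funB; apply: mVk => //.
exact: (measurable_shift R _ 0 (h j) (mWj j)).
Qed.

Let Ek_le j p : `|Ek j p| <= 1 + eps^-1.
Proof.
have /andP[i0 i1] := rinv _ (rjP j p); have /andP[k0 k1] := k01.
rewrite normr_id; apply: (le_trans (ler_normB _ _)); rewrite normr1 lerD2l.
by rewrite normrM (ger0_norm k0) (ger0_norm i0) -[leRHS]mul1r; apply: ler_pM.
Qed.

Let Qk_le j p : `|Qk j p| <= cm + Cv.
Proof.
rewrite normr_id; have /andP[v0 v1] := vjP j p; have /andP[w0 w1] := Vk _ (Wj01 j p.2).
by apply: (le_trans (ler_normB _ _)); rewrite !ger0_norm// lerD.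
Qed.

Let Jk_le j X : `|Jk j X| <= Cv + Cv.
Proof.
rewrite normr_id; have /andP[v0 v1] := Vk _ (Wj01 j (X + h j)).
have /andP[w0 w1] := Vk _ (Wj01 j X).
by apply: (le_trans (ler_normB _ _)); rewrite !ger0_norm// lerD.
Qed.

Let psi_ge0 j p : 0 <= p.1 -> 0 <= psi j p.
Proof.
move=> p0; apply: phi0; split => //=; rewrite in_itv/= andbT /Tj.
by rewrite mulr_ge0// ltW.
Qed.

(** Summation by parts in the label; [chi] is invariant under these shifts, so no boundary term
    appears. *)
Let space_shift j :
  \int[mu2]_p (chi R p * ((Qk j (p.1, p.2 + h j) - Qk j p) / h j *
                          psi j (p.1 + lam * h j, p.2))) =
  - \int[mu2]_p (chi R p * (Qk j (p.1, p.2 + h j) * dqx j p)).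
Proof.
pose Kf p := chi R p * (Qk j p * psi j (p.1 + lam * h j, p.2)).
have bK : bbs R Kf.
  apply: (half_plane_bbs R _ ((cm + Cv) * M) support_radius).
  - by apply: measurable_funM => //; exact: measurable_psiS.
  - by move=> p _; rewrite normrM; apply: ler_pM => //; exact: psi_le.
  - by move=> p p0 nb; rewrite psi_boxD// mulr0.
have bQ : bbs R (fun p => chi R p * (Qk j (p.1, p.2 + h j) * dqx j p)).
  apply: (half_plane_bbs R _ ((cm + Cv) * (M * eps^-1)) support_radius).
  - by apply: measurable_funM => //; exact: measurable_dqx.
  - by move=> p _; rewrite normrM; apply: ler_pM => //; exact: dqx_le.
  - by move=> p p0 nb; rewrite dqx_box// mulr0.
pose Ks p := Kf (p.1 + 0, p.2 + h j).
have bKs : bbs R Ks by exact: bbs_shift.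
have pw p : chi R p * ((Qk j (p.1, p.2 + h j) - Qk j p) / h j *
      psi j (p.1 + lam * h j, p.2)) =
    (h j)^-1 * (Ks p - Kf p) - chi R p * (Qk j (p.1, p.2 + h j) * dqx j p).
  have e : psi j (p.1 + lam * h j, p.2 + h j) =
      psi j (p.1 + lam * h j, p.2) + h j * dqx j p.
    by rewrite /dqx mulrCA divff ?gt_eqF// mulr1 [RHS]addrC subrK.
  have ec : chi R (p.1, p.2 + h j) = chi R p.
    by have [p0|p0] := leP 0 p.1; [rewrite !chiT|rewrite !chiF].
  rewrite /Ks /Kf/= !addr0 ec e; move: (chi R p) (psi j _) (dqx j p) (Qk j p) (Qk j _).
  by move=> a b c d f; field; rewrite gt_eqF.
under eq_Rintegral => p _ do rewrite pw.
have b1 : bbs R (fun p => Ks p - Kf p) by exact: bbsB.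
have b2 : bbs R (fun p => (h j)^-1 * (Ks p - Kf p)).
  by apply: (bbsMl R (cst (h j)^-1) _ `|(h j)^-1|).
rewrite bbs_intB// bbs_intZ// bbs_intB//.
by rewrite /Ks (bbs_int_shift R _ _ _ bK) subrr mulr0 add0r.
Qed.

Let discrete_entropy j :
  0 <= \int[mu2]_p (chi R p * (Ek j p * dq j p)) + \int[mu]_X (Ek j (0, X) * psi j (0, X))
       - k * \int[mu2]_p (chi R p * (Qk j (p.1, p.2 + h j) * dqx j p))
       + k * \int[mu2]_p (chi R p * (Jk j p.2 / h j * psi j (p.1 + lam * h j, p.2))).
Proof.
have E0 j' t X : 0 <= t -> t < lam * h j' -> Ek j' (t, X) = Ek j' (0, X).
  move=> t0 tD; rewrite /Ek.
  suff e : Num.truncn (t / (lam * h j')) = Num.truncn (0 / (lam * h j')).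
    by have [_ ->] := ll_step ll j' t 0 X X e erefl.
  rewrite mul0r; apply: Num.Theory.truncn_def; rewrite Num.Theory.truncn0.
  apply/andP; split; first by rewrite divr_ge0// ltW.
  by rewrite ltr_pdivrMr// mul1r.
have mE j' : measurable_fun setT (Ek j') by exact: mEk.
have sbp := summation_by_parts Ek (1 + eps^-1) mE Ek_le E0 j.
have /andP[k0 k1] := k01.
pose F1 p := (Ek j (p.1 + lam * h j, p.2) - Ek j p) / (lam * h j) *
             psi j (p.1 + lam * h j, p.2).
pose F2 p := (Qk j (p.1, p.2 + h j) - Qk j p) / h j * psi j (p.1 + lam * h j, p.2).
pose F3 p := Jk j p.2 / h j * psi j (p.1 + lam * h j, p.2).
have mEs : measurable_fun setT (fun p : R * R => Ek j (p.1 + lam * h j, p.2)).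
  by have := measurable_shift R _ (lam * h j) 0 (mE j); under eq_fun do rewrite addr0.
have b1 : bbs R (fun p => chi R p * F1 p).
  apply: (half_plane_bbs R _ (((1 + eps^-1) + (1 + eps^-1)) * `|(lam * h j)^-1| * M) support_radius).
  - apply: measurable_funM; last exact: measurable_psiS.
    by apply: measurable_funM => //; exact: measurable_funB.
  - move=> p _; rewrite /F1 !normrM; apply: ler_pM => //; last exact: psi_le.
    rewrite -normrM normrM; apply: ler_pM => //.
    by apply: (le_trans (ler_normB _ _)); rewrite lerD.
  - by move=> p p0 nb; rewrite /F1 psi_boxD// mulr0.
have b2 : bbs R (fun p => chi R p * F2 p).
  apply: (half_plane_bbs R _ (((cm + Cv) + (cm + Cv)) * `|(h j)^-1| * M) support_radius).
  - apply: measurable_funM; last exact: measurable_psiS.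
    by apply: measurable_funM => //; exact: measurable_funB.
  - move=> p _; rewrite /F2 !normrM; apply: ler_pM => //; last exact: psi_le.
    rewrite -normrM normrM; apply: ler_pM => //.
    by apply: (le_trans (ler_normB _ _)); rewrite lerD.
  - by move=> p p0 nb; rewrite /F2 psi_boxD// mulr0.
have b3 : bbs R (fun p => chi R p * F3 p).
  apply: (half_plane_bbs R _ ((Cv + Cv) * `|(h j)^-1| * M) support_radius).
  - apply: measurable_funM; last exact: measurable_psiS.
    exact: measurable_funM.
  - move=> p _; rewrite /F3 !normrM; apply: ler_pM => //; last exact: psi_le.
    by rewrite -normrM normrM; apply: ler_pM.
  - by move=> p p0 nb; rewrite /F3 psi_boxD// mulr0.
have pw p : chi R p * F1 p <= k * (chi R p * F2 p) + k * (chi R p * F3 p).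
  have [p0|p0] := leP 0 p.1; last by rewrite chiF// !mul0r !mulr0 addr0.
  rewrite chiT// !mul1r.
  have /= := ll_entropy ll j k p.1 p.2 k01 p0.
  rewrite -surjective_pairing /F1 /F2 /F3 -/(Ek j p) -/(Ek j (_, _)) -/(Jk j p.2).
  rewrite -/(Qk j p) -/(Qk j (p.1, p.2 + h j)).
  have pp : 0 <= psi j (p.1 + lam * h j, p.2) by apply: psi_ge0; rewrite /= addr_ge0// ltW.
  rewrite !mulrA -mulrDl => ineq; apply: ler_wpM2r => //.
  rewrite ler_pdivrMr// lerBlDl; apply: (le_trans ineq).
  move: (Ek j p) (Qk j p) (Qk j _) (Jk j _) => a b c d.
  have h0' := h0 j; have l0' := lam0; rewrite le_eqVlt; apply/orP; left; apply/eqP.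
  by field; rewrite gt_eqF.
have b23 : bbs R (fun p => k * (chi R p * F2 p) + k * (chi R p * F3 p)).
  by apply: bbsD; apply: (bbsMl R (cst k) _ 1) => // p; rewrite ger0_norm.
have := bbs_le R _ _ b1 b23 pw.
rewrite bbs_intD; [|by apply: (bbsMl R (cst k) _ 1) => // p; rewrite ger0_norm..].
rewrite !bbs_intZ// (space_shift j) -/F3.
move: sbp; rewrite -/F1; move: (\int[mu2]_p (chi R p * F1 p)) => I1.
move: (\int[mu2]_p _) (\int[mu]_X _) => I2 I3 e1.
move: (\int[mu2]_p _) (\int[mu2]_p _) => I4 I5 e2.
lra.
Qed.

(** The production terms concentrate at the jumps of [W] and are not assumed to converge: a
    convergent majorant [s] is enough, since only an inequality passes to the limit. *)
Lemma entropy_limit (r0 : R -> R) (s : nat -> R) (Jl : R) :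
  measurable_fun setT r0 ->
  (forall X, eps <= r0 X <= 1) -> {ae mu, forall X, rj j (0, X) @[j --> \oo] --> r0 X} ->
  (forall j, k * \int[mu2]_p (chi R p * (Jk j p.2 / h j * psi j (p.1 + lam * h j, p.2))) <= s j) ->
  s @ \oo --> Jl ->
  0 <= \int[mu2]_p (chi R p * (`|1 - k / rl p| * Lphi p
          - k * (Q0 p * (dx phi (p.1, x p) * (rl p)^-1))))
       + \int[mu]_X (`|1 - k / r0 X| * phi (0, xo X)) + Jl.
Proof.
move=> mr0 r01 cr0 Js cs.
have mrl : measurable_fun setT rl by case: ll.
have cEk (r_ : nat -> R) (r : R) : eps <= r <= 1 -> r_ @ \oo --> r ->
    `|1 - k / r_ j| @[j --> \oo] --> `|1 - k / r|.
  move=> /andP[r1 _] cr; apply: cvg_norm; apply: cvgB; first exact: cvg_cst.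
  by apply: cvgM; [exact: cvg_cst|apply: cvgV => //; rewrite gt_eqF// (lt_le_trans eps0)].
have cr := ll_cr ll.
have cE : {ae mu2, forall p, 0 <= p.1 -> Ek j p @[j --> \oo] --> `|1 - k / rl p|}.
  by apply: (ae_mono2 _ _ R _ _ _ _ _ cr cr) => p crp _ p0; apply: cEk => //; exact: crp.
have mE j' : measurable_fun setT (Ek j') by exact: mEk.
have mE' : measurable_fun setT (fun p : R * R => `|1 - k / rl p|) by exact: mEk.
have l1 := summation_limit Ek _ (1 + eps^-1) mE mE' Ek_le cE.
have l2 : \int[mu]_X (Ek j (0, X) * psi j (0, X)) @[j --> \oo] -->
    \int[mu]_X (`|1 - k / r0 X| * phi (0, xo X)).
  apply: (initial_limit (fun j X => Ek j (0, X)) _ (1 + eps^-1)).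
  - by move=> j; exact: (measurableT_comp (mE j) (pair1_measurable _)).
  - have m2 : measurable_fun setT (fun p : R * R => r0 p.2) by exact: measurableT_comp.
    have m3 := mEk _ m2 (fun p => r01 p.2).
    exact: (measurableT_comp m3 (pair1_measurable (0 : R))).
  - by move=> j X; exact: Ek_le.
  - by apply: ae_mono cr0 => X; exact: cEk.
have cW : {ae mu2, forall p : R * R, 0 <= p.1 -> Wj j (p.2 + h j) @[j --> \oo] --> W p.2}.
  apply: (ae_cvg_ysection R (fun j p => Wj j (p.2 + h j)) (fun p => W p.2)
    [set p | 0 <= p.1]).
  - rewrite (_ : [set p | 0 <= p.1] = `[0, +oo[%classic `*` setT); first exact: measurableX.
    by apply/seteqP; split => -[t X] /=; rewrite in_itv/= andbT; [split|case].
  - by move=> j; exact: (measurable_shift R _ 0 (h j) (mWj j)).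
  - exact: (measurableT_comp Wm).
  - apply: ae_mono Wc => X cWX; apply: aeW => t _ /=.
    rewrite (_ : (fun j => _) = fun j => W ((Num.floor (X / h j))%:~R * h j + h j)).
      apply: continuous_cvg => //; rewrite -[X in _ --> X]addr0; apply: cvgD => //.
      exact: floor_cvg.
    apply/funext => j; rewrite (ll_W ll) floorD1//.
    by rewrite intrD mulrDl mul1r.
have cvS := ll_cvS ll.
have cVk (w_ : nat -> R) (w : R) : (forall j, 0 <= w_ j <= 1) -> 0 <= w <= 1 -> w_ @ \oo --> w ->
    V k (w_ j) @[j --> \oo] --> V k w.
  move=> w1 w2 cw; apply/cvgrPdist_le => e e0.
  have Cv0 := sp_Cv sp.
  have C1 : 0 < Cv + 1 by rewrite ltr_wpDl.
  have eC : 0 < e / (Cv + 1) by rewrite divr_gt0.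
  have /cvgrPdist_le/(_ _ eC) := cw; apply: filterS => j hj.
  apply: (le_trans (sp_affine sp _ _ _ k01)).
  rewrite ler_pdivlMr// mulrC in hj; apply: le_trans hj.
  by rewrite ler_wpM2r// lerDl.
have cQ : {ae mu2, forall p, 0 <= p.1 -> Qk j (p.1, p.2 + h j) @[j --> \oo] --> Q0 p}.
  apply: (ae_mono2 _ _ R _ _ _ _ _ cW cvS) => p cWp cvp p0.
  apply: cvg_norm; apply: cvgB; first exact: cvp.
  by apply: cVk => //; exact: cWp.
have mQ0 : measurable_fun setT Q0.
  apply: measurableT_comp => //; apply: measurable_funB; first exact: measurable_V.
  by apply: mVk; exact: (measurableT_comp Wm).
have [_ _ c2] := test_continuous R phi tphi.
have mdx : measurable_fun setT (fun p : R * R => dx phi (p.1, x p) * (rl p)^-1).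
  by apply: measurable_funM; [exact: measurable_along|exact: minv].
have l3 : \int[mu2]_p (chi R p * (Qk j (p.1, p.2 + h j) * dqx j p)) @[j --> \oo] -->
    \int[mu2]_p (chi R p * (Q0 p * (dx phi (p.1, x p) * (rl p)^-1))).
  apply: (half_plane_dct R _ _ ((cm + Cv) * (M * eps^-1)) support_radius).
  - by move=> j; apply: measurable_funM => //; exact: measurable_dqx.
  - exact: measurable_funM.
  - by move=> j p _; rewrite normrM; apply: ler_pM => //; exact: dqx_le.
  - by move=> j p p0 nb; rewrite dqx_box// mulr0.
  - apply: (ae_mono2 _ _ R _ _ _ _ _ cQ dqx_cvg) => p a1 a2 p0.
    by apply: cvgM; [exact: a1|exact: a2].
have bE : bbs R (fun p => chi R p * (`|1 - k / rl p| * Lphi p)).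
  apply: (Lphi_bbs _ (1 + eps^-1) mE') => p; rewrite normr_id.
  have /andP[i0 i1] := rinv _ (rlP p); have /andP[k0 k1] := k01.
  apply: (le_trans (ler_normB _ _)); rewrite normr1 lerD2l.
  by rewrite normrM (ger0_norm k0) (ger0_norm i0) -[leRHS]mul1r; apply: ler_pM.
have bQ : bbs R (fun p => chi R p * (Q0 p * (dx phi (p.1, x p) * (rl p)^-1))).
  apply: (half_plane_bbs R _ ((Cv + Cv) * (M * eps^-1)) support_radius).
  - exact: measurable_funM.
  - move=> p _; rewrite normrM; apply: ler_pM => //.
      rewrite normr_id; have /andP[w0 w1] := Vk _ (W01 p.2).
      have /andP[ra rb] := rlP p.
      have r01' : 0 <= rl p <= 1 by rewrite rb (le_trans (ltW eps0)).
      have /andP[v0 v1] := sp_bound sp _ _ r01' (W01 p.2).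
      by apply: (le_trans (ler_normB _ _)); rewrite !ger0_norm// lerD.
    have /andP[i0 i1] := rinv _ (rlP p); rewrite normrM (ger0_norm i0).
    by have [_ _ d2] := phiM (p.1, x p); apply: ler_pM.
  - move=> p p0 nb; have [_ _ d2] := phiB _ (along_box p p0 nb).
    by rewrite d2 mul0r mulr0.
have e : \int[mu2]_p (chi R p * (`|1 - k / rl p| * Lphi p
      - k * (Q0 p * (dx phi (p.1, x p) * (rl p)^-1)))) =
    \int[mu2]_p (chi R p * (`|1 - k / rl p| * Lphi p)) -
    k * \int[mu2]_p (chi R p * (Q0 p * (dx phi (p.1, x p) * (rl p)^-1))).
  rewrite -bbs_intZ// -bbs_intB//; last first.
    by apply: (bbsMl R (cst k) _ `|k|).
  by apply: eq_Rintegral => p _; rewrite mulrBr; congr (_ - _); rewrite mulrCA.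
rewrite e [X in X + Jl]addrAC.
move: (\int[mu2]_p _) l1 (\int[mu]_X _) l2 (\int[mu2]_p _) l3 => I1 l1 I2 l2 I3 l3.
have c1 : \int[mu2]_p (chi R p * (Ek j p * dq j p)) + \int[mu]_X (Ek j (0, X) * psi j (0, X))
       - k * \int[mu2]_p (chi R p * (Qk j (p.1, p.2 + h j) * dqx j p)) + s j
    @[j --> \oo] --> I1 + I2 - k * I3 + Jl.
  apply: cvgD => //; apply: cvgB; first by apply: cvgD; [exact: l1|exact: l2].
  by apply: cvgM; [exact: cvg_cst|exact: l3].
have c0 : (fun _ : nat => 0 : R) @ \oo --> (0 : R) by exact: cvg_cst.
apply: (ler_cvg_to c0 c1); apply: nearW => j.
apply: (le_trans (discrete_entropy j)).
by rewrite lerD2l; exact: Js.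
Qed.

End entropy.

End limit_passage.

(** * Return to Eulerian coordinates *)

Section eulerian.
Context (R : realType).
Local Notation mu := (@lebesgue_measure R).
Local Notation mu2 := (mu \x mu)%E.
Variables (V : R -> R -> R) (eps cm : R).
Variables (W xo : R -> R) (lam : R) (h : nat -> R) (Wj : nat -> R -> R).
Variables (xj rj vj : nat -> R * R -> R) (x rl : R * R -> R).
Hypothesis ll : lagrangian_limit R V eps cm W xo lam h Wj xj rj vj x rl.
Hypothesis eps0 : 0 < eps.

Let h0 j : 0 < h j. Proof. by case: ll. Qed.
Let h1 j : h j <= 1. Proof. by case: ll. Qed.
Let ch : h @ \oo --> 0. Proof. by case: ll. Qed.

Let rinv (r : R) := inv_bounds R eps r eps0.

Let rjP j p : eps <= rj j p <= 1. Proof. by case: ll. Qed.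
Let rlP p : eps <= rl p <= 1. Proof. by case: ll. Qed.
Let mono j t X Y : X <= Y -> xj j (t, X) <= xj j (t, Y).
Proof. exact: (ll_mono ll). Qed.
Let space j t X : xj j (t, X + h j) = xj j (t, X) + h j * (rj j (t, X))^-1.
Proof. exact: (ll_space ll). Qed.

Let minv (f : R * R -> R) : measurable_fun setT f -> (forall p, eps <= f p <= 1) ->
  measurable_fun setT (fun p => (f p)^-1).
Proof.
by move=> mf f1; apply: (measurable_inv_ge _ _ R eps) => // p; have /andP[] := f1 p.
Qed.

Lemma measurable_rl_inv : measurable_fun setT (fun p => (rl p)^-1).
Proof. by apply: minv => //; case: ll. Qed.

Let seg_int (a b C : R) (g : R -> R) : measurable_fun setT g ->
  (forall X, a <= X <= b -> `|g X| <= C) ->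
  mu.-integrable setT (EFin \o (fun X => \1_(`]a, b]%classic) X * g X)).
Proof.
move=> mg gC; apply: (@bounded_support_integrable _ _ R mu `[a, b]%classic C) => //.
- exact: segment_lty.
- by apply: measurable_funM.
- move=> X /=; rewrite in_itv/= => Xi; rewrite normrM -[leRHS]mul1r; apply: ler_pM => //.
    by rewrite indicE; case: (_ \in _); rewrite ?normr1 ?normr0.
  exact: gC.
- move=> X nX; rewrite indicE memNset ?mul0r// => /= /itvP Xi; apply: nX.
  by rewrite /= in_itv/= !Xi.
Qed.

Let one_int (a b : R) : mu.-integrable setT (EFin \o (\1_(`]a, b]%classic) : R -> R)).
Proof.
apply: (@bounded_support_integrable _ _ R mu `[a, b]%classic 1) => //.
- exact: segment_lty.
- by move=> X _; rewrite indicE; case: (_ \in _); rewrite ?normr1 ?normr0.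
- move=> X nX; rewrite indicE memNset// => /= /itvP Xi; apply: nX.
  by rewrite /= in_itv/= !Xi.
Qed.

Let cell_average j t c : xj j (t, c) <=
  (h j)^-1 * \int[mu]_X (\1_(`]c, c + h j]%classic) X * xj j (t, X)) <=
  xj j (t, c) + h j * eps^-1.
Proof.
have mx : measurable_fun setT (fun X => xj j (t, X)).
  have m2 : measurable_fun setT (xj j) by case: ll.
  exact: (measurableT_comp m2 (pair1_measurable t)).
have hj := h0 j.
have up : xj j (t, c + h j) <= xj j (t, c) + h j * eps^-1.
  by rewrite space lerD2l ler_pM2l//; have /andP[] := rinv _ (rjP j (t, c)).
have ix := seg_int c (c + h j) (`|xj j (t, c)| + `|xj j (t, c + h j)|) _ mx.
have {}ix : mu.-integrable setT (EFin \o (fun X => \1_(`]c, c + h j]%classic) X * xj j (t, X))).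
  apply: ix => X /andP[X1 X2]; have := mono j t _ _ X1; have := mono j t _ _ X2.
  have := ler_norm (- xj j (t, c)); have := ler_norm (xj j (t, c + h j)).
  have := normr_ge0 (xj j (t, c)); have := normr_ge0 (xj j (t, c + h j)).
  by rewrite normrN ler_norml => *; apply/andP; split; lra.
have ic d : \int[mu]_X (\1_(`]c, c + h j]%classic) X * d) = h j * d.
  rewrite RintegralZr//.
  rewrite /Rintegral integral_indicT// lebesgue_measure_itv/= lte_fin ltrDl hj.
  by rewrite -EFinB/= addrAC subrr add0r.
have icst d : mu.-integrable setT (EFin \o (fun X => \1_(`]c, c + h j]%classic) X * d)).
  exact: (seg_int _ _ `|d| (cst d)).
have ind0 X (a b : R) : (X \in `]c, c + h j]%classic -> a <= b) ->
    \1_(`]c, c + h j]%classic) X * a <= \1_(`]c, c + h j]%classic) X * b :> R.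
  by move=> ab; rewrite indicE; case: (boolP (_ \in _)) => [/ab ?|_]; rewrite ?mul1r ?mul0r.
apply/andP; split.
  rewrite ler_pdivlMl// -ic; apply: le_Rintegral => // X _; apply: ind0.
  by move=> /set_mem/= /itvP Xi; apply: mono; rewrite Xi.
apply: le_trans up; rewrite ler_pdivrMl// -ic; apply: le_Rintegral => // X _; apply: ind0.
by move=> /set_mem/= /itvP Xi; apply: mono; rewrite Xi.
Qed.

(* Discretely, [tau_j(X) = (x_j(X + h) - x_j(X)) / h], so the integral of [tau_j]
   over ]a, b] is a difference of two averages of [x_j]. *)
Let discrete_volume j t a b : a <= b ->
  \int[mu]_X (\1_(`]a, b]%classic) X * (rj j (t, X))^-1) =
  (h j)^-1 * \int[mu]_X (\1_(`]b, b + h j]%classic) X * xj j (t, X)) -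
  (h j)^-1 * \int[mu]_X (\1_(`]a, a + h j]%classic) X * xj j (t, X)).
Proof.
move=> ab; have hj := h0 j; set F := fun X => xj j (t, X).
have mF : measurable_fun setT F.
  have m2 : measurable_fun setT (xj j) by case: ll.
  exact: (measurableT_comp m2 (pair1_measurable t)).
have FC : forall c d, exists C, forall X, c <= X <= d -> `|F X| <= C.
  move=> c d; exists (`|F c| + `|F d|) => X /andP[X1 X2].
  have := mono j t _ _ X1; have := mono j t _ _ X2; rewrite -/(F c) -/(F X) -/(F d).
  have := ler_norm (- F c); have := ler_norm (F d).
  have := normr_ge0 (F c); have := normr_ge0 (F d).
  by rewrite normrN ler_norml => *; apply/andP; split; lra.
have iF c d : mu.-integrable setT (EFin \o (fun X => \1_(`]c, d]%classic) X * F X)).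
  by have [C] := FC c d; exact: seg_int.
pose G (X : R) : R := \1_(`]a + h j, b + h j]%classic) X * F X.
have iG : mu.-integrable setT (EFin \o G) by exact: iF.
have mG : measurable_fun setT G by apply: measurable_funM.
have GE X : G (X + h j) = \1_(`]a, b]%classic) X * F (X + h j).
  rewrite /G; congr (_ * _); apply: eq_indic.
  by rewrite /= !in_itv/= ltrD2r lerD2r.
have mGs : measurable_fun setT (fun X : R => G (X + h j)).
  by apply: (measurableT_comp mG); exact: measurable_funD.
have iGs : mu.-integrable setT (EFin \o (fun X => G (X + h j))).
  have [C CP] := FC (a + h j) (b + h j).
  apply: (@bounded_support_integrable _ _ R mu `[a, b]%classic C) => //.
  - exact: segment_lty.
  - move=> X /=; rewrite in_itv/= => /andP[X1 X2]; rewrite GE normrM -[leRHS]mul1r.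
    apply: ler_pM => //; first by rewrite indicE; case: (_ \in _); rewrite ?normr1 ?normr0.
    by apply: CP; rewrite !lerD2r X1.
  - move=> X nX; rewrite GE indicE memNset ?mul0r// => /= /itvP Xi; apply: nX.
    by rewrite /= in_itv/= !Xi.
have sG : \int[mu]_X G (X + h j) = \int[mu]_X G X.
  by congr fine; exact: integral_shift.
transitivity ((h j)^-1 * (\int[mu]_X G (X + h j) - \int[mu]_X (\1_(`]a, b]%classic) X * F X))).
  rewrite -RintegralB// -RintegralZl//; last exact: (integrableB measurableT iGs (iF a b)).
  apply: eq_Rintegral => X _; rewrite GE -mulrBr mulrCA; congr (_ * _).
  by rewrite /F space addrAC subrr add0r mulrA mulVf ?gt_eqF// mul1r.
rewrite sG -mulrBr; congr (_ * _); apply/eqP; rewrite subr_eq addrAC eq_sym subr_eq; apply/eqP.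
rewrite -RintegralD// -RintegralD//; apply: eq_Rintegral => X _; rewrite /G -!mulrDl.
congr (_ * _).
have I c d : \1_(`]c, d]%classic) X = ((c < X) && (X <= d))%:R :> R.
  rewrite indicE (_ : (X \in _) = ((c < X) && (X <= d)))//.
  by apply/idP/idP => [/set_mem|Xi]; [|apply: mem_set]; rewrite /= in_itv.
rewrite !I.
have [aX|aX] := ltP a X; have [bX|bX] := ltP b X;
  have [ahX|ahX] := ltP (a + h j) X; have [bhX|bhX] := leP X (b + h j);
  have [Xb|Xb] := leP X b; have [Xah|Xah] := leP X (a + h j); rewrite /= ?addr0 ?add0r//; lra.
Qed.

(** Limit of [discrete_volume]: the cell averages of the positions tend to [x], and the integral of
    the volumes converges by dominated convergence at each time when the densities converge for
    almost every label. This is the integrated form of x_X = 1 / rho. *)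
Lemma volume : {ae mu, forall t, 0 <= t -> forall a b, a <= b ->
  (\int[mu]_(X in `]a, b]) ((rl (t, X))^-1)%:E = (x (t, b) - x (t, a))%:E)%E}.
Proof.
have cr := xsection_ae R _ (ll_cr ll).
apply: ae_mono cr => t ct t0 a b ab.
have mrl : measurable_fun setT (fun X => (rl (t, X))^-1).
  exact: (measurableT_comp measurable_rl_inv (pair1_measurable t)).
have mrj j : measurable_fun setT (fun X => (rj j (t, X))^-1).
  have m2 : measurable_fun setT (rj j) by case: ll.
  exact: (measurableT_comp (minv _ m2 (rjP j)) (pair1_measurable t)).
have mI : measurable_fun setT (\1_(`]a, b]%classic) : R -> R) by exact: measurable_indic.
have irl : mu.-integrable setT (EFin \o (fun X => \1_(`]a, b]%classic) X * (rl (t, X))^-1)).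
  apply: (seg_int _ _ eps^-1) => // X _.
  by have /andP[i0 i1] := rinv _ (rlP (t, X)); rewrite ger0_norm.
have l1 : \int[mu]_X (\1_(`]a, b]%classic) X * (rj j (t, X))^-1) @[j --> \oo] -->
    \int[mu]_X (\1_(`]a, b]%classic) X * (rl (t, X))^-1).
  apply: (@bounded_support_dct _ _ R mu `[a, b]%classic eps^-1) => //.
  - exact: segment_lty.
  - by move=> j; exact: (measurable_funM mI (mrj j)).
  - exact: (measurable_funM mI mrl).
  - move=> j X _; have /andP[i0 i1] := rinv _ (rjP j (t, X)).
    rewrite normrM -[leRHS]mul1r; apply: ler_pM => //; last by rewrite ger0_norm.
    by rewrite indicE; case: (_ \in _); rewrite ?normr1 ?normr0.
  - move=> j X nX; rewrite indicE memNset ?mul0r// => /= /itvP Xi; apply: nX.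
    by rewrite /= in_itv/= !Xi.
  - apply: ae_mono ct => X cX; apply: cvgM; first exact: cvg_cst.
    apply: cvgV; last exact: cX.
    by have /andP[a1 _] := rlP (t, X); rewrite gt_eqF// (lt_le_trans eps0).
have lc c : (h j)^-1 * \int[mu]_X (\1_(`]c, c + h j]%classic) X * xj j (t, X)) @[j --> \oo]
    --> x (t, c).
  have cx := ll_cx ll (t, c).
  apply: (@squeeze_cvgr _ _ _ _ (fun j => xj j (t, c)) (fun j => xj j (t, c) + h j * eps^-1)).
  - by apply: nearW => j; exact: cell_average.
  - exact: cx.
  - rewrite -[X in _ --> X]addr0 -[X in _ --> _ + X](mul0r eps^-1).
    by apply: cvgD => //; apply: cvgM => //; exact: cvg_cst.
have l2 : \int[mu]_X (\1_(`]a, b]%classic) X * (rj j (t, X))^-1) @[j --> \oo] -->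
    x (t, b) - x (t, a).
  rewrite (_ : (fun j => _) = (fun j =>
    (h j)^-1 * \int[mu]_X (\1_(`]b, b + h j]%classic) X * xj j (t, X)) -
    (h j)^-1 * \int[mu]_X (\1_(`]a, a + h j]%classic) X * xj j (t, X)))).
    by apply: cvgB; exact: lc.
  by apply/funext => j; rewrite discrete_volume.
rewrite -(cvg_unique _ l1 l2)// /Rintegral fineK; last exact: integrable_fin_num.
rewrite [LHS]integral_mkcond; apply: eq_integral => X _; rewrite patchE indicE.
by case: (X \in _); rewrite ?mul1r ?mul0r.
Qed.

(** [N] assigns to a point the label of the particle located there. As [x] has slope at least 1 in X
    and is [cm]-Lipschitz in time, [|N (t, y) - N (s, z)| <= |y - z| + cm * |t - s|], hence joint
    continuity. *)
Lemma lagrangian_inverse : exists N : R * R -> R,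
  [/\ forall t X, N (t, x (t, X)) = X, forall t y, x (t, N (t, y)) = y,
      forall t y z, (N (t, y) <= N (t, z)) = (y <= z) & continuous N].
Proof.
have sl := ll_space_lim ll.
have tl := ll_time_lim ll.
have /choice[N NP] : forall t, exists g : R -> R,
    [/\ cancel (fun X => x (t, X)) g, cancel g (fun X => x (t, X)) &
        {mono (fun X => x (t, X)) : X Y / X <= Y}].
  move=> t; have [X Y XY|g [g1 g2 g3 _]] := bilip_inverse R (fun X => x (t, X)) 1 eps^-1 ltr01.
    by rewrite mul1r mulrC; exact: sl.
  by exists g.
exists (fun p => N p.1 p.2); split => /=.
- by move=> t X; have [] := NP t.
- by move=> t y; have [] := NP t.
- by move=> t y z; have [g1 g2 g3] := NP t; rewrite -g3 !g2.
have lip t s y z : `|N t y - N s z| <= `|y - z| + cm * `|t - s|.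
  have [_ gt _] := NP t; have [_ gs _] := NP s.
  have e1 X Y : `|X - Y| <= `|x (t, X) - x (t, Y)|.
    wlog XY : X Y / X <= Y.
      move=> H; have [|/ltW] := leP X Y; first exact: H.
      by rewrite distrC (distrC (x (t, X))); exact: H.
    have /andP[a1 _] := sl t _ _ XY.
    rewrite distrC (distrC (x (t, X))) (ger0_norm (_ : 0 <= Y - X)) ?subr_ge0//.
    exact: le_trans a1 (ler_norm _).
  have e2 X : `|x (s, X) - x (t, X)| <= cm * `|t - s|.
    have [ts|/ltW st] := leP t s.
      by have /andP[a1 a2] := tl _ _ X ts; rewrite ger0_norm// distrC (ger0_norm (_ : 0 <= s - t)) ?subr_ge0.
    by have /andP[a1 a2] := tl _ _ X st; rewrite distrC ger0_norm// (ger0_norm (_ : 0 <= t - s)) ?subr_ge0.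
  apply: (le_trans (e1 _ _)); rewrite gt -[X in _ - x (t, X)]/(N s z).
  apply: (le_trans (ler_distD z _ _)); rewrite lerD2l -{1}(gs z); exact: e2.
have cm0 : 0 <= cm by case: ll.
move=> [t y]; apply/cvgrPdist_lt => e e0.
pose d := e / 2 / (1 + cm).
have c1 : 0 < 1 + cm by rewrite ltr_pwDl.
have d0 : 0 < d by rewrite !divr_gt0.
exists (ball t d, ball y d) => [|[s z] [/= b1 b2]].
  by split; exact: nbhsx_ballx.
rewrite /ball/= in b1 b2; apply: (le_lt_trans (lip _ _ _ _)).
have b3 : cm * `|t - s| <= cm * d by rewrite ler_wpM2l// ltW.
have b4 : d * (1 + cm) = e / 2 by rewrite /d divfK// gt_eqF.
by move: b2 b3 b4; rewrite mulrDr mulr1 (mulrC d) => *; lra.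
Qed.

(** On almost every time slice [volume] makes [(rl p)^-1] the Jacobian of the change of variables y
    = x(t, X); Fubini's theorem assembles the slices. *)
Lemma euler (F : R * R -> R) (M B : R) : measurable_fun setT F -> 0 <= B ->
  (forall p, 0 <= p.1 -> `|F p| <= M) -> (forall p, 0 <= p.1 -> ~ box R B p -> F p = 0) ->
  int_half_plane F = \int[mu2]_p (chi R p * (F (p.1, x p) * (rl p)^-1)).
Proof.
move=> mF B0 FM F0.
have mx : measurable_fun setT x := measurable_x R V eps cm W xo lam h Wj xj rj vj x rl ll.
have mFx : measurable_fun setT (fun p : R * R => F (p.1, x p)).
  by apply: (measurableT_comp mF); exact: measurable_fun_pair.
have bF : bbs R (fun p => chi R p * F p) by exact: half_plane_bbs FM F0.
have bH : bbs R (fun p => chi R p * (F (p.1, x p) * (rl p)^-1)).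
  apply: (half_plane_bbs R _ (M * eps^-1) (support_radius R cm xo lam B)).
  - by apply: measurable_funM => //; exact: measurable_rl_inv.
  - move=> p p0; have /andP[i0 i1] := rinv _ (rlP p).
    by rewrite normrM (ger0_norm i0); apply: ler_pM => //; exact: FM.
  - move=> p p0 nb; rewrite F0 ?mul0r//.
    exact: (along_box R V eps cm W xo lam h Wj xj rj vj x rl ll B B0 p p0 nb).
have -> : int_half_plane F = \int[mu2]_p (chi R p * F p).
  rewrite bbs_fubini// /int_half_plane Rintegral_mkcond; apply: eq_Rintegral => t _.
  rewrite patchE; have [t0|t0] := leP 0 t.
    rewrite mem_set/= ?in_itv/= ?t0//; apply: eq_Rintegral => X _.
    by rewrite chiT// mul1r.
  rewrite memNset/= ?in_itv/= ?leNgt ?t0//.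
  rewrite (@eq_Rintegral _ _ _ mu setT (cst 0)) ?Rintegral_cst ?mul0r// => X _.
  by rewrite chiF// mul0r.
congr fine; rewrite !Rintegral_fubini; [|exact: bbs_integrable..].
have [N [N1 N2 N3 _]] := lagrangian_inverse.
apply: ae_eq_integral => //.
- exact: (@measurable_fubini_F _ _ _ _ R mu mu _ (bbs_integrable R _ bF)).
- exact: (@measurable_fubini_F _ _ _ _ R mu mu _ (bbs_integrable R _ bH)).
- apply: ae_mono volume => t vt _; have [t0|t0] := leP 0 t; last first.
    by apply: eq_integral => X _; rewrite !chiF// !mul0r.
  have mFt : measurable_fun setT (fun y => F (t, y)).
    exact: (measurableT_comp mF (pair1_measurable t)).
  transitivity (\int[mu]_y (F (t, y))%:E)%E.
    by apply: eq_integral => X _; rewrite chiT// mul1r.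
  have xy : cancel (fun y => N (t, y)) (fun X => x (t, X)) by move=> y; exact: N2.
  have xm : {mono (fun X => x (t, X)) : X Y / X <= Y} by move=> X Y; rewrite -(N3 t) !N1.
  have mt := measurableT_comp measurable_rl_inv (pair1_measurable t).
  have r0 X : 0 <= (rl (t, X))^-1 by have /andP[] := rinv _ (rlP (t, X)).
  have := homeo_integral R _ _ _ xy xm mt r0 (vt t0) _ mFt.
  by move=> ->; apply: eq_integral => X _; rewrite chiT// mul1r.
Qed.

End eulerian.

(** * Initial data *)

Section initial_data.
Context (R : realType).
Local Notation mu := (@lebesgue_measure R).
Variables (rho : R -> R) (eps : R).
Hypothesis eps0 : 0 < eps.
Hypothesis mrho : measurable_fun setT rho.
Hypothesis rhoP : forall y, eps <= rho y <= 1.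

Let one_seg (a b : R) : mu.-integrable setT (EFin \o (fun y => \1_(`]a, b]%classic) y * rho y)).
Proof.
apply: (@bounded_support_integrable _ _ R mu `[a, b]%classic 1) => //.
- exact: segment_lty.
- by apply: measurable_funM.
- move=> y _; have /andP[r0 r1] := rhoP y; rewrite normrM -[leRHS]mul1r.
  apply: ler_pM => //; first by rewrite indicE; case: (_ \in _); rewrite ?normr1 ?normr0.
  by rewrite ger0_norm// (le_trans (ltW eps0)).
- move=> y ny; rewrite indicE memNset ?mul0r// => /= /itvP yi; apply: ny.
  by rewrite /= in_itv/= !yi.
Qed.

Let seg_mass (a b : R) := \int[mu]_y (\1_(`]a, b]%classic) y * rho y).

Let seg_massE a b : (\int[mu]_(y in `]a, b]) (rho y)%:E = (seg_mass a b)%:E)%E.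
Proof.
rewrite /seg_mass /Rintegral fineK; last exact: (integrable_fin_num measurableT (one_seg a b)).
rewrite [LHS]integral_mkcond; apply: eq_integral => y _; rewrite patchE indicE.
by case: (y \in _); rewrite ?mul1r ?mul0r.
Qed.

(** The signed mass between 0 and [y]: one of the intervals ]0, y] and ]y, 0] is always empty. *)
Let mass (y : R) := seg_mass 0 y - seg_mass y 0.

Let massB a b : a <= b -> mass b - mass a = seg_mass a b.
Proof.
move=> ab; rewrite /mass; apply/eqP; rewrite subr_eq; apply/eqP.
suff : seg_mass 0 b + seg_mass a 0 = seg_mass a b + seg_mass 0 a + seg_mass b 0 by lra.
rewrite /seg_mass -!RintegralD//; last exact: (integrableD measurableT (one_seg a b) (one_seg 0 a)).
apply: eq_Rintegral => y _; rewrite -!mulrDl; congr (_ * _).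
have I c d : \1_(`]c, d]%classic) y = ((c < y) && (y <= d))%:R :> R.
  rewrite indicE (_ : (y \in _) = ((c < y) && (y <= d)))//.
  by apply/idP/idP => [/set_mem|Xi]; [|apply: mem_set]; rewrite /= in_itv.
rewrite !I.
have [ay|ay] := ltP a y; have [by'|by'] := ltP b y; have [y0|y0] := ltP 0 y;
  have [yb|yb] := leP y b; have [ya|ya] := leP y a; have [y0'|y0'] := leP y 0;
  rewrite /= ?addr0 ?add0r//; lra.
Qed.

(** A density between [eps] and 1 makes the mass function bi-Lipschitz. The mass is the label [No]
    of a position, its inverse [xo] the initial position of a label, and the density is the Jacobian
    between the two. *)
Lemma initial_homeo : exists xo No : R -> R,
  [/\ cancel xo No, cancel No xo, {mono No : y z / y <= z},
      forall X Y, X <= Y -> Y - X <= xo Y - xo X <= (Y - X) / eps &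
      forall F : R -> R, measurable_fun setT F ->
        (\int[mu]_X (F X)%:E = \int[mu]_y (F (No y) * rho y)%:E)%E].
Proof.
have sb a b : a <= b -> eps * (b - a) <= mass b - mass a <= 1 * (b - a).
  move=> ab; rewrite massB//.
  have ic d : \int[mu]_y (\1_(`]a, b]%classic) y * d) = d * (b - a).
    rewrite RintegralZr//; last first.
      apply: (@bounded_support_integrable _ _ R mu `[a, b]%classic 1) => //.
      - exact: segment_lty.
      - by move=> X _; rewrite indicE; case: (_ \in _); rewrite ?normr1 ?normr0.
      - move=> X nX; rewrite indicE memNset// => /= /itvP Xi; apply: nX.
        by rewrite /= in_itv/= !Xi.
    rewrite /Rintegral integral_indicT// lebesgue_measure_itv/= lte_fin mulrC.
    case: ltP => [_|ba]; first by rewrite -EFinB.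
    by rewrite (le_anti (_ : a <= b <= a)) ?subrr// ab.
  have icst d : mu.-integrable setT (EFin \o (fun y => \1_(`]a, b]%classic) y * d)).
    apply: (@bounded_support_integrable _ _ R mu `[a, b]%classic `|d|) => //.
    - exact: segment_lty.
    - by apply: measurable_funM.
    - move=> X _; rewrite normrM -[leRHS]mul1r; apply: ler_pM => //.
      by rewrite indicE; case: (_ \in _); rewrite ?normr1 ?normr0.
    - move=> X nX; rewrite indicE memNset ?mul0r// => /= /itvP Xi; apply: nX.
      by rewrite /= in_itv/= !Xi.
  rewrite -!ic; apply/andP; split; apply: le_Rintegral => // y _;
    have /andP[r0 r1] := rhoP y; by rewrite ler_wpM2l.
have [xo [c1 c2 c3 c4]] := bilip_inverse R mass eps 1 eps0 sb.
exists xo, mass; split => //.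
  by move=> X Y XY; have := c4 X Y XY; rewrite divr1.
move=> F mF; apply: (homeo_integral R mass xo rho) => //.
- by move=> y; have /andP[r0 _] := rhoP y; rewrite (le_trans (ltW eps0)).
- by move=> a b ab; rewrite seg_massE massB.
Qed.

(** * Initial densities of the cells *)

Section cell_density.
Variables (xo No : R -> R).
Hypothesis xoK : cancel xo No.
Hypothesis NoK : cancel No xo.
Hypothesis No_mono : {mono No : y z / y <= z}.
Hypothesis xo_cont : continuous xo.
Hypothesis No_int : forall F : R -> R, measurable_fun setT F ->
  (\int[mu]_X (F X)%:E = \int[mu]_y (F (No y) * rho y)%:E)%E.
Variable h : nat -> R.
Hypothesis h0 : forall j, 0 < h j.
Hypothesis ch : h @ \oo --> 0.

Let tau0 X := (rho (xo X))^-1.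

Let rinv (r : R) := inv_bounds R eps r eps0.

Lemma measurable_rho_xo : measurable_fun setT (rho \o xo).
Proof. by apply: (measurableT_comp mrho); exact: continuous_measurable_fun. Qed.

Let mtau0 : measurable_fun setT tau0.
Proof.
apply: (measurable_inv_ge _ _ R eps) => //; last exact: measurable_rho_xo.
by move=> X; have /andP[] := rhoP (xo X).
Qed.

Let xo_mono X Y : (xo X <= xo Y) = (X <= Y).
Proof. by rewrite -No_mono !xoK. Qed.

Let tau0_mass a b : a <= b ->
  (\int[mu]_(X in `]a, b]) (tau0 X)%:E = (xo b - xo a)%:E)%E.
Proof.
move=> ab; have mI : measurable_fun setT (\1_(`]a, b]%classic) : R -> R) by exact: measurable_indic.
transitivity (\int[mu]_X (\1_(`]a, b]%classic) X * tau0 X)%:E)%E.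
  rewrite [LHS]integral_mkcond; apply: eq_integral => X _; rewrite patchE indicE.
  by case: (X \in _); rewrite ?mul1r ?mul0r.
rewrite No_int; last exact: (measurable_funM mI mtau0).
transitivity (\int[mu]_y (\1_(`]xo a, xo b]%classic) y)%:E)%E.
  apply: eq_integral => y _; rewrite /tau0 NoK -mulrA mulVf; last first.
    by have /andP[r0 _] := rhoP y; rewrite gt_eqF// (lt_le_trans eps0).
  rewrite mulr1; congr (_%:E); apply: eq_indic.
  have e1 : (a < No y) = (xo a < y) by rewrite !ltNge -xo_mono NoK.
  have e2 : (No y <= b) = (y <= xo b) by rewrite -xo_mono NoK.
  by rewrite /= !in_itv/= e1 e2.
rewrite integral_indicT// lebesgue_measure_itv/= lte_fin.
case: ltP => [_|ba]; first by rewrite -EFinB.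
by rewrite (le_anti (_ : xo a <= xo b <= xo a)) ?subrr// xo_mono ab.
Qed.

(** The quotient is the mean of the initial specific volume over the cell containing X, so its limit
    is given by Lebesgue differentiation; the cells need not be centred at X, hence nicely shrinking
    sets. *)
Lemma cell_density_cvg : {ae mu, forall X : R,
  (xo ((Num.floor (X / h j))%:~R * h j + h j) - xo ((Num.floor (X / h j))%:~R * h j)) / h j
    @[j --> \oo] --> tau0 X}.
Proof.
pose nd j X := (Num.floor (X / h j))%:~R * h j.
pose E X j : set R := `]nd j X, nd j X + h j]%classic.
have hE X : nicely_shrinking X (E X).
  split; first by move=> j; exact: measurable_itv.
  have r2 j : 0 < 2 * h j by rewrite mulr_gt0.
  (* The cell has length [h j] and lies in the ball of radius [2 * h j] around [X], whose measure is
     four times that of the cell. *)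
  exists (4, fun j => PosNum (r2 j)); split => //=.
  - by rewrite -(mulr0 2); apply: cvgM => //; exact: cvg_cst.
  - move=> j y; rewrite /E /= in_itv/= /ball/= => /andP[y1 y2].
    have /andP[a1 a2] := floor_approx R (h j) X (h0 j); have hj := h0 j.
    by rewrite ltr_norml; apply/andP; split; rewrite /nd in y1 y2; lra.
  - move=> j; have hj := h0 j; rewrite (lebesgue_measure_ball _ (ltW (r2 j))) lebesgue_measure_itv/=.
    rewrite lte_fin ltrDl hj -EFinB -EFinM lee_fin mulr2n; lra.
have loc : locally_integrable setT tau0.
  split => //; first exact: openT.
  move=> K _ cK; have mK := compact_measurable cK.
  apply: (@le_lt_trans _ _ (\int[mu]_(y in K) (cst (eps^-1)%:E y)))%E.
    apply: ge0_le_integral => //.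
    - by apply/measurable_EFinP; apply: measurable_funTS; exact: measurableT_comp.
    - by move=> y _; rewrite lee_fin; have /andP[i0 i1] := rinv _ (rhoP (xo y)); rewrite ger0_norm.
  rewrite integral_cst// lte_mul_pinfty// ?lee_fin ?invr_ge0 ?(ltW eps0)//.
  exact: compact_finite_measure.
apply: ae_mono (lebesgue_differentiation loc) => X lX.
have := nice_lebesgue_differentiation hE loc lX.
rewrite (_ : (fun n => _) = (fun j => (((xo (nd j X + h j) - xo (nd j X)) / h j)%:E)))%E.
  by move=> /fine_cvg.
apply/funext => j; have hj := h0 j.
rewrite tau0_mass; last by rewrite lerDl ltW.
rewrite lebesgue_measure_itv/= lte_fin ltrDl hj/= -EFinB addrAC subrr add0r.
by rewrite inver gt_eqF// -EFinM mulrC.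
Qed.

End cell_density.
End initial_data.

(** * The Eulerian solution *)

Section solution.
Context (R : realType).
Local Notation mu := (@lebesgue_measure R).
Local Notation mu2 := (mu \x mu)%E.
Variables (V : R -> R -> R) (eps cm A kap al L Cv : R).
Hypothesis sp : speed_spec R V eps cm A kap al L Cv.
Variables (W xo No rho0 : R -> R) (lam : R) (h : nat -> R) (Wj : nat -> R -> R).
Variables (xj rj vj : nat -> R * R -> R) (x rl : R * R -> R).
Hypothesis ll : lagrangian_limit R V eps cm W xo lam h Wj xj rj vj x rl.
Hypothesis W01 : forall X, 0 <= W X <= 1.
Hypothesis Wm : measurable_fun setT W.
Hypothesis mrho0 : measurable_fun setT rho0.
Hypothesis rho0P : forall y, eps <= rho0 y <= 1.
Hypothesis NoK : cancel No xo.
Hypothesis xo_cont : continuous xo.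
Hypothesis No_int : forall F : R -> R, measurable_fun setT F ->
  (\int[mu]_X (F X)%:E = \int[mu]_y (F (No y) * rho0 y)%:E)%E.
Variable N : R * R -> R.
Hypothesis N1 : forall t X, N (t, x (t, X)) = X.
Hypothesis N_cont : continuous N.

Let eps0 : 0 < eps. Proof. by case/andP: (sp_eps sp). Qed.
Let rlP p : eps <= rl p <= 1. Proof. by case: ll. Qed.
Let rl0 p : 0 < rl p. Proof. by have /andP[h1 _] := rlP p; exact: lt_le_trans h1. Qed.

Definition eul_rho (p : R * R) : R := rl (p.1, N p).
Definition eul_w (p : R * R) : R := W (N p).

Let mN : measurable_fun setT N. Proof. exact: continuous_measurable2. Qed.

Lemma measurable_eul_rho : measurable_fun setT eul_rho.
Proof.
have mrl : measurable_fun setT rl by case: ll.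
by apply: (measurableT_comp mrl); exact: measurable_fun_pair.
Qed.

Lemma measurable_eul_w : measurable_fun setT eul_w.
Proof. exact: measurableT_comp. Qed.

Let r01 p : 0 <= eul_rho p <= 1.
Proof. by have /andP[h1 ->] := rlP (p.1, N p); rewrite (le_trans (ltW eps0)). Qed.

Let mV : measurable_fun setT (fun p => V (eul_rho p) (eul_w p)).
Proof.
apply: (sp_meas sp) => //; first exact: measurable_eul_rho.
exact: measurable_eul_w.
Qed.

Let Vb p w : 0 <= w <= 1 -> `|eul_rho p * V (eul_rho p) w| <= Cv.
Proof.
move=> w1; have /andP[r0 r1] := r01 p.
have /andP[v0 v1] := sp_bound sp _ _ (r01 p) w1.
by rewrite ger0_norm ?mulr_ge0// -[leRHS]mul1r; apply: ler_pM.
Qed.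

Let mtest (g : R * R -> R) : continuous g -> measurable_fun setT g.
Proof. exact: continuous_measurable2. Qed.

Lemma weak_euler (om : R -> R) (C : R) (phi : R * R -> R) : measurable_fun setT om ->
  (forall X, `|om X| <= C) -> test_half_plane phi ->
  int_half_plane (fun p => eul_rho p * om (N p) * dt phi p +
     eul_rho p * V (eul_rho p) (eul_w p) * om (N p) * dx phi p)
  + \int[mu]_y (rho0 y * om (No y) * phi (0, y)) = 0.
Proof.
move=> mom omC tphi; have [M [B [M0 B0 phiM phiB]]] := test_bounds R phi tphi.
have [c0 c1 c2] := test_continuous R phi tphi.
have momN : measurable_fun setT (fun p => om (N p)) by exact: measurableT_comp.
have wl := weak_limit R V eps cm A kap al L Cv sp W xo lam h Wj xj rj vj x rl ll Wm phi M B
  tphi M0 B0 phiM phiB om C mom omC.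
rewrite -[RHS]wl; congr (_ + _).
  rewrite (euler R V eps cm W xo lam h Wj xj rj vj x rl ll eps0 _ (C * M + Cv * C * M) B)//.
  - apply: eq_Rintegral => -[t X] _; congr (_ * _); rewrite /eul_rho /eul_w /Lphi/= !N1.
    have := rl0 (t, X); move: (rl _) (V _ _) (om _) (dt _ _) (dx _ _) => a b c d e a0.
    by field; rewrite gt_eqF.
  - have mr := measurable_eul_rho.
    apply: measurable_funD.
      apply: measurable_funM; last exact: mtest.
      exact: measurable_funM.
    apply: measurable_funM; last exact: mtest.
    by apply: measurable_funM => //; exact: measurable_funM.
  - move=> p _; have [_ d1 d2] := phiM p; apply: (le_trans (ler_normD _ _)); apply: lerD.
      rewrite !normrM; apply: ler_pM => //; rewrite -[leRHS]mul1r; apply: ler_pM => //.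
      by have /andP[r0 r1] := r01 p; rewrite ger0_norm.
    rewrite normrM; apply: ler_pM => //; rewrite normrM; apply: ler_pM => //.
    by apply: Vb; exact: W01.
  - by move=> p _ nb; have [_ -> ->] := phiB p nb; rewrite !mulr0 addr0.
have mF : measurable_fun setT (fun X => om X * phi (0, xo X)).
  apply: measurable_funM => //.
  have m1 := measurableT_comp (mtest _ c0) (pair1_measurable (0 : R)).
  exact: (measurableT_comp m1 (continuous_measurable_fun xo_cont)).
rewrite /Rintegral (No_int _ mF); congr fine; apply: eq_integral => y _.
by rewrite /= NoK; congr (_%:E); ring.
Qed.

(** As the speed decreases in the density, sgn(r - k) (V r - V k) = - |V r - V k|. The Kruzhkov flux
    is therefore transport of |r - k| at speed V r minus k |V r - V k|, and division by [r], the
    Jacobian, gives the Lagrangian entropy and flux. *)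
Lemma kruzhkov_lagrangian (k r w d e : R) : 0 <= k <= 1 -> eps <= r <= 1 -> 0 <= w <= 1 ->
  (`|r - k| * d + Num.sg (r - k) * (r * V r w - k * V k w) * e) * r^-1 =
  `|1 - k / r| * (d + e * V r w) - k * (`|V r w - V k w| * (e * r^-1)).
Proof.
move=> /andP[k0 k1] /andP[r0 r1] w1; have rp : 0 < r := lt_le_trans eps0 r0.
have -> : 1 - k / r = (r - k) / r by field; rewrite gt_eqF.
rewrite normrM [`|r^-1|]ger0_norm ?invr_ge0 ?ltW//.
have dec := sp_decr sp _ _ _ w1.
have [rk|kr|->] := ltgtP r k.
- have V0 : 0 <= V r w - V k w by rewrite subr_ge0 dec// ltW.
  rewrite ltr0_sg ?subr_lt0// ltr0_norm ?subr_lt0// (ger0_norm V0).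
  by field; rewrite gt_eqF.
- have V0 : V r w - V k w <= 0 by rewrite subr_le0 dec// ltW.
  rewrite gtr0_sg ?subr_gt0// gtr0_norm ?subr_gt0// (ler0_norm V0).
  by field; rewrite gt_eqF.
- by rewrite !subrr sgr0 !normr0; ring.
Qed.

Lemma entropy_euler (k : R) (phi : R * R -> R) (M B : R) (s : nat -> R) (Jl : R) :
  {ae mu, forall X : R, {for X, continuous W}} ->
  {ae mu, forall X, rj j (0, X) @[j --> \oo] --> rho0 (xo X)} ->
  0 <= k <= 1 -> test_half_plane phi ->
  (forall p, half_plane p -> 0 <= phi p) ->
  0 <= M -> 0 <= B -> (forall p, [/\ `|phi p| <= M, `|dt phi p| <= M & `|dx phi p| <= M]) ->
  (forall p, ~ box R B p -> [/\ phi p = 0, dt phi p = 0 & dx phi p = 0]) ->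
  (forall j, k * \int[mu2]_p (chi R p * (Jk R V h Wj k j p.2 / h j *
      psi R lam h xj phi j (p.1 + lam * h j, p.2))) <= s j) ->
  s @ \oo --> Jl ->
  0 <= int_half_plane (fun p => `|eul_rho p - k| * dt phi p
         + kruzhkov_flux (fun r w => r * V r w) (eul_rho p) (eul_w p) k * dx phi p)
       + \int[mu]_y (`|rho0 y - k| * phi (0, y)) + Jl.
Proof.
move=> Wc cr0 k01 tphi phi0 M0 B0 phiM phiB Js cs.
have [c0 c1 c2] := test_continuous R phi tphi.
have mr0 := measurable_rho_xo R rho0 mrho0 xo xo_cont.
have /andP[k0 k1] := k01.
have := entropy_limit R V eps cm A kap al L Cv sp W xo lam h Wj xj rj vj x rl ll W01 Wm phi M B
  tphi M0 B0 phiM phiB Wc phi0 k k01 _ s Jl mr0 (fun X => rho0P (xo X)) cr0 Js cs.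
congr (0 <= _ + _ + _).
  rewrite (euler R V eps cm W xo lam h Wj xj rj vj x rl ll eps0 _ (M + (Cv + Cv) * M) B)//.
  - apply: eq_Rintegral => -[t X] _; congr (_ * _); rewrite /eul_rho /eul_w /Lphi /Q0/= !N1 /kruzhkov_flux.
    by rewrite kruzhkov_lagrangian.
  - have mr := measurable_eul_rho; have mw := measurable_eul_w.
    apply: measurable_funD.
      apply: measurable_funM; last exact: mtest.
      by apply: measurableT_comp => //; exact: measurable_funB.
    apply: measurable_funM; last exact: mtest.
    apply: measurable_funM.
      rewrite (_ : (fun p => _) = (fun y : R => Num.sg (y - k)) \o eul_rho)//.
      apply: (measurableT_comp _ mr).
      apply: nondecreasing_measurable => // a b ab.
      have sgv (y : R) : [\/ y < 0 /\ Num.sg y = -1, y = 0 /\ Num.sg y = 0 | 0 < y /\ Num.sg y = 1].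
        have [y0|y0|->] := ltgtP y 0; last by rewrite sgr0; constructor 2.
          by rewrite ltr0_sg//; constructor 1.
        by rewrite gtr0_sg//; constructor 3.
      by have [[? ->]|[? ->]|[? ->]] := sgv (a - k); have [[? ->]|[? ->]|[? ->]] := sgv (b - k); lra.
    apply: measurable_funB; first exact: measurable_funM.
    apply: measurable_funM => //.
    exact: (sp_meas sp (cst k) eul_w).
  - move=> p _; have [_ d1 d2] := phiM p; apply: (le_trans (ler_normD _ _)); apply: lerD.
      rewrite normrM -[leRHS]mul1r; apply: ler_pM => //; rewrite normr_id.
      by have /andP[a1 a2] := r01 p; rewrite ler_norml; apply/andP; split; lra.
    rewrite normrM; apply: ler_pM => //; rewrite /kruzhkov_flux normrM -[leRHS]mul1r.
    apply: ler_pM => //.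
      by rewrite normr_sg; case: (_ != _).
    apply: (le_trans (ler_normB _ _)); apply: lerD; first by apply: Vb; exact: W01.
    have /andP[v0 v1] := sp_bound sp _ _ k01 (W01 (N p)).
    by rewrite ger0_norm ?mulr_ge0// -[leRHS]mul1r; apply: ler_pM.
  - by move=> p _ nb; have [_ -> ->] := phiB p nb; rewrite !mulr0 addr0.
have mphi : measurable_fun setT (fun X => phi (0, xo X)).
  have m1 := measurableT_comp (mtest _ c0) (pair1_measurable (0 : R)).
  exact: (measurableT_comp m1 (continuous_measurable_fun xo_cont)).
have mF : measurable_fun setT (fun X => `|1 - k / (rho0 \o xo) X| * phi (0, xo X)).
  apply: measurable_funM => //; apply: measurableT_comp => //; apply: measurable_funB => //.
  apply: measurable_funM => //.
  apply: (measurable_inv_ge _ _ R eps) => // X.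
  by have /andP[] := rho0P (xo X).
rewrite /Rintegral (No_int _ mF); congr fine; apply: eq_integral => y _.
rewrite /= NoK; congr (_%:E); rewrite [LHS]mulrAC; congr (_ * _).
have /andP[a1 _] := rho0P y; have y0 : 0 < rho0 y by exact: lt_le_trans a1.
rewrite -{2}(ger0_norm (ltW y0)) -normrM; congr (`|_|).
by rewrite mulrBl mul1r divfK// gt_eqF.
Qed.

End solution.

(** * Piecewise constant data *)

Lemma cvg_sum_seq (R : realType) (I : Type) (r : seq I) (f : I -> nat -> R) (l : I -> R) :
  (forall i, f i @ \oo --> l i) ->
  \sum_(i <- r) f i j @[j --> \oo] --> \sum_(i <- r) l i.
Proof.
move=> cf; elim: r => [|i r ih].
  by rewrite big_nil; under eq_fun do rewrite big_nil; exact: cvg_cst.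
by rewrite big_cons; under eq_fun do rewrite big_cons; apply: cvgD.
Qed.

Lemma bbs_sum (R : realType) (I : Type) (r : seq I) (F : I -> R * R -> R) :
  (forall i, bbs R (F i)) -> bbs R (fun p => \sum_(i <- r) F i p) /\
  \int[(@lebesgue_measure R \x @lebesgue_measure R)%E]_p (\sum_(i <- r) F i p) =
  \sum_(i <- r) \int[(@lebesgue_measure R \x @lebesgue_measure R)%E]_p F i p.
Proof.
move=> bF; elim: r => [|i r [ih1 ih2]].
  split.
    rewrite (_ : (fun p => _) = cst 0); last by apply/funext => p; rewrite big_nil.
    by split; [exact: measurable_cst|exists 0 => p; rewrite normr0|exists 0].
  rewrite big_nil (@eq_Rintegral _ _ _ _ setT (cst 0)) ?Rintegral_cst ?mul0r// => p _.
  by rewrite big_nil.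
rewrite (_ : (fun p => _) = (fun p => F i p + \sum_(i <- r) F i p)); last first.
  by apply/funext => p; rewrite big_cons.
split; first exact: bbsD.
by rewrite bbs_intD// ih2 big_cons.
Qed.

Section piecewise_constant.
Context (R : realType).
Variables (M : nat) (d a : nat -> R) (u : R -> R).
Hypothesis pc : piecewise_constant M d a u.

Lemma pc_increasing m m' : (1 <= m)%N -> (m < m')%N -> (m' <= M)%N -> d m < d m'.
Proof.
case: pc => _ dS _ _ m1; elim: m' => // m' ih; rewrite ltnS leq_eqVlt => /orP[/eqP <-|mm'] m'M.
  by apply: dS; rewrite m1.
apply: (lt_trans (ih mm' (ltnW m'M))); apply: dS.
by rewrite m'M andbT (leq_trans m1 (ltnW mm')).
Qed.

(** [p] counts the jump points that do not exceed [X]; the value 0 stands for the leftmost piece. *)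
Lemma pc_index X : exists p, [/\ (p <= M)%N, u X = a p &
  forall m, (1 <= m <= M)%N -> (d m <= X) = (m <= p)%N].
Proof.
have [M0 _ _ [u0 um uM]] := pc.
have mono m m' : (1 <= m)%N -> (m <= m')%N -> (m' <= M)%N -> d m <= d m'.
  move=> m1; rewrite leq_eqVlt => /orP[/eqP -> //|mm'] m'M.
  by rewrite ltW// pc_increasing.
have [X1|X1] := ltP X (d 1%N).
  exists 0%N; split => //; first exact: u0.
  move=> m /andP[m1 mM]; rewrite leqNgt m1; apply/negbTE; rewrite -ltNge.
  by apply: (lt_le_trans X1); exact: mono.
pose P m := (1 <= m <= M)%N && (d m <= X).
have exP : exists m, P m by exists 1%N; rewrite /P X1 M0.
have PM m : P m -> (m <= M)%N by case/andP => /andP[].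
case: (ex_maxnP exP PM) => p /andP[/andP[p1 pM] pX] maxp.
exists p; split => //.
  have [pM'|Mp] := ltnP p M; last first.
    have e : p = M by apply/eqP; rewrite eqn_leq pM Mp.
    by rewrite e; apply: uM; rewrite -e.
  apply: um; first by rewrite p1.
  rewrite pX ltNge; apply/negP => pX'.
  by have := maxp p.+1; rewrite /P pX' pM' ltnn => /(_ isT).
move=> m /andP[m1 mM]; apply/idP/idP => [mX|mp]; first by apply: maxp; rewrite /P m1 mM.
by apply: le_trans pX; exact: mono.
Qed.

(** Telescoping up to the index of [X] writes the function as a sum of Heaviside steps. Increments
    can then be bounded one jump at a time, and the value depends only on which jump points lie to
    the left. *)
Lemma pc_sum (g : R -> R) X : g (u X) = g (a 0%N) +
  \sum_(1 <= m < M.+1) (d m <= X)%R%:R * (g (a m) - g (a m.-1)).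
Proof.
have [p [pM -> pX]] := pc_index X.
rewrite (@big_cat_nat _ _ _ p.+1)//= [X in _ + (_ + X)]big_nat_cond.
rewrite [X in _ + (_ + X)]big1 ?addr0; last first.
  move=> m; rewrite andbT => /andP[pm mM]; rewrite pX; last by rewrite (leq_ltn_trans (leq0n p) pm).
  by rewrite [(m <= p)%N]leqNgt pm mul0r.
rewrite big_nat_cond (eq_bigr (fun m => g (a m) - g (a m.-1))); last first.
  move=> m; rewrite andbT => /andP[m1 mp]; have mp' : (m <= p)%N by [].
  rewrite pX; first by rewrite mp' mul1r.
  by rewrite m1 (leq_trans mp' pM).
rewrite -big_nat_cond big_add1/= (telescope_sumr (fun m => g (a m)))//.
by rewrite addrC subrK.
Qed.

Lemma pc_right m X : (1 <= m <= M)%N -> d m <= X -> ((m < M)%N -> X < d m.+1) -> u X = a m.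
Proof.
move=> /andP[m1 mM] mX Xm; have [p [pM -> pX]] := pc_index X; congr a.
apply/eqP; rewrite eqn_leq -(pX m) ?m1// mX andbT.
rewrite leqNgt; apply/negP => mp.
have mM' : (m < M)%N by exact: leq_trans mp pM.
by have := Xm mM'; rewrite ltNge pX ?mp// mM'.
Qed.

Lemma pc_left m X : (1 <= m <= M)%N -> X < d m -> ((1 < m)%N -> d m.-1 <= X) -> u X = a m.-1.
Proof.
move=> /andP[m1 mM] Xm mX; have [p [pM -> pX]] := pc_index X; congr a.
have pm : (p < m)%N by rewrite ltnNge -pX ?m1// -ltNge.
apply/eqP; rewrite eqn_leq -ltnS prednK// pm/=.
have [m2|m1'] := ltnP 1 m; last by rewrite (_ : m = 1%N)//; apply/eqP; rewrite eqn_leq m1' m1.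
by rewrite -(pX m.-1) ?mX// -ltnS prednK// m2 (leq_trans (leq_pred m)).
Qed.

End piecewise_constant.

(** * Entropy production at the jumps of W *)

Section jumps.
Context (R : realType).
Local Notation mu := (@lebesgue_measure R).
Local Notation mu2 := (mu \x mu)%E.
Variables (V : R -> R -> R) (eps cm A kap al L Cv : R).
Hypothesis sp : speed_spec R V eps cm A kap al L Cv.
Variables (W xo : R -> R) (lam : R) (h : nat -> R) (Wj : nat -> R -> R).
Variables (xj rj vj : nat -> R * R -> R) (x rl : R * R -> R).
Hypothesis ll : lagrangian_limit R V eps cm W xo lam h Wj xj rj vj x rl.
Hypothesis W01 : forall X, 0 <= W X <= 1.
Variables (n : nat) (Dm a : nat -> R).
Hypothesis pcW : piecewise_constant n Dm a W.
Variables (phi : R * R -> R) (M B : R).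
Hypothesis tphi : test_half_plane phi.
Hypothesis M0 : 0 <= M.
Hypothesis B0 : 0 <= B.
Hypothesis phiM : forall p, [/\ `|phi p| <= M, `|dt phi p| <= M & `|dx phi p| <= M].
Hypothesis phiB : forall p, ~ box R B p -> [/\ phi p = 0, dt phi p = 0 & dx phi p = 0].
Hypothesis phi0 : forall p, half_plane p -> 0 <= phi p.
Variable k : R.
Hypothesis k01 : 0 <= k <= 1.

Let h0 j : 0 < h j. Proof. by case: ll. Qed.
Let lam0 : 0 < lam. Proof. by case: ll. Qed.
Let D0 j : 0 < lam * h j. Proof. exact: mulr_gt0. Qed.

(* The cell [i h, (i + 1) h] with [i h < Dm <= (i + 1) h]. *)
Let cell m j : int := Num.ceil (Dm m / h j) - 1.
Let c m : R := `|V k (a m) - V k (a m.-1)|.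

Let cellP m j : Dm m - h j <= (cell m j)%:~R * h j <= Dm m.
Proof.
have hj := h0 j; have /andP[c1 c2] := Num.Theory.ceil_itv (Dm m / h j).
have e1 : (cell m j)%:~R * h j < Dm m by rewrite -ltr_pdivlMr.
rewrite (ltW e1) andbT lerBlDr.
rewrite ler_pdivrMr// in c2; apply: (le_trans c2); rewrite /cell intrB mulrBl mul1r; lra.
Qed.

(** In the difference of two instances of [pc_sum] at neighbouring nodes, only the steps whose jump
    point lies between these nodes survive, and each jump point selects exactly one cell. *)
Let Jk_le j X : Jk R V h Wj k j X <=
  \sum_(1 <= m < n.+1) c m * (Num.floor (X / h j) == cell m j)%:R.
Proof.
have hj := h0 j; rewrite /Jk !(ll_W ll) floorD1//.
set i := Num.floor (X / h j).
rewrite !(pc_sum R n Dm a W pcW (V k)) opprD addrACA subrr add0r -sumrB.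
apply: (le_trans (ler_norm_sum _ _ _)); apply: ler_sum => m _.
rewrite -mulrBl normrM -/(c m) mulrC; apply: ler_wpM2l; first exact: normr_ge0.
have ii : (i + 1)%:~R * h j = i%:~R * h j + h j by rewrite intrD mulrDl mul1r.
rewrite ii.
have [D1|D1] := leP (Dm m) (i%:~R * h j).
  have -> : Dm m <= i%:~R * h j + h j by apply: (le_trans D1); rewrite lerDl ltW.
  by rewrite subrr normr0.
have [D2|D2] := leP (Dm m) (i%:~R * h j + h j); last by rewrite subrr normr0.
rewrite subr0 normr1 (_ : (i == cell m j) = true)//; apply/eqP.
rewrite /cell (@Num.Theory.ceil_def _ _ (i + 1)) ?addrK//.
by rewrite ltr_pdivlMr// D1 ler_pdivrMr// ii.
Qed.

Let s j := \sum_(1 <= m < n.+1) (k * c m) *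
  \int[mu2]_p (chi R p * ((Num.floor (p.2 / h j) == cell m j)%:R / h j *
    psi R lam h xj phi j (p.1 + lam * h j, p.2))).

Let psiS j (p : R * R) := psi R lam h xj phi j (p.1 + lam * h j, p.2).

Let mpsiS j : measurable_fun setT (psiS j).
Proof. exact: (measurable_psiS R V eps cm W xo lam h Wj xj rj vj x rl ll phi tphi). Qed.

Let bbs_psiS (g : R * R -> R) (C : R) j : measurable_fun setT g -> (forall p, `|g p| <= C) ->
  bbs R (fun p => chi R p * (g p / h j * psiS j p)).
Proof.
move=> mg gC; apply: (half_plane_bbs R _ (C * `|(h j)^-1| * M) (support_radius R cm xo lam B)).
- by apply: measurable_funM => //; exact: measurable_funM.
- move=> p _; rewrite normrM; apply: ler_pM => //.
    by rewrite normrM; apply: ler_pM.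
  by have [] := phiM (Tj R lam h j (p.1 + lam * h j), xj j (p.1 + lam * h j, p.2)).
- move=> p p0 nb; rewrite /psiS.
  by rewrite (psi_boxD R V eps cm W xo lam h Wj xj rj vj x rl ll phi B B0 phiB)// mulr0.
Qed.

Let mcell m j : measurable_fun setT (fun p : R * R => (Num.floor (p.2 / h j) == cell m j)%:R : R).
Proof. exact: (measurable_step R (fun _ i => (i == cell m j)%:R) _ _ ltr01 (h0 j)). Qed.

Let mJk j : measurable_fun setT (fun p : R * R => Jk R V h Wj k j p.2).
Proof.
have mW : measurable_fun setT (fun p : R * R => Wj j p.2).
  have := measurable_step R (fun _ i => W (i%:~R * h j)) _ _ ltr01 (h0 j).
  by congr measurable_fun; apply/funext => p; rewrite (ll_W ll).
rewrite /Jk; apply: (@measurableT_comp _ _ _ _ _ _ (@Num.norm R R)) => //.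
apply: measurable_funB.
  exact: (sp_meas sp (cst k) _ _ (measurable_shift R _ 0 (h j) mW)).
exact: (sp_meas sp (cst k) _ _ mW).
Qed.

Let jump_le j :
  k * \int[mu2]_p (chi R p * (Jk R V h Wj k j p.2 / h j * psiS j p)) <= s j.
Proof.
have /andP[k0 _] := k01; have hj := h0 j.
pose F m p := c m * (chi R p * ((Num.floor (p.2 / h j) == cell m j)%:R / h j * psiS j p)).
have bI m : bbs R (fun p => chi R p * ((Num.floor (p.2 / h j) == cell m j)%:R / h j * psiS j p)).
  apply: (bbs_psiS _ 1) => // p; by case: (_ == _); rewrite ?normr1 ?normr0.
have bF m : bbs R (F m) by apply: (bbsMl R (cst (c m)) _ `|c m|).
have [bS iS] := bbs_sum R nat (index_iota 1 n.+1) F bF.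
have bJ : bbs R (fun p => chi R p * (Jk R V h Wj k j p.2 / h j * psiS j p)).
  apply: (bbs_psiS _ (Cv + Cv)) => // p; rewrite normr_id.
  have Vk X : 0 <= V k (Wj j X) <= Cv.
    by apply: (sp_bound sp) => //; rewrite (ll_W ll).
  have /andP[v0 v1] := Vk (p.2 + h j); have /andP[w0 w1] := Vk p.2.
  by apply: (le_trans (ler_normB _ _)); rewrite !ger0_norm// lerD.
have -> : s j = k * \int[mu2]_p (\sum_(m <- index_iota 1 n.+1) F m p).
  rewrite iS big_distrr/=; apply: eq_bigr => m _; rewrite /F bbs_intZ// mulrA.
  by [].
apply: ler_wpM2l => //; apply: bbs_le => // p.
have [p0|p0] := leP 0 p.1; last first.
  by rewrite chiF// mul0r big1// => m _; rewrite /F chiF// mul0r mulr0.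
rewrite (eq_bigr (fun m => c m * (Num.floor (p.2 / h j) == cell m j)%:R * ((h j)^-1 * psiS j p))).
  rewrite -big_distrl/= chiT// mul1r -mulrA; apply: ler_wpM2r; last exact: Jk_le.
  rewrite mulr_ge0 ?invr_ge0 ?(ltW hj)//; apply: phi0; split => //=.
  by rewrite in_itv/= andbT /Tj mulr_ge0// ltW.
by move=> m _; rewrite /F chiT// mul1r !mulrA.
Qed.

Let jump_cvg : s @ \oo --> \sum_(1 <= m < n.+1) (k * c m) *
  \int[mu]_(t in `[0, +oo[) phi (t, x (t, Dm m)).
Proof.
apply: (cvg_sum_seq R nat (index_iota 1 n.+1) (fun m j => (k * c m) *
  \int[mu2]_p (chi R p * ((Num.floor (p.2 / h j) == cell m j)%:R / h j *
    psi R lam h xj phi j (p.1 + lam * h j, p.2))))) => m.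
have cl := cell_limit R V eps cm A kap al L Cv sp W xo lam h Wj xj rj vj x rl ll phi M B tphi
  B0 phiM phiB (Dm m) (cell m) (cellP m).
have ck : (fun _ : nat => k * c m) @ \oo --> k * c m by exact: cvg_cst.
exact: (cvgM ck cl).
Qed.

(** The factor [k] of the Lagrangian inequality turns a jump of the speed at density [k] into the
    jump of the flux, and [cell_limit] concentrates it on the trajectory issued from the jump
    point. *)
Lemma jump_limit : exists s : nat -> R,
  (forall j, k * \int[mu2]_p (chi R p * (Jk R V h Wj k j p.2 / h j *
      psi R lam h xj phi j (p.1 + lam * h j, p.2))) <= s j) /\
  s @ \oo --> \sum_(1 <= m < n.+1)
    \int[mu]_(t in `[0, +oo[) (`|k * V k (a m) - k * V k (a m.-1)| * phi (t, x (t, Dm m))).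
Proof.
exists s; split; first exact: jump_le.
rewrite (_ : \sum_(1 <= m < n.+1) _ = \sum_(1 <= m < n.+1) (k * c m) *
  \int[mu]_(t in `[0, +oo[) phi (t, x (t, Dm m))); first exact: jump_cvg.
apply: eq_bigr => m _; rewrite -mulrBr normrM (ger0_norm (_ : 0 <= k)); last by case/andP: k01.
rewrite -/(c m) RintegralZl//.
have [c0 _ _] := test_continuous R phi tphi.
apply: (@integrableS _ _ _ mu setT) => //.
apply: (@bounded_support_integrable _ _ R mu `[- B, B]%classic M) => //.
- exact: segment_lty.
- have := measurable_along R V eps cm W xo lam h Wj xj rj vj x rl ll phi c0.
  by move=> m1; exact: (measurableT_comp m1 (pair2_measurable (Dm m))).
- by move=> t _; have [] := phiM (t, x (t, Dm m)).
- move=> t nt; have [//|-> //] := phiB (t, x (t, Dm m)).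
  by move=> /boxP[/= t1 _]; apply: nt; rewrite /= in_itv/= -ler_norml.
Qed.

End jumps.

(** * Curves, components and one-sided traces *)

Section geometry.
Context (R : realType).
Variables (eps cm : R) (W : R -> R) (x N : R * R -> R).
Hypothesis eps0 : 0 < eps.
Hypothesis x_space : forall t X Y, X <= Y -> Y - X <= x (t, Y) - x (t, X) <= (Y - X) / eps.
Hypothesis x_time : forall t s X, t <= s -> 0 <= x (s, X) - x (t, X) <= cm * (s - t).
Hypothesis N1 : forall t X, N (t, x (t, X)) = X.
Hypothesis N2 : forall t y, x (t, N (t, y)) = y.
Hypothesis N3 : forall t y z, (N (t, y) <= N (t, z)) = (y <= z).
Hypothesis N_cont : continuous N.
Variables (n : nat) (Dm a : nat -> R).
Hypothesis pcW : piecewise_constant n Dm a W.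

(** Distinct particles never meet, so every curve is an entire trajectory: it starts at time 0 and
    lives forever. *)
Let ts (m : nat) : R := 0.
Let Ts (m : nat) : \bar R := +oo%E.
Let ys (m : nat) (s : R) : R := x (s, Dm m).

Let ys_lt m m' s : (1 <= m)%N -> (m < m')%N -> (m' <= n)%N -> ys m s < ys m' s.
Proof.
move=> m1 mm' m'M; have lt := pc_increasing R n Dm a W pcW m m' m1 mm' m'M.
have /andP[h1 _] := x_space s _ _ (ltW lt).
by rewrite /ys -subr_gt0 (lt_le_trans _ h1)// subr_gt0.
Qed.

Lemma lagrangian_curves : ordered_curves n ts Ts ys.
Proof.
split=> [m _|m m' m1 mm' m'M s _ _].
  split => //; first exact: ltry.
  exists cm; split; first exact: num_real.
  move=> K cK [s t] _ /=; rewrite /ys.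
  have le (s' t' : R) : s' <= t' -> `|x (s', Dm m) - x (t', Dm m)| <= K * `|s' - t'|.
    move=> st; have /andP[h1 h2] := x_time _ _ (Dm m) st.
    rewrite distrC ger0_norm// distrC (ger0_norm (_ : 0 <= t' - s')) ?subr_ge0//.
    by apply: (le_trans h2); rewrite ler_wpM2r ?subr_ge0// ltW.
  have [st|/ltW st] := leP s t; first exact: le.
  by rewrite distrC (distrC s); exact: le.
exact: ys_lt.
Qed.

(** [N] is continuous, so it maps a connected set onto an interval, and off the curves this interval
    contains no jump point. All Heaviside steps of [pc_sum] then agree at the two points. *)
Lemma components_constant (p q : R * R) :
  connected_component (curves_complement n ts Ts ys) p q -> W (N p) = W (N q).
Proof.
move=> [C [Cp CS cC] Cq].
have iN : is_interval (N @` C).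
  apply/connected_intervalP; apply: connected_continuous_connected => //.
  exact: continuous_subspaceT.
have avoid m : (1 <= m <= n)%N -> ~ (N @` C) (Dm m).
  move=> mn [[t y] Cr Nr]; have [[/= + _]] := CS _ Cr; rewrite in_itv/= andbT => t0.
  apply; exists m => //; split => /=; first by rewrite /lifespan/= t0 ltry.
  by rewrite /ys -Nr N2.
have side m : (1 <= m <= n)%N -> (Dm m <= N p) = (Dm m <= N q).
  move=> mn; have Np : (N @` C) (N p) by exists p.
  have Nq : (N @` C) (N q) by exists q.
  have av := avoid m mn.
  have [Dp|Dp] := leP (Dm m) (N p); have [Dq|Dq] := leP (Dm m) (N q) => //.
    by case: av; apply: (iN _ _ Nq Np); rewrite (ltW Dq).
  by case: av; apply: (iN _ _ Np Nq); rewrite (ltW Dp).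
rewrite !(pc_sum R n Dm a W pcW id); congr (_ + _).
rewrite big_nat_cond [RHS]big_nat_cond; apply: eq_bigr => m.
by rewrite andbT => /andP[m1 mn]; rewrite side// m1.
Qed.

Let N_ge s X y : (X <= N (s, y)) = (x (s, X) <= y).
Proof. by rewrite -(N1 s X) N3 N1. Qed.

(** Just to the right of the curve the label lies in the piece that starts at [Dm m], because the
    next curve, if there is one, is strictly further; the function is constant there, so the limit
    is attained. The last curve has no right neighbour and is treated apart. *)
Lemma trace_right m s : (1 <= m <= n)%N ->
  lim (W (N (s, y)) @[y --> (ys m s)^'+]) = a m.
Proof.
move=> /andP[m1 mn]; apply: cvg_lim => //; apply: cvg_near_cst.
have right : \forall y \near (ys m s)^'+, ys m s < y by exact: nbhs_right_gt.
have [mn'|nm] := ltnP m n; last first.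
  apply: filterS right => y my; apply: (pc_right R n Dm a W pcW); rewrite ?m1//.
    by rewrite N_ge ltW.
  by rewrite ltnNge nm.
have lt : ys m s < ys m.+1 s by exact: ys_lt.
apply: filterS2 right (nbhs_right_lt lt) => y my my'.
apply: (pc_right R n Dm a W pcW); rewrite ?m1//; first by rewrite N_ge ltW.
by move=> _; rewrite ltNge N_ge -ltNge.
Qed.

Lemma trace_left m s : (1 <= m <= n)%N ->
  lim (W (N (s, y)) @[y --> (ys m s)^'-]) = a m.-1.
Proof.
move=> /andP[m1 mn]; apply: cvg_lim => //; apply: cvg_near_cst.
have left : \forall y \near (ys m s)^'-, y < ys m s by exact: nbhs_left_lt.
have [m2|m2] := ltnP 1 m; last first.
  apply: filterS left => y my; apply: (pc_left R n Dm a W pcW); rewrite ?m1//.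
    by rewrite ltNge N_ge -ltNge.
  by rewrite ltnNge m2.
have lt : ys m.-1 s < ys m s.
  by apply: ys_lt => //; rewrite ?prednK// -ltnS prednK.
apply: filterS2 left (nbhs_left_gt lt) => y my my'.
apply: (pc_left R n Dm a W pcW); rewrite ?m1//; first by rewrite ltNge N_ge -ltNge.
by move=> _; rewrite N_ge ltW.
Qed.

End geometry.

Lemma lagrangian_limit_exists (R : realType) (V : R -> R -> R)
    (eps cm A kap al L Cv : R) (W xo : R -> R) :
  speed_spec R V eps cm A kap al L Cv ->
  (forall X, 0 <= W X <= 1) -> measurable_fun setT W ->
  {ae @lebesgue_measure R, forall X : R, {for X, continuous W}} ->
  (forall X Y : R, X <= Y -> Y - X <= xo Y - xo X <= (Y - X) / eps) ->
  exists lam h Wj xj rj vj x rl, lagrangian_limit R V eps cm W xo lam h Wj xj rj vj x rl.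
Proof.
move=> sp W01 Wm Wc xoP.
pose h (j : nat) : R := j.+1%:R^-1.
have h0 j : 0 < h j by rewrite invr_gt0.
have h1 j : h j <= 1 by rewrite invf_le1// ler1n.
have ch : h @ \oo --> 0 by exact: cvg_natSinv.
have [phi [x [phi_ge cx]]] := xx_extraction R V eps cm A kap al L Cv sp W xo h W01 xoP h0 ch h1.
have chphi : h (phi j) @[j --> \oo] --> 0.
  apply/cvgrPdist_lt => e e0; have /cvgrPdist_lt/(_ _ e0) [K _ hK] := ch.
  by exists K => // j /= Kj; apply: hK; exact: leq_trans Kj (phi_ge j).
have ll := scheme_limit R V eps cm A kap al L Cv sp W xo (h \o phi) W01 xoP
  (fun j => h0 (phi j)) chphi x cx Wm Wc (fun j => h1 (phi j)).
by do 8 eexists; exact: ll.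
Qed.

(** At time 0 the specific volume of a cell is the quotient of increments of [xo] in
    [cell_density_cvg], and taking inverses gives the density. *)
Lemma initial_density (R : realType) (V : R -> R -> R) (eps cm : R) (W xo No rho0 : R -> R)
    (lam : R) (h : nat -> R) (Wj : nat -> R -> R) (xj rj vj : nat -> R * R -> R)
    (x rl : R * R -> R) :
  lagrangian_limit R V eps cm W xo lam h Wj xj rj vj x rl ->
  0 < eps -> measurable_fun setT rho0 -> (forall y, eps <= rho0 y <= 1) ->
  cancel xo No -> cancel No xo -> {mono No : y z / y <= z} -> continuous xo ->
  (forall F : R -> R, measurable_fun setT F ->
    (\int[@lebesgue_measure R]_X (F X)%:E =
     \int[@lebesgue_measure R]_y (F (No y) * rho0 y)%:E)%E) ->
  {ae @lebesgue_measure R, forall X, rj j (0, X) @[j --> \oo] --> rho0 (xo X)}.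
Proof.
move=> ll eps0 mrho rhoP xoK NoK No_mono xo_cont No_int.
have h0 j : 0 < h j by case: ll.
have lam0 : 0 < lam by case: ll.
have ch : h @ \oo --> 0 by case: ll.
apply: ae_mono (cell_density_cvg R rho0 eps eps0 mrho rhoP xo No xoK NoK No_mono xo_cont No_int h h0 ch).
move=> X cX; have /andP[r0 _] := rhoP (xo X); have rp : 0 < rho0 (xo X) := lt_le_trans eps0 r0.
rewrite -[rho0 (xo X)]invrK.
rewrite (_ : (fun j => _) = (fun j => ((xo ((Num.floor (X / h j))%:~R * h j + h j) -
  xo ((Num.floor (X / h j))%:~R * h j)) / h j)^-1)).
  by apply: cvgV; [rewrite gt_eqF// invr_gt0|exact: cX].
apply/funext => j; have hj := h0 j; have D0 : 0 < lam * h j by rewrite mulr_gt0.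
have := ll_space ll j 0 X.
rewrite !(ll_xj0 ll)// floorD1// intrD mulrDl mul1r => ->.
by rewrite addrAC subrr add0r mulrAC divff ?gt_eqF// mul1r invrK.
Qed.

Lemma ae_eq_Rintegral (R : realType) (F G : R -> R) :
  measurable_fun setT F -> measurable_fun setT G ->
  {ae @lebesgue_measure R, forall y, F y = G y} ->
  \int[@lebesgue_measure R]_y F y = \int[@lebesgue_measure R]_y G y.
Proof.
move=> mF mG FG; congr fine; apply: ae_eq_integral => //.
- exact/measurable_EFinP.
- exact/measurable_EFinP.
- by apply: ae_mono FG => y e _; rewrite e.
Qed.

(** A discontinuity of the composition at a label forces one of [u] at its position, so these labels
    lie in the image under [No] of a countable set. *)
Lemma comp_continuous_ae (R : realType) (u xo No : R -> R) : BV u ->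
  cancel xo No -> continuous xo ->
  {ae @lebesgue_measure R, forall X : R, {for X, continuous (u \o xo)}}.
Proof.
move=> bv xoK xoc; have cS := BV_countable_discontinuity R u bv.
have cN : countable (No @` [set y | ~ {for y, continuous u}]) by exact: (card_le_trans (card_image_le _ _) cS).
apply: ae_mono (countable_ae R _ cN) => X nX.
apply: continuous_comp; first exact: xoc.
by apply: contrapT => nc; apply: nX; exists (xo X); rewrite ?xoK.
Qed.

Lemma piecewise_constant_comp (R : realType) (M : nat) (d a : nat -> R) (u xo No : R -> R) :
  cancel xo No -> {mono No : y z / y <= z} ->
  piecewise_constant M d a u -> piecewise_constant M (No \o d) a (u \o xo).
Proof.
move=> xoK mono [M0 dS a01 [u0 um uM]].
have le y X : (No y <= X) = (y <= xo X) by rewrite -{1}(xoK X) mono.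
have lt y X : (X < No y) = (xo X < y) by rewrite !ltNge le.
split => //; first by move=> m mM; rewrite /= ltNge mono -ltNge; exact: dS.
split.
- by move=> X /=; rewrite lt; exact: u0.
- by move=> m X mM /=; rewrite le lt; exact: um.
- by move=> X /=; rewrite le; exact: uM.
Qed.

Theorem theorem2p3 (R : realType) (Vmin Vmax : R -> R) (eps : R)
  (hVmin : W2inf_nonneg Vmin) (hVmax : W2inf_nonneg Vmax)
  (ha_min : forall x y, 0 <= x -> x <= y -> y <= 1 -> Vmin y <= Vmin x)
  (ha_max : forall x y, 0 <= x -> x <= y -> y <= 1 -> Vmax y <= Vmax x)
  (ha_le : forall x, 0 <= x <= 1 -> Vmin x <= Vmax x)
  (ha_min1 : Vmin 1 = 0) (ha_max1 : Vmax 1 = 0)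
  (hb : exists2 eta : R, 0 < eta &
    forall w, 0 <= w <= 1 ->
      exists2 g, weak_derivative 2 (fun r => flux Vmin Vmax r w) g &
        {ae @lebesgue_measure R, forall r, 0 < r < 1 -> g r < - eta})
  (heps : 0 < eps < 1)
  (hc : forall x, 0 <= x <= eps -> Vmin x = Vmax x)
  (rhoo wo : R -> R)
  (hrhoo : Linf (@lebesgue_measure R) setT `[eps, 1] rhoo)
  (hwo01 : forall x, 0 <= wo x <= 1) (hwoBV : BV wo) :
  exists rho w : R * R -> R,
    weak_solution (flux Vmin Vmax) rhoo wo rho w /\
    (forall (M : nat) (d a : nat -> R), piecewise_constant M d a wo ->
      entropy_solution (flux Vmin Vmax) M rhoo wo rho w).
Proof.
have [eta eta0 hb'] := hb; have /andP[eps0 eps1] := heps.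
have [cm [A [kap [al [L [Cv sp]]]]]] := speed_specP R Vmin Vmax eps eta hVmin hVmax
  ha_min ha_max ha_le ha_min1 ha_max1 eta0 hb' heps hc.
set V := speed R Vmin Vmax in sp.
have [mrhoo rhooP] := hrhoo.
(* The bounds on the datum hold almost everywhere; this version satisfies them everywhere and gives
   the same integrals. *)
pose rho0 y := Num.max eps (Num.min 1 (rhoo y)).
have mrho0 : measurable_fun setT rho0.
  by apply: measurable_maxr => //; exact: measurable_minr.
have rho0P y : eps <= rho0 y <= 1.
  by rewrite /rho0 le_max lexx/= ge_max (ltW eps1) ge_min lexx.
have rhoE : {ae @lebesgue_measure R, forall y, rhoo y = rho0 y}.
  apply: ae_mono rhooP => y /(_ I); rewrite /= in_itv/= => /andP[r0 r1].
  by rewrite /rho0 (min_idPr r1) (max_idPr r0).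
have [xo [No [xoK NoK No_mono xoP No_int]]] := initial_homeo R rho0 eps eps0 mrho0 rho0P.
have xoc := xo_continuous R eps xo xoP.
have mxo : measurable_fun setT xo by exact: continuous_measurable_fun.
have mNo : measurable_fun setT No by apply: nondecreasing_measurable => // y z; rewrite No_mono.
have mwo : measurable_fun setT wo by exact: BV_measurable.
pose W := wo \o xo.
have W01 X : 0 <= W X <= 1 by exact: hwo01.
have mW : measurable_fun setT W by exact: measurableT_comp.
have Wc := comp_continuous_ae R wo xo No hwoBV xoK xoc.
have [lam [h [Wj [xj [rj [vj [x [rl ll]]]]]]]] :=
  lagrangian_limit_exists R V eps cm A kap al L Cv W xo sp W01 mW Wc xoP.
have [N [N1 N2 N3 Nc]] := lagrangian_inverse R V eps cm W xo lam h Wj xj rj vj x rl ll.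
pose rho := eul_rho R rl N; pose w := eul_w R W N.
have mrho : measurable_fun setT rho by
  exact: (measurable_eul_rho R V eps cm W xo lam h Wj xj rj vj x rl ll N Nc).
have mw : measurable_fun setT w by exact: (measurable_eul_w R W mW N Nc).
have rlP p : eps <= rl p <= 1 by case: ll.
have Lrho : Linf_half_plane rho.
  split; first exact: measurable_funTS.
  apply: aeW => p _; rewrite /= in_itv/= /rho /eul_rho.
  by have /andP[r0 ->] := rlP (p.1, N p); rewrite (le_trans (ltW eps0)).
have Lw : Linf_half_plane w.
  split; first exact: measurable_funTS.
  by apply: aeW => p _; rewrite /= in_itv/=; exact: W01.
have mphi phi : test_half_plane phi -> measurable_fun setT (fun y : R => phi (0, y)).
  move=> tphi; have [c0 _ _] := test_continuous R phi tphi.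
  exact: (measurableT_comp (continuous_measurable2 R phi c0) (pair1_measurable (0 : R))).
(* One identity for both equations: [om] is the constant 1 for the density and [W] for the second
   unknown, where [W (No y) = wo y]. *)
have weak (om : R -> R) (phi : R * R -> R) : measurable_fun setT om ->
    (forall X, `|om X| <= 1) -> test_half_plane phi ->
    int_half_plane (fun p => rho p * om (N p) * dt phi p +
      flux Vmin Vmax (rho p) (w p) * om (N p) * dx phi p) +
    \int[@lebesgue_measure R]_y (rhoo y * om (No y) * phi (0, y)) = 0.
  move=> mom om1 tphi.
  rewrite -[RHS](weak_euler R V eps cm A kap al L Cv sp W xo No rho0 lam h Wj xj rj vj x rl
    ll W01 mW NoK xoc No_int N N1 Nc om 1 phi mom om1 tphi); congr (_ + _).
  have momNo : measurable_fun setT (om \o No) by exact: measurableT_comp.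
  have mp := mphi _ tphi.
  apply: ae_eq_Rintegral; first by apply: measurable_funM => //; exact: measurable_funM.
    by apply: measurable_funM => //; exact: measurable_funM.
  by apply: ae_mono rhoE => y ->.
have W_rho : weak_form_rho (flux Vmin Vmax) rhoo rho w.
  move=> phi tphi; rewrite -[RHS](weak (cst 1) phi _ _ tphi)//=; last by rewrite normr1.
  congr (_ + _).
    by congr int_half_plane; apply/funext => p; rewrite !mulr1.
  by apply: eq_Rintegral => y _; rewrite mulr1.
have W_rhow : weak_form_rhow (flux Vmin Vmax) rhoo wo rho w.
  move=> phi tphi; rewrite -[RHS](weak W phi mW _ tphi)//; last first.
    by move=> X; have /andP[w0 w1] := W01 X; rewrite ger0_norm.
  by congr (_ + _); apply: eq_Rintegral => y _; rewrite /W /= NoK.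
exists rho, w; split; first by split.
move=> M d a pcwo; split => //.
have pcW := piecewise_constant_comp R M d a wo xo No xoK No_mono pcwo.
have sl := ll_space_lim ll.
have tl := ll_time_lim ll.
(* The jump at [d m] sits on the particle of label [No (d m)], whose trajectory starts at [d m]. *)
exists (fun=> 0), (fun=> +oo%E), (fun m s => x (s, No (d m))); split.
- exact: (lagrangian_curves R eps cm W x sl tl M (No \o d) a pcW).
- by move=> p q; exact: (components_constant R W x N N2 Nc M (No \o d) a pcW p q).
move=> phi k tphi phi0 k01.
have [K [B [M0 B0 phiM phiB]]] := test_bounds R phi tphi.
have [s [sJ cs]] := jump_limit R V eps cm A kap al L Cv sp W xo lam h Wj xj rj vj x rl ll W01
  M (No \o d) a pcW phi K B tphi B0 phiM phiB phi0 k k01.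
have cr0 := initial_density R V eps cm W xo No rho0 lam h Wj xj rj vj x rl ll eps0 mrho0 rho0P
  xoK NoK No_mono xoc No_int.
have := entropy_euler R V eps cm A kap al L Cv sp W xo No rho0 lam h Wj xj rj vj x rl ll W01 mW
  mrho0 rho0P NoK xoc No_int N N1 Nc k phi K B s _ Wc cr0 k01 tphi phi0 M0 B0 phiM phiB sJ cs.
congr (0 <= _ + _ + _).
  have mp := mphi _ tphi.
  apply: ae_eq_Rintegral; last by apply: ae_mono rhoE => y ->.
    by apply: measurable_funM => //; apply: measurableT_comp => //; exact: measurable_funB.
  by apply: measurable_funM => //; apply: measurableT_comp => //; exact: measurable_funB.
rewrite big_nat_cond [RHS]big_nat_cond; apply: eq_bigr => m.
rewrite andbT ltnS => mM.
rewrite (_ : lifespan 0 +oo%E = `[0, +oo[%classic); last first.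
  by apply/seteqP; split => t; rewrite /lifespan/= in_itv/= ltry ?andbT.
apply: eq_Rintegral => t _.
have tr := trace_right R eps W x N sl N1 N3 M (No \o d) a pcW m t mM.
have tl' := trace_left R eps W x N sl N1 N3 M (No \o d) a pcW m t mM.
congr (`|_ - _| * _).
  exact: (congr1 (flux Vmin Vmax k) (esym tr)).
exact: (congr1 (flux Vmin Vmax k) (esym tl')).
Qed.
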